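(* Let $m\ge1$ and let $V=e^{-x_0\underline{D}}\circ e^{\frac{\Delta}{2}}$ be the map sending $f\in L^2(\mathbb{T}^m,dx)\otimes\mathbb{C}_m$ to the $\mathbb{C}_m$-valued function $$V(f)(x_0,\underline{x})=\sum_{j=0}^\infty(-1)^j\frac{x_0^j}{j!}\,\underline{D}^j\left(e^{\frac{\Delta}{2}}f\right)(\underline{x})$$ on $\mathbb{T}^m\times\mathbb{R}$. Let $d\mu=\frac{1}{\sqrt{\pi}}e^{-x_0^2}\,dx_0\,dx$ on $\mathbb{T}^m\times\mathbb{R}$ and let $\mathcal{M}L^2(\mathbb{T}^m\times\mathbb{R},d\mu)$ be the Hilbert space of $\mathbb{C}_m$-valued monogenic functions on $\mathbb{T}^m\times\mathbb{R}$ which are $L^2$ with respect to $d\mu$. Then $$V:L^2(\mathbb{T}^m,dx)\otimes\mathbb{C}_m\to\mathcal{M}L^2(\mathbb{T}^m\times\mathbb{R},d\mu)$$ is a unitary isomorphism.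
   Context: $\mathbb{C}_m=\mathbb{R}_m\otimes\mathbb{C}$ is the complex Clifford algebra with generators $e_1,\dots,e_m$, $e_ie_j+e_je_i=-2\delta_{ij}$, with basis $e_A$, $A\subset\{1,\dots,m\}$ ($e_\emptyset=1$), and standard Hermitian inner product $(\sum_A u_Ae_A,\sum_B v_Be_B)=\sum_A u_A\overline{v_A}$; the inner product of $\mathbb{C}_m$-valued functions in an $L^2$ space is the integral of the pointwise inner product. $\mathbb{T}^m=\mathbb{R}^m/(2\pi\mathbb{Z})^m$ is the torus with $2\pi$-periodic coordinates $(x_1,\dots,x_m)$, $dx$ is its unit volume Haar measure (the same $dx$ is used in $d\mu$), $\Delta=\sum_{j=1}^m\partial_{x_j}^2$, and $e^{\Delta/2}f$ is the time-$1$ solution of $\partial_th=\frac12\Delta h$, $h_0=f$ (componentwise). $\underline{D}=\sum_{j=1}^m e_j\partial_{x_j}$ acts by Clifford multiplication on the left. A continuously differentiable $\mathbb{C}_m$-valued function $F(x_0,\underline{x})$ on $\mathbb{T}^m\times\mathbb{R}$ ($x_0\in\mathbb{R}$, $\underline{x}\in\mathbb{T}^m$) is monogenic if $(\partial_{x_0}+\underline{D})F=0$. *)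

(* Defs.v *)
From HB Require Import structures.
From mathcomp Require Import all_boot all_order all_algebra.
From mathcomp Require Import all_classical all_reals all_analysis.
From mathcomp Require Import complex ring.

Set Implicit Arguments.
Unset Strict Implicit.
Unset Printing Implicit Defensive.
Import Order.TTheory GRing.Theory Num.Theory.
Import numFieldNormedType.Exports.
Local Open Scope classical_set_scope.
Local Open Scope ring_scope.

(* An element is the family of its coordinates in the basis e_A, where
   e_A = e_(a1) ... e_(ak) for A = {a1 < ... < ak}. *)
Definition clifford (R : realType) (m : nat) := {ffun {set 'I_m} -> R[i]}.

(* Sorting e_A e_B takes one transposition for each (a, b) in A x B with
   b < a and one contraction e_a ^+ 2 = -1 for each a in A :&: B; hence
   e_A e_B = (-1) ^+ (cl_inv A B) e_(A symdiff B). *)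
Definition cl_inv (m : nat) (A B : {set 'I_m}) : nat :=
  \sum_(a in A) \sum_(b in B) (b <= a)%N.

Definition symdiff (m : nat) (A B : {set 'I_m}) : {set 'I_m} :=
  (A :\: B) :|: (B :\: A).

Section CliffordAlgebra.
Variables (R : realType) (m : nat).
Local Notation Cl := (clifford R m).
Implicit Types (u v w : Cl) (A B C : {set 'I_m}).

HB.instance Definition _ := GRing.Zmodule.on Cl.

Definition cl_basis A : Cl := [ffun B => (B == A)%:R].

Definition cl_gen (i : 'I_m) : Cl := cl_basis [set i].

Definition cl_mul u v : Cl :=
  [ffun C => \sum_A \sum_(B | symdiff A B == C)
               (-1) ^+ cl_inv A B * u A * v B].

Definition cl_scale (a : R[i]) u : Cl := [ffun A => a * u A].

Let in_symdiff A B i : (i \in symdiff A B) = (i \in A) (+) (i \in B).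
Proof. by rewrite !inE; case: (i \in A); case: (i \in B). Qed.

Let symdiffA : associative (@symdiff m).
Proof. by move=> A B C; apply/setP => i; rewrite !in_symdiff addbA. Qed.

Let symdiffK A : involutive (symdiff A).
Proof. by move=> B; apply/setP => i; rewrite !in_symdiff addbA addbb. Qed.

Let symdiff0 A : symdiff finset.set0 A = A.
Proof. by apply/setP => i; rewrite in_symdiff inE. Qed.

Let symdiffr0 A : symdiff A finset.set0 = A.
Proof. by apply/setP => i; rewrite in_symdiff inE addbF. Qed.

Let sgn A B : R[i] := (-1) ^+ cl_inv A B.

Let sgnE A B :
  sgn A B = \prod_i \prod_j (-1) ^+ [&& i \in A, j \in B & (j <= i)%N].
Proof.
rewrite /sgn /cl_inv -prodrXr big_mkcond /=; apply: eq_bigr => i _.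
case: (i \in A) => /=; last by rewrite big1.
rewrite -prodrXr big_mkcond /=; apply: eq_bigr => j _.
by case: (j \in B).
Qed.

Let sgnDl A B C : sgn (symdiff A B) C = sgn A C * sgn B C.
Proof.
rewrite !sgnE -big_split; apply: eq_bigr => i _ /=.
rewrite -big_split; apply: eq_bigr => j _ /=.
by rewrite in_symdiff andb_addl signr_addb.
Qed.

Let sgnDr A B C : sgn A (symdiff B C) = sgn A B * sgn A C.
Proof.
rewrite !sgnE -big_split; apply: eq_bigr => i _ /=.
rewrite -big_split; apply: eq_bigr => j _ /=.
by rewrite in_symdiff andb_addl andb_addr signr_addb.
Qed.

Let sgn0l A : sgn finset.set0 A = 1.
Proof. by rewrite /sgn /cl_inv big_set0. Qed.

Let sgn0r A : sgn A finset.set0 = 1.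
Proof. by rewrite /sgn /cl_inv big1 // => i _; rewrite big_set0. Qed.

Let cl_mulE u v C :
  cl_mul u v C = \sum_A sgn A (symdiff A C) * u A * v (symdiff A C).
Proof.
rewrite ffunE; apply: eq_bigr => A _.
rewrite (big_pred1 (symdiff A C)) // => B /=.
by apply/eqP/eqP => [<-|->]; rewrite symdiffK.
Qed.

Let sgnK A B : sgn A B * sgn A B = 1.
Proof. by rewrite /sgn -expr2 sqrr_sign. Qed.

Let cl_mulA : associative cl_mul.
Proof.
move=> u v w; apply/ffunP => D; rewrite !cl_mulE.
under eq_bigr => A _ do rewrite cl_mulE mulr_sumr.
under [RHS]eq_bigr => A _ do rewrite cl_mulE mulr_sumr mulr_suml.
rewrite [RHS]exchange_big /=; apply: eq_bigr => A _.
rewrite [RHS](reindex_inj (can_inj (symdiffK A))) /=.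
apply: eq_bigr => B _; rewrite !symdiffK.
have -> : symdiff B (symdiff A D) = symdiff (symdiff A B) D.
  by apply/setP => i; rewrite !in_symdiff addbCA addbA.
have -> : sgn A (symdiff A D) = sgn A (symdiff (symdiff A B) D) * sgn A B.
  by rewrite !sgnDr [sgn A A * sgn A B]mulrC -!mulrA mulrCA ![sgn A B * _]mulrC
             -!mulrA sgnK mulr1.
by rewrite sgnDl; ring.
Qed.

Let cl_mul1l : left_id (cl_basis finset.set0) cl_mul.
Proof.
move=> u; apply/ffunP => C; rewrite cl_mulE (bigD1 finset.set0) //= big1.
  by rewrite sgn0l symdiff0 ffunE eqxx !mul1r addr0.
by move=> A /negPf A0; rewrite ffunE A0 mulr0 mul0r.
Qed.

Let cl_mul1r : right_id (cl_basis finset.set0) cl_mul.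
Proof.
move=> u; apply/ffunP => C; rewrite cl_mulE (bigD1 C) //= big1.
  have -> : symdiff C C = finset.set0.
    by apply/setP => i; rewrite in_symdiff addbb inE.
  by rewrite sgn0r ffunE eqxx mulr1 mul1r addr0.
move=> A /negPf AC; rewrite ffunE; case: eqP => [E|_]; last by rewrite mulr0.
by move: AC; rewrite -(symdiffK A C) E symdiffr0 eqxx.
Qed.

Let cl_mulDl : left_distributive cl_mul +%R.
Proof.
move=> u v w; apply/ffunP => C; rewrite [RHS]ffunE !cl_mulE -big_split.
by apply: eq_bigr => A _; rewrite ffunE mulrDr mulrDl.
Qed.

Let cl_mulDr : right_distributive cl_mul +%R.
Proof.
move=> u v w; apply/ffunP => C; rewrite [RHS]ffunE !cl_mulE -big_split.
by apply: eq_bigr => A _; rewrite ffunE mulrDr.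
Qed.

Let cl_1neq0 : cl_basis finset.set0 != 0.
Proof.
apply/eqP => /ffunP/(_ finset.set0)/eqP; rewrite !ffunE eqxx.
by rewrite oner_eq0.
Qed.

HB.instance Definition _ := GRing.Zmodule_isNzRing.Build Cl
  cl_mulA cl_mul1l cl_mul1r cl_mulDl cl_mulDr cl_1neq0.

Let mulclE u v C :
  (u * v) C = \sum_A sgn A (symdiff A C) * u A * v (symdiff A C).
Proof. exact: cl_mulE. Qed.

Let cl_scaleA a b u : cl_scale a (cl_scale b u) = cl_scale (a * b) u.
Proof. by apply/ffunP => A; rewrite !ffunE mulrA. Qed.

Let cl_scale1 : left_id 1 cl_scale.
Proof. by move=> u; apply/ffunP => A; rewrite !ffunE mul1r. Qed.

Let cl_scaleDr : right_distributive cl_scale +%R.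
Proof. by move=> a u v; apply/ffunP => A; rewrite !ffunE mulrDr. Qed.

Let cl_scaleDl u : {morph cl_scale^~ u : a b / a + b}.
Proof. by move=> a b; apply/ffunP => A; rewrite !ffunE mulrDl. Qed.

HB.instance Definition _ := GRing.Zmodule_isLmodule.Build R[i] Cl
  cl_scaleA cl_scale1 cl_scaleDr cl_scaleDl.

Let cl_scaleAl (a : R[i]) u v : a *: (u * v) = (a *: u) * v.
Proof.
apply/ffunP => C; rewrite [LHS]ffunE !mulclE mulr_sumr.
by apply: eq_bigr => A _; rewrite [in RHS]ffunE; ring.
Qed.

Let cl_scaleAr (a : R[i]) u v : a *: (u * v) = u * (a *: v).
Proof.
apply/ffunP => C; rewrite [LHS]ffunE !mulclE mulr_sumr.
by apply: eq_bigr => A _; rewrite [in RHS]ffunE; ring.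
Qed.

HB.instance Definition _ := GRing.Lmodule_isLalgebra.Build R[i] Cl cl_scaleAl.
HB.instance Definition _ := GRing.Lalgebra_isAlgebra.Build R[i] Cl cl_scaleAr.

Lemma cl_basis_mul A B :
  cl_basis A * cl_basis B = (-1) ^+ cl_inv A B *: cl_basis (symdiff A B).
Proof.
apply/ffunP => C; rewrite mulclE [RHS]ffunE (bigD1 A) //= big1.
  rewrite !ffunE eqxx mulr1 addr0 [C == _]eq_sym.
  have -> : (symdiff A C == B) = (symdiff A B == C).
    by apply/eqP/eqP => [<-|<-]; rewrite symdiffK.
  by case: eqP => [<-|_]; rewrite ?mulr0 // symdiffK.
by move=> D /negPf DA; rewrite ffunE DA mulr0 mul0r.
Qed.

Lemma cl_gen_mul (i j : 'I_m) :
  cl_gen i * cl_gen j + cl_gen j * cl_gen i = (- (i == j)%:R *+ 2)%:A :> Cl.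
Proof.
rewrite !cl_basis_mul /cl_inv !big_set1.
have [<-|ij] := eqVneq i j.
  rewrite leqnn expr1 scaleN1r; have -> : symdiff [set i] [set i] = finset.set0.
    by rewrite /symdiff finset.setDv finset.setU0.
  by rewrite mulr2n scalerDl scaleN1r.
have -> : symdiff [set j] [set i] = symdiff [set i] [set j].
  by rewrite /symdiff finset.setUC.
rewrite oppr0 mul0rn scale0r; have [ji|] := leqP j i; last first.
  by move=> /ltnW -> ; rewrite expr0 expr1 scale1r scaleN1r subrr.
by rewrite leqNgt ltn_neqAle ji eq_sym ij /= expr1 expr0 scaleN1r scale1r addNr.
Qed.

Lemma cl_basisE A : cl_basis A = \prod_(i in A) cl_gen i :> Cl.
Proof.
suff prodE (s : seq 'I_m) : sorted ltn [seq val i | i <- s] ->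
    \prod_(i <- s) cl_gen i = cl_basis [set:: s] :> Cl.
  rewrite -big_filter prodE.
    congr cl_basis; apply/setP => i.
    by rewrite inE mem_filter mem_index_enum andbT.
  rewrite sorted_map sorted_filter //; first by move=> ? ? ?; exact: ltn_trans.
  by rewrite -sorted_map /index_enum -enumT val_enum_ord iota_ltn_sorted.
elim: s => [_|i s IHs]; first by rewrite big_nil finset.set_nil.
rewrite [sorted _ _]/= path_sortedE; last exact: ltn_trans.
move=> /andP[/allP lt_i /IHs srt]; rewrite big_cons srt cl_basis_mul.
have lt_is j : j \in s -> (i < j)%N by move=> js; apply/lt_i/map_f.
rewrite /cl_inv big_set1 big1 ?expr0 ?scale1r.
  congr cl_basis; apply/setP => j; rewrite in_symdiff !inE.
  by case: eqP => // ->; case: (boolP (i \in s)) => // /lt_is; rewrite ltnn.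
by move=> j; rewrite inE => /lt_is; rewrite ltnNge => /negPf ->.
Qed.

(* The standard Hermitian inner product, for which (e_A)_A is orthonormal. *)
Definition cl_dot u v : R[i] := \sum_A u A * ((v A)^*)%C.

End CliffordAlgebra.
Arguments cl_gen {R m} i.
Arguments cl_basis {R m} A.

Section CliffordCalculus.
Variables (R : realType) (m : nat).
Local Notation Cl := (clifford R m).

(* The real coordinates (A, real or imaginary part) of an element. *)
Definition cl_coord (A : {set 'I_m}) (b : bool) (u : Cl) : R :=
  if b then complex.Im (u A) else complex.Re (u A).

(* Extends an operator on real-valued functions to Clifford-valued
   functions, coordinate by coordinate. *)
Definition cl_lift (T : Type) (phi : (T -> R) -> R) (f : T -> Cl) : Cl :=
  [ffun A => Complex (phi (cl_coord A false \o f)) (phi (cl_coord A true \o f))].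

Definition cl_derive (E : normedModType R) (v : E) (f : E -> Cl) (x : E) : Cl :=
  cl_lift (fun g => 'D_v g x) f.

Definition cl_lim (u : nat -> Cl) : Cl := cl_lift (fun s => limn s) u.

Definition cl_cvgn (u : nat -> Cl) : Prop :=
  forall A b, cvgn (cl_coord A b \o u).

(* k times continuously differentiable on the open set U. *)
Fixpoint Ck (E : normedModType R) (U : set E) (k : nat) (g : E -> R) : Prop :=
  (forall x, U x -> {for x, continuous g}) /\
  (if k is k'.+1 then
     forall v, (forall x, U x -> derivable g x v) /\ Ck U k' (fun x => 'D_v g x)
   else True).

Definition cl_Ck (E : normedModType R) (U : set E) (k : nat) (f : E -> Cl) :=
  forall A b, Ck U k (cl_coord A b \o f).

End CliffordCalculus.

(* A function on the torus is a function on R^m that is 2 pi-periodic in each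
   variable; a function on T^m x R is curried as x_0 |-> x |-> F x_0 x. *)
Section Torus.
Variables (R : realType) (m : nat).
Local Notation Cl := (clifford R m).
Implicit Types (f g u : 'rV[R]_m -> Cl) (F : R -> 'rV[R]_m -> Cl).

Definition periodic f : Prop :=
  forall (j : 'I_m) (x : 'rV[R]_m), f (x + (2 * pi) *: delta_mx 0 j) = f x.

Definition partial (j : 'I_m) f : 'rV[R]_m -> Cl :=
  cl_derive (delta_mx 0 j) f.

Definition dirac_op f : 'rV[R]_m -> Cl :=
  fun x => \sum_(j < m) cl_gen j * partial j f x.

Definition laplacian f : 'rV[R]_m -> Cl :=
  fun x => \sum_(j < m) partial j (partial j f) x.

Definition monogenic F : Prop :=
  [/\ forall x0, periodic (F x0),
      cl_Ck [set: R * 'rV[R]_m] 1 (fun z => F z.1 z.2)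
    & forall x0 x,
        cl_derive (1 : R) (F ^~ x) x0 + dirac_op (F x0) x = 0].

End Torus.

Section TupleProbability.
Variable R : realType.
Local Notation TR := (measurableTypeR R).

Let tcons (n : nat) (p : TR * n.-tuple TR) : n.+1.-tuple TR :=
  [tuple of p.1 :: p.2].

Let measurable_tcons n : measurable_fun [set: TR * n.-tuple TR] (@tcons n).
Proof. by apply: measurable_cons. Qed.

HB.instance Definition _ n :=
  isMeasurableFun.Build _ _ _ _ (@tcons n) (@measurable_tcons n).

(* The n-fold product of a probability P on the line. *)
Fixpoint tuple_prob (P : probability TR R) (n : nat) :
    probability (n.-tuple TR) R :=
  if n is n'.+1 then distribution (P \x tuple_prob P n')%E (@tcons n')
  else \d_[tuple].

End TupleProbability.

Section Measures.
Variables (R : realType) (m : nat).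
Local Notation TR := (measurableTypeR R).

Let lt0_2pi : (0 : R) < 2 * pi.
Proof. by rewrite mulr_gt0 // pi_gt0. Qed.

(* The unit volume Haar measure of the torus, on the fundamental domain
   [0, 2 pi]^m. *)
Definition haar : probability (m.-tuple TR) R :=
  tuple_prob (uniform_prob lt0_2pi) m.

Definition gauss : probability TR R := normal_prob 0 (Num.sqrt 2)^-1.

Lemma gaussE (U : set TR) : gauss U =
  (\int[lebesgue_measure]_(x in U) ((Num.sqrt pi)^-1 * expR (- x ^+ 2))%:E)%E.
Proof.
have s2 : (Num.sqrt 2 : R)^-1 ^+ 2 = 2^-1 by rewrite exprVn sqr_sqrtr.
rewrite /gauss /= /normal_prob; apply: eq_integral => x _; congr EFin.
rewrite normal_pdfE ?invr_eq0 ?sqrtr_eq0 -?ltNge // /normal_peak /normal_fun s2.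
by rewrite subr0 -mulr_natr mulrAC mulVf // mul1r -mulr_natr mulVf // invr1 mulr1.
Qed.

Definition cylinder_measure : probability (TR * m.-tuple TR)%type R := (gauss \x haar)%E.

Definition torus_point (t : m.-tuple TR) : 'rV[R]_m := \row_i tnth t i.

End Measures.

Section L2.
Variables (R : realType) (m : nat).
Local Notation TR := (measurableTypeR R).
Local Notation Cl := (clifford R m).

Definition L2fun d (T : measurableType d) (mu : {measure set T -> \bar R})
    (f : T -> Cl) : Prop :=
  forall A b, cl_coord A b \o f \in Lfun mu 2%:E.

Definition L2dot d (T : measurableType d) (mu : {measure set T -> \bar R})
    (f g : T -> Cl) : R[i] :=
  Complex (\int[mu]_t complex.Re (cl_dot (f t) (g t)))
          (\int[mu]_t complex.Im (cl_dot (f t) (g t))).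

Definition on_torus (f : 'rV[R]_m -> Cl) : m.-tuple TR -> Cl :=
  fun t => f (torus_point t).

Definition on_cylinder (F : R -> 'rV[R]_m -> Cl) : TR * m.-tuple TR -> Cl :=
  fun z => F z.1 (torus_point z.2).

(* L^2(T^m, dx) (x) C_m, before identifying functions equal a.e. *)
Definition L2torus (f : 'rV[R]_m -> Cl) : Prop :=
  periodic f /\ L2fun (haar R m) (on_torus f).

Definition ML2 (F : R -> 'rV[R]_m -> Cl) : Prop :=
  monogenic F /\ L2fun (cylinder_measure R m) (on_cylinder F).

(* A classical solution for t > 0; since f is only square integrable, h_0 = f
   means that h_t tends to f in L^2 when t tends to 0+. *)
Definition heat_solution (f : 'rV[R]_m -> Cl) (h : R -> 'rV[R]_m -> Cl) : Prop :=
  [/\ forall t, 0 < t -> periodic (h t),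
      cl_Ck [set z : R * 'rV[R]_m | 0 < z.1] 2 (fun z => h z.1 z.2),
      forall t x, 0 < t ->
        cl_derive (1 : R) (h ^~ x) t = (2^-1 : R[i]) *: laplacian (h t) x
    & forall A b,
        (fun t => ('N[haar R m]_2%:E
           [EFin \o (cl_coord A b \o on_torus (h t - f)%R)])%E) @ 0^'+ --> 0%E].

(* The time-1 value of the solution; the total extension 0 is irrelevant, as
   every square integrable f has a solution. *)
Definition exp_half_laplacian (f : 'rV[R]_m -> Cl) : 'rV[R]_m -> Cl :=
  xget (fun _ _ => 0) [set h | heat_solution f h] 1.

Definition exp_dirac_psum (x0 : R) (u : 'rV[R]_m -> Cl) (x : 'rV[R]_m) (n : nat)
    : Cl :=
  \sum_(0 <= j < n)
    ((-1) ^+ j * (x0 ^+ j / j`!%:R)%:C%C) *: iter j (@dirac_op R m) u x.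

Definition exp_dirac (x0 : R) (u : 'rV[R]_m -> Cl) : 'rV[R]_m -> Cl :=
  fun x => cl_lim (exp_dirac_psum x0 u x).

Definition V (f : 'rV[R]_m -> Cl) : R -> 'rV[R]_m -> Cl :=
  fun x0 => exp_dirac x0 (exp_half_laplacian f).

End L2.

(* Main.v *)
(* The functions cas (k . x) = cos (k . x) + sin (k . x), k in Z^m, are a real
   orthonormal basis of L^2(T^m). On coefficients c_k in this basis the heat
   flow is multiplication by exp (- t |k|^2 / 2), while D exchanges c_k and
   c_(-k) up to multiplication by the vector k, whose Clifford square is
   - |k|^2. Hence a monogenic F has coefficients
     c_k(x0) = cosh (x0 |k|) c_k(0) + sinh (x0 |k|) (k / |k|) c_(-k)(0),
   and the Gaussian moments (exp (|k|^2) +- 1) / 2 of cosh^2 and sinh^2 give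
   |F|^2 = \sum_k exp (|k|^2) |c_k(0)|^2. Since V f has the coefficients
   exp (- |k|^2 / 2) c_k(f) at x0 = 0, V is isometric; and F = V f for the f
   with coefficients exp (|k|^2 / 2) c_k(0), square summable when |F| < oo. *)
Require Import Defs.
From HB Require Import structures.
From mathcomp Require Import all_boot all_order all_algebra.
From mathcomp Require Import all_classical all_reals all_analysis.
From mathcomp Require Import measurable_realfun complex ring lra.

Set Implicit Arguments.
Unset Strict Implicit.
Unset Printing Implicit Defensive.
Import Order.TTheory GRing.Theory Num.Theory.
Import numFieldNormedType.Exports.
Local Open Scope classical_set_scope.
Local Open Scope ring_scope.

(** All analysis is done on the real coordinates [cl_coord A b]. Left multiplication by a generator
    permutes them up to sign, so limits, derivatives and integrals are needed for real functions
    only; this is why the real kernels cas are preferred to exponentials. Differentiating cas (k .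
    x) yields a multiple of cas (- k . x), so series carry two coefficient families, one on each
    kernel, and their form survives every derivative. Regularity is decoupled from L^2: coefficients
    are only asked to be [tempered], a growth condition stable under polynomial factors in k, and a
    Gaussian weight then permits termwise differentiation to any order. In the converse direction no
    expansion of F is summed. F and V f are compared slice by slice: their coefficients obey the
    same differential equation in x_0, and continuous periodic functions with equal coefficients are
    equal everywhere. Energies are computed in the extended reals, so that the norm identity itself
    proves square integrability; polarization turns it into an isometry. *)

(** * Limits, continuity and directional derivatives of dominated series *)

Section SeriesLimits.
Context {R : realType}.

(** The Weierstrass test together with its error bound: the remainder is controlled by that of the
    majorant, uniformly in any parameter on which [u] depends. *)
Lemma series_tail (u M : nat -> R) : (forall n, `|u n| <= M n) ->
  cvgn (series M) -> cvgn (series u) /\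
  forall N, `|limn (series u) - series u N| <= limn (series M) - series M N.
Proof.
move=> uM cM.
have M0 n : 0 <= M n by exact: le_trans (uM n).
have cu : cvgn (series u).
  by apply: normed_cvg; apply: series_le_cvg cM => // n /=; exact: normr_ge0.
split=> // N.
have cuN : (fun n => `|series u n - series u N|) @ \oo -->
    `|limn (series u) - series u N|.
  by apply: cvg_norm; apply: cvgB => //; exact: cvg_cst.
rewrite -(cvg_lim _ cuN)//; apply: limr_le; first by apply/cvg_ex; eexists; exact: cuN.
near=> n.
have Nn : (N <= n)%N by near: n; exact: nbhs_infty_ge.
rewrite sub_series_geq//.
apply: (le_trans (ler_norm_sum _ _ _)).
apply: (@le_trans _ _ (series M n - series M N)).
  by rewrite sub_series_geq//; exact: ler_sum.
rewrite lerB//; apply: nondecreasing_cvgn_le => //.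
exact/nondecreasing_series.
Unshelve. all: by end_near. Qed.

(* Tannery's theorem. *)
Lemma cvg_lim_series (T : Type) (F : set_system T) {FF : ProperFilter F}
    (g : nat -> T -> R) (M l : nat -> R) :
  cvgn (series M) ->
  (\forall y \near F, forall n, `|g n y| <= M n) ->
  (forall n, g n y @[y --> F] --> l n) ->
  limn (series (g^~ y)) @[y --> F] --> limn (series l).
Proof.
move=> cM gM gl.
have lM n : `|l n| <= M n.
  have cn : `|g n y| @[y --> F] --> `|l n| by apply: cvg_norm; exact: gl.
  apply: (@closed_cvg _ _ F FF (fun y => `|g n y|) [set z | z <= M n]) cn.
    exact: closed_le.
  by near=> y; rewrite /=; move: (n); near: y.
apply/cvgrPdist_le => e e0.
have e3 : 0 < e / 3 by rewrite divr_gt0.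
have [N _ HN] : \forall n \near \oo, limn (series M) - series M n <= e / 3.
  move/cvgrPdist_le : cM => /(_ _ e3); apply: filterS => n.
  exact/le_trans/ler_norm.
have {HN} HN := HN N (leqnn N).
have cN : series (g^~ y) N @[y --> F] --> series l N.
  rewrite /series /=; apply: cvg_big => //; exact: add_continuous.
move/cvgrPdist_le : cN => /(_ _ e3) cN.
near=> y.
have gy : forall n, `|g n y| <= M n by near: y.
have [_ /(_ N) t1] := series_tail lM cM.
have [_ /(_ N) t2] := series_tail gy cM.
have t3 : `|series l N - series (g^~ y) N| <= e / 3 by near: y.
rewrite (_ : _ - _ = (limn (series l) - series l N) +
  (series l N - series (g^~ y) N) - (limn (series (g^~ y)) - series (g^~ y) N));
  last by ring.
apply: (le_trans (ler_normB _ _)); apply: (le_trans (lerD (ler_normD _ _) (lexx _))).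
have -> : e = e / 3 + e / 3 + e / 3 by field.
by rewrite !lerD//; exact: le_trans HN.
Unshelve. all: by end_near. Qed.

Lemma continuous_lim_series (T : topologicalType) (g : nat -> T -> R)
    (M : nat -> R) (x : T) :
  cvgn (series M) ->
  (\forall y \near x, forall n, `|g n y| <= M n) ->
  (forall n, {for x, continuous (g n)}) ->
  {for x, continuous (fun y => limn (series (g^~ y)))}.
Proof. by move=> cM gM cg; apply: cvg_lim_series cM gM _. Qed.

(** Both difference quotients are the same function of [h], whence an equivalence that involves no
    direction other than [w]. *)
Lemma is_derive_comp_affine (E E' : normedModType R) (f : E' -> R) (phi : E -> E')
    (x v : E) (w : E') (df : R) : (forall h : R, phi (h *: v + x) = h *: w + phi x) ->
  is_derive x v (f \o phi) df <-> is_derive (phi x) w f df.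
Proof.
move=> phiE; have E1 : (fun h : R => h^-1 *: (((f \o phi) \o shift x) (h *: v) - (f \o phi) x)) =
    (fun h => h^-1 *: ((f \o shift (phi x)) (h *: w) - f (phi x))).
  by apply/funext => h /=; rewrite phiE.
by split=> -[d1 d2]; apply: DeriveDef; move: d1 d2; rewrite /derivable /derive E1.
Qed.

Lemma is_derive_line (E : normedModType R) (f : E -> R) (x v : E) (s : R) :
  derivable f (s *: v + x) v ->
  is_derive s 1 (fun s => f (s *: v + x)) ('D_v f (s *: v + x)).
Proof.
move=> df; apply: (is_derive_comp_affine f (phi := fun s : R => s *: v + x) _ _).2 => [h|].
  by rewrite scalerDl addrA [_ *: 1]mulr1.
exact: DeriveDef.
Qed.

Lemma is_derive_affine (E : normedModType R) (f : E -> R) (x v : E) (df : R) :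
  (forall h, f (h *: v + x) = h * df + f x) -> is_derive x v f df.
Proof.
move=> fE; have L : (fun h : R => h^-1 *: ((f \o shift x) (h *: v) - f x)) @ 0^' --> df.
  apply: cvg_near_cst; near=> h; rewrite /= fE addrK /GRing.scale /= mulKf//.
  by near: h; exact: nbhs_dnbhs_neq.
by apply: DeriveDef; [apply/cvg_ex; eexists; exact: L|exact: cvg_lim L].
Unshelve. all: by end_near. Qed.

Lemma is_derive_comp1 (E : normedModType R) (f : E -> R) (g : R -> R) (x v : E)
    (df dg : R) : is_derive x v f df -> is_derive (f x) 1 g dg ->
  is_derive x v (g \o f) (dg * df).
Proof.
move=> dxf dxg; pose phi (s : R) := s *: v + x.
have phi0 : phi 0 = x by rewrite /phi scale0r add0r.
have phiE (h : R) : phi (h *: 1 + 0) = h *: v + phi 0.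
  by rewrite phi0 /phi addr0 [h *: 1]mulr1.
rewrite -phi0 in dxf dxg *; apply/(is_derive_comp_affine _ _ phiE).
exact: (@is_derive1_comp _ g (f \o phi) 0 _ _ dxg ((is_derive_comp_affine _ _ phiE).2 dxf)).
Qed.

Lemma is_derive_slice_snd (E1 E2 : normedModType R) (f : E1 * E2 -> R)
    (t : E1) (x v : E2) (df : R) :
  is_derive (t, x) (0, v) f df -> is_derive x v (fun y => f (t, y)) df.
Proof.
apply: (is_derive_comp_affine f (phi := pair t) _ _).2 => h.
by congr pair; rewrite /= scaler0 add0r.
Qed.

Lemma is_derive_slice_fst (E2 : normedModType R) (f : R * E2 -> R)
    (t : R) (x : E2) (df : R) :
  is_derive (t, x) (1, 0) f df -> is_derive t 1 (fun s => f (s, x)) df.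
Proof.
apply: (is_derive_comp_affine f (phi := pair^~ x) _ _).2 => h.
by congr pair; rewrite /= scaler0 add0r.
Qed.

(** The restriction to the line is a function of one variable; as [h] may have either sign, the mean
    value theorem is used on [0, h] or on [h, 0]. *)
Lemma mean_value_line (E : normedModType R) (f : E -> R) (x v : E) (h C : R) :
  (forall s : R, `|s| <= `|h| ->
    derivable f (s *: v + x) v /\ `|'D_v f (s *: v + x)| <= C) ->
  `|f (h *: v + x) - f x| <= C * `|h|.
Proof.
move=> Hf.
pose phi s := f (s *: v + x).
have dphi (s : R) : `|s| <= `|h| -> is_derive s 1 phi ('D_v f (s *: v + x)).
  by move=> /Hf[df _]; exact: is_derive_line.
have -> : f x = phi 0 by rewrite /phi scale0r add0r.
rewrite -/(phi h).
have itv_norm a b : (a = 0 /\ b = h \/ a = h /\ b = 0) -> forall s : R, s \in `[a, b] -> `|s| <= `|h|.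
  case=> -[-> ->] s; rewrite in_itv /= => /andP[s1 s2].
    by rewrite !ger0_norm//; exact: le_trans s2.
  by rewrite !ler0_norm ?lerN2//; exact: le_trans s2.
have main a b : (a = 0 /\ b = h \/ a = h /\ b = 0) -> a <= b ->
    `|phi b - phi a| <= C * `|b - a|.
  move=> ab leab.
  have [|||c cab ->] := @MVT_segment _ phi (fun s => 'D_v f (s *: v + x)) a b.
  - exact: leab.
  - by move=> s /subset_itv_oo_cc /(itv_norm _ _ ab); exact: dphi.
  - apply: derivable_within_continuous => s /(itv_norm _ _ ab) /dphi ds.
    exact: ex_derive.
  - rewrite normrM ler_wpM2r//.
    by have [] := Hf c (itv_norm _ _ ab _ cab).
have [h0|h0] := leP 0 h.
  by have := main 0 h (or_introl (conj erefl erefl)) h0; rewrite subr0.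
have := main h 0 (or_intror (conj erefl erefl)) (ltW h0).
by rewrite distrC sub0r normrN.
Qed.

(** The mean value inequality bounds the difference quotient of the n-th term by [M n], so Tannery's
    theorem applies to the quotients as h tends to 0. *)
Lemma is_derive_lim_series (E : normedModType R) (g : nat -> E -> R)
    (M : nat -> R) (x v : E) :
  cvgn (series M) ->
  (\forall y \near x, forall n,
    [/\ `|g n y| <= M n, derivable (g n) y v & `|'D_v (g n) y| <= M n]) ->
  is_derive x v (fun y => limn (series (g^~ y)))
    (limn (series (fun n => 'D_v (g n) x))).
Proof.
move=> cM gM.
suff quot : h^-1 *: (((fun y => limn (series (g^~ y))) \o shift x) (h *: v) -
    limn (series (g^~ x))) @[h --> 0^'] -->
    limn (series (fun n => 'D_v (g n) x)).
  apply: DeriveDef; first by apply/cvg_ex; eexists; exact: quot.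
  exact/cvg_lim.
have line : (s *: v + x) @[s --> (0 : R)] --> x.
  rewrite -[X in _ --> X](add0r x) -(scale0r v).
  by apply: cvgD; [apply: cvgZr_tmp; exact: cvg_id|exact: cvg_cst].
have /nbhs_ballP[d /= d0 Hd] : \forall s \near (0 : R), forall n,
    [/\ `|g n (s *: v + x)| <= M n, derivable (g n) (s *: v + x) v
      & `|'D_v (g n) (s *: v + x)| <= M n] by exact: line gM.
have {}Hd (s : R) : `|s| < d -> forall n,
    [/\ `|g n (s *: v + x)| <= M n, derivable (g n) (s *: v + x) v
      & `|'D_v (g n) (s *: v + x)| <= M n].
  by move=> sd; apply: Hd; rewrite /ball /= sub0r normrN.
have gx n : [/\ `|g n x| <= M n, derivable (g n) x v & `|'D_v (g n) x| <= M n].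
  by have := Hd 0; rewrite normr0 => /(_ d0 n); rewrite scale0r add0r.
have nearD : \forall h \near (0 : R)^', `|h| < d.
  exact: dnbhs0_lt.
have step : limn (series (fun n => h^-1 *: (g n (h *: v + x) - g n x))) @[h --> 0^']
    --> limn (series (fun n => 'D_v (g n) x)).
  apply: (cvg_lim_series cM).
    near=> h => n.
    have hd : `|h| < d by near: h.
    have h0 : h != 0 by near: h; exact: nbhs_dnbhs_neq.
    rewrite normrZ normfV mulrC ler_pdivrMr ?normr_gt0//.
    apply: mean_value_line => s sh.
    by have [] := Hd s (le_lt_trans sh hd) n.
  move=> n; have [_ dn _] := gx n.
  exact: dn.
apply: cvg_trans step; apply: near_eq_cvg; near=> h.
have hd : `|h| < d by near: h.
have cx : cvgn (series (g^~ x)).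
  by apply: (series_tail _ cM).1 => n; have [] := gx n.
have ch : cvgn (series (g^~ (h *: v + x))).
  apply: (series_tail _ cM).1 => n; have [] // := Hd h hd n.
rewrite /=; apply: cvg_lim; first exact: Rhausdorff.
rewrite (_ : series _ = h^-1 *: (series (g^~ (h *: v + x)) - series (g^~ x))).
  by apply: cvgZl_tmp; exact: cvgB.
apply/funext => n; rewrite /series /= -scaler_sumr; congr (_ *: _).
by rewrite sumrB.
Unshelve. all: by end_near. Qed.

End SeriesLimits.

Lemma limn_einf_le_near (R : realType) (u : nat -> \bar R) (C : \bar R) :
  (\forall k \near \oo, (u k <= C)%E) -> (limn_einf u <= C)%E.
Proof.
move=> [N _ uC]; rewrite limn_einf_lim; apply: lime_le.
  exact: is_cvg_einfs.
apply: nearW => n; apply: (@le_trans _ _ (u (maxn n N))).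
  by apply: ereal_inf_lbound; exists (maxn n N) => //=; rewrite leq_maxl.
by apply: uC; rewrite /= leq_maxr.
Qed.

(** * Real square integrable functions on a probability space *)

Section SquareIntegrable.
Context d (T : measurableType d) (R : realType).
Variable mu : probability T R.
Implicit Types f g h : T -> R.
Local Notation L2 := (Lfun mu 2%:E).

Definition ip f g : R := \int[mu]_t (f t * g t).

Lemma integral_prob_cst (c : \bar R) : (\int[mu]_t c = c)%E.
Proof.
rewrite (integral_cst mu measurableT).
exact: etrans (congr1 (mule c) (probability_setT mu)) (mule1 _).
Qed.

Lemma L2_measurable f : f \in L2 -> measurable_fun setT f.
Proof. by rewrite inE => /andP[/[!inE]]. Qed.

Lemma L2P f : measurable_fun setT f ->
  (\int[mu]_t (f t ^+ 2)%:E < +oo)%E -> f \in L2.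
Proof.
move=> mf fy; rewrite inE; apply/andP; split; rewrite inE//=.
rewrite /finite_norm unlock /Lnorm; apply: poweR_lty.
by under eq_integral do rewrite /= powR_mulrn// -normrX ger0_norm ?sqr_ge0//.
Qed.

Lemma L2D f g : f \in L2 -> g \in L2 -> f + g \in L2.
Proof. by move=> fL gL; apply: rpredD => //; rewrite lee1n. Qed.

Lemma L2B f g : f \in L2 -> g \in L2 -> f - g \in L2.
Proof. by move=> fL gL; apply: rpredB => //; rewrite lee1n. Qed.

Lemma L2Z a f : f \in L2 -> a *: f \in L2.
Proof. by move=> fL; apply: rpredZ => //; rewrite lee1n. Qed.

Lemma L2sum (I : Type) (r : seq I) (P : pred I) (F : I -> T -> R) :
  (forall i, P i -> F i \in L2) -> \sum_(i <- r | P i) F i \in L2.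
Proof. by move=> fL; apply: rpred_sum => //; rewrite lee1n. Qed.

Lemma ip_integrable f g : f \in L2 -> g \in L2 ->
  mu.-integrable setT (EFin \o (fun t => f t * g t)).
Proof. by move=> fL gL; apply/Lfun1_integrable; exact: Lfun2_mul_Lfun1. Qed.

Lemma L2_integrable f : f \in L2 -> mu.-integrable setT (EFin \o f).
Proof.
move=> fL; have /(ip_integrable fL) : cst 1 \in L2 by exact: Lfun_cst.
by under eq_fun do rewrite /= mulr1.
Qed.

Lemma ip_EFin f g : f \in L2 -> g \in L2 ->
  (ip f g)%:E = (\int[mu]_t (f t * g t)%:E)%E.
Proof.
move=> fL gL; rewrite /ip /Rintegral fineK//.
exact/integrable_fin_num/ip_integrable.
Qed.

Lemma ipC f g : ip f g = ip g f.
Proof. by rewrite /ip; apply: eq_Rintegral => t _; rewrite mulrC. Qed.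

Lemma ipDl f g h : f \in L2 -> g \in L2 -> h \in L2 ->
  ip (f + g) h = ip f h + ip g h.
Proof.
move=> fL gL hL; rewrite /ip -RintegralD//; [|exact: ip_integrable..].
by apply: eq_Rintegral => t _; rewrite mulrDl.
Qed.

Lemma ipZl a f h : f \in L2 -> h \in L2 -> ip (a *: f) h = a * ip f h.
Proof.
move=> fL hL; rewrite /ip -RintegralZl//; last exact: ip_integrable.
by apply: eq_Rintegral => t _; rewrite -mulrA.
Qed.

Lemma ipBl f g h : f \in L2 -> g \in L2 -> h \in L2 ->
  ip (f - g) h = ip f h - ip g h.
Proof.
move=> fL gL hL; rewrite ipDl//; last by rewrite -scaleN1r; exact: L2Z.
by rewrite -[- g]scaleN1r ipZl// mulN1r.
Qed.

Lemma ip0l h : ip 0 h = 0.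
Proof.
transitivity (\int[mu]_(t in setT) (0 : R)).
  by apply: eq_Rintegral => t _; rewrite mul0r.
by rewrite Rintegral_cst// mul0r.
Qed.

Lemma ip_suml n (F : nat -> T -> R) h : (forall i, F i \in L2) -> h \in L2 ->
  ip (\sum_(i < n) F i) h = \sum_(i < n) ip (F i) h.
Proof.
move=> FL hL; elim: n => [|n IHn]; first by rewrite !big_ord0 ip0l.
by rewrite !big_ord_recr /= ipDl ?IHn//; exact: L2sum.
Qed.

Lemma ip_ge0 f : 0 <= ip f f.
Proof. by apply: Rintegral_ge0 => t _; rewrite -expr2 sqr_ge0. Qed.

Lemma ip_subr_sqr f g : f \in L2 -> g \in L2 ->
  ip (f - g) (f - g) = ip f f - 2 * ip f g + ip g g.
Proof.
move=> fL gL; have fgL := L2B fL gL.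
rewrite ipBl// [ip f (_ - _)]ipC [ip g (_ - _)]ipC !ipBl// [ip g f]ipC.
by ring.
Qed.

Lemma ae_eq_ip f g h : f \in L2 -> g \in L2 -> h \in L2 ->
  {ae mu, forall t, f t = g t} -> ip f h = ip g h.
Proof.
move=> fL gL hL fg; rewrite /ip /Rintegral; congr fine.
apply: ae_eq_integral => //.
- by apply/measurable_EFinP/measurable_funM; exact: L2_measurable.
- by apply/measurable_EFinP/measurable_funM; exact: L2_measurable.
- by apply: filterS fg => t -> _.
Qed.

(** * Orthonormal systems: Bessel, Riesz-Fischer and Parseval *)

Section Orthonormal.
Variable e : nat -> T -> R.
Hypothesis eL : forall n, e n \in L2.
Hypothesis on : forall n k, ip (e n) (e k) = (n == k)%:R.
Implicit Types a : nat -> R.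

Definition fsum a n : T -> R := \sum_(i < n) a i *: e i.

Lemma fsumE a n t : fsum a n t = series (fun i => a i * e i t) n.
Proof. by rewrite /fsum fct_sumE /series /= big_mkord. Qed.

Lemma fsum_L2 a n : fsum a n \in L2.
Proof. by apply: L2sum => i _; exact: L2Z. Qed.

Hint Resolve fsum_L2 : core.

Lemma ip_fsuml a n h : h \in L2 ->
  ip (fsum a n) h = \sum_(i < n) a i * ip h (e i).
Proof.
move=> hL; rewrite /fsum (@ip_suml n (fun i => a i *: e i))//.
  by apply: eq_bigr => i _; rewrite ipZl// ipC.
by move=> i; exact: L2Z.
Qed.

Lemma ip_fsum_basis a n k : ip (fsum a n) (e k) = if (k < n)%N then a k else 0.
Proof.
rewrite ip_fsuml//; under eq_bigr do rewrite on.
case: ifPn => [kn|kn].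
  rewrite (bigD1 (Ordinal kn))//= eqxx mulr1 big1 ?addr0// => i ik.
  case: eqVneq => [E|_]; last by rewrite mulr0.
  by move: ik; rewrite -val_eqE /= E eqxx.
rewrite big1// => i _; case: eqVneq => [E|_]; last by rewrite mulr0.
by move: kn; rewrite E ltn_ord.
Qed.

Lemma ip_fsum_fsum a n : ip (fsum a n) (fsum a n) = \sum_(i < n) a i ^+ 2.
Proof.
rewrite ip_fsuml//; apply: eq_bigr => i _.
by rewrite ip_fsum_basis ltn_ord expr2.
Qed.

Lemma ip_sub_fsum a f n : f \in L2 -> (forall i, a i = ip f (e i)) ->
  ip (f - fsum a n) (f - fsum a n) = ip f f - \sum_(i < n) a i ^+ 2.
Proof.
move=> fL af; rewrite ip_subr_sqr// ip_fsum_fsum ipC ip_fsuml//.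
under [in 2 * _]eq_bigr do rewrite -af -expr2.
by ring.
Qed.

Lemma bessel f n : f \in L2 -> \sum_(i < n) ip f (e i) ^+ 2 <= ip f f.
Proof.
move=> fL; rewrite -subr_ge0 -(@ip_sub_fsum (fun i => ip f (e i)))//.
exact: ip_ge0.
Qed.

Lemma bessel_cvg f : f \in L2 -> cvgn (series (fun i => ip f (e i) ^+ 2)).
Proof.
move=> fL; apply: nondecreasing_is_cvgn.
  by apply: nondecreasing_series => i _ _; rewrite sqr_ge0.
by exists (ip f f) => _ [n _ <-]; rewrite /series /= big_mkord; exact: bessel.
Qed.

Lemma ip_sub_fsum_fsum a n k : (n <= k)%N ->
  ip (fsum a k - fsum a n) (fsum a k - fsum a n) =
  series (fun i => a i ^+ 2) k - series (fun i => a i ^+ 2) n.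
Proof.
move=> nk; rewrite ip_subr_sqr// !ip_fsum_fsum [ip (fsum a k) _]ipC ip_fsuml//.
under [in 2 * _]eq_bigr => i _ do
  rewrite ip_fsum_basis (leq_trans (ltn_ord i) nk) -expr2.
by rewrite /series /= !big_mkord; ring.
Qed.

(* Along a subsequence with fast enough L2 convergence, the partial sums
   converge almost everywhere; Fatou's lemma gives L2 convergence. *)
Lemma riesz_fischer a : cvgn (series (fun i => a i ^+ 2)) ->
  exists phi : nat -> nat,
    let f t := fine (limn_esup (fun k => (fsum a (phi k) t)%:E)) in
    [/\ f \in L2, forall i, ip f (e i) = a i &
        ip f f = limn (series (fun i => a i ^+ 2))].
Proof.
set A := series _ => cA.
have A_nd : {homo A : n k / (n <= k)%N >-> n <= k}.
  by apply: nondecreasing_series => i _ _; rewrite sqr_ge0.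
have AleA n : A n <= limn A by exact: nondecreasing_cvgn_le.
(* The bound 4^-k on squared norms makes successive distances at most 2^-k, which is summable;
   [k <= N] makes [phi] tend to infinity. *)
have ex_phi k : exists N, (k <= N)%N /\ limn A - A N <= 4^-1 ^+ k.
  have k0 : 0 < 4^-1 ^+ k :> R by rewrite exprn_gt0.
  move/cvgrPdist_le : (cA) => /(_ _ k0)[N _ HN].
  exists (maxn k N); rewrite leq_maxl; split=> //.
  by apply: le_trans (ler_norm _) (HN _ _); rewrite /= leq_maxr.
have [phi phiP] := choice ex_phi; exists phi => f.
pose g k := fsum a (phi k).
have gL k : g k \in L2 by exact: fsum_L2.
have mg k : measurable_fun setT (g k) by exact: L2_measurable.
have gg j k : (j <= k)%N -> ip (g k - g j) (g k - g j) <= 4^-1 ^+ j.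
  move=> jk.
  have [_ Hj] := phiP j; have [_ Hk] := phiP k.
  have Hkj : 4^-1 ^+ k <= 4^-1 ^+ j :> R by rewrite ler_wiXn2l//; lra.
  (* [phi] is not known to be monotone, so both orders occur. *)
  have [le|/ltnW le] := leqP (phi j) (phi k).
    rewrite ip_sub_fsum_fsum//; apply: le_trans Hj; rewrite lerB//; exact: AleA.
  rewrite (_ : ip _ _ = ip (g j - g k) (g j - g k)).
    rewrite ip_sub_fsum_fsum//; apply: le_trans Hkj; apply: le_trans Hk.
    by rewrite lerB//; exact: AleA.
  by rewrite !ip_subr_sqr// [ip (g k) (g j)]ipC; ring.
pose dd k t := `|g k.+1 t - g k t|.
have mdd k : measurable_fun setT (fun t => (dd k t)%:E).
  by apply/measurable_EFinP/measurableT_comp => //; exact: measurable_funB.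
(* The inequality |z| <= 2^k z^2 / 2 + 2^-k / 2 does the work of Cauchy-Schwarz: it turns the bound
   4^-k for z^2 into the bound 2^-k for |z|. *)
have int_dd k : (\int[mu]_t (dd k t)%:E <= (2^-1 ^+ k)%:E)%E.
  have gkL : g k.+1 - g k \in L2 by exact: L2B.
  apply: (@le_trans _ _ (\int[mu]_t ((2 ^+ k / 2)%:E *
      ((g k.+1 - g k) t * (g k.+1 - g k) t)%:E + (2^-1 ^+ k / 2)%:E))%E).
    apply: ge0_le_integral => //.
    - by move=> t _; rewrite lee_fin /dd.
    - apply: emeasurable_funD => //; apply: emeasurable_funM => //.
      by apply/measurable_EFinP/measurable_funM; exact: measurable_funB.
    - move=> t _; rewrite -EFinM -EFinD lee_fin /dd /=.
      set z := g k.+1 t - g k t.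
      have -> : (g k.+1 - g k) t * (g k.+1 - g k) t = `|z| ^+ 2.
        by rewrite -normrX ger0_norm ?sqr_ge0// expr2.
      rewrite exprVn -subr_ge0.
      have p0 : 2 ^+ k != 0 :> R by rewrite expf_neq0.
      rewrite (_ : _ - _ = (2 ^+ k * `|z| - 1) ^+ 2 / (2 * 2 ^+ k)); last by field.
      by rewrite divr_ge0 ?sqr_ge0// mulr_ge0// exprn_ge0.
  rewrite integralD//=; first last.
  - by apply: finite_measure_integrable_cst.
  - by apply: integrableZl => //; exact: ip_integrable.
  rewrite integralZl//; last exact: ip_integrable.
  rewrite -(ip_EFin gkL gkL) integral_prob_cst.
  rewrite -EFinM -EFinD lee_fin.
  have Hgg := gg k k.+1 (leqnSn k).
  apply: (@le_trans _ _ (2 ^+ k / 2 * 4^-1 ^+ k + 2^-1 ^+ k / 2)).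
    by rewrite lerD2r ler_wpM2l// divr_ge0// exprn_ge0.
  rewrite (_ : 4^-1 = 2^-1 * 2^-1 :> R); last by field.
  rewrite exprMn !exprVn le_eqVlt; apply/orP; left; apply/eqP; field.
  by rewrite expf_neq0.
have int_sum : (\int[mu]_t (\sum_(0 <= k <oo) (dd k t)%:E) < +oo)%E.
  rewrite integral_nneseries//; last by move=> k t _; rewrite lee_fin /dd.
  apply: (@le_lt_trans _ _ (\sum_(0 <= k <oo) (2^-1 ^+ k)%:E)%E).
    apply: lee_nneseries => k _ //.
    by move=> _; apply: integral_ge0 => t _; rewrite lee_fin /dd.
  apply: le_lt_trans (ltry 2); apply: le_trans (epsilon_trick0 xpredT (ler0n R 2)).
  apply: lee_nneseries => k _ => [_|]; first by rewrite lee_fin exprn_ge0.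
  by rewrite lee_fin natrX exprVn exprS invfM mulVKf.
(* Where the sum of the increments is finite, [g] telescopes into an absolutely convergent series;
   the remaining points form a null set. *)
have gf : {ae mu, forall t, g k t @[k --> \oo] --> f t}.
  have isum : mu.-integrable setT (fun t => \sum_(0 <= k <oo) (dd k t)%:E)%E.
    apply/integrableP; split.
      by apply: ge0_emeasurable_sum => // k t _ _; rewrite lee_fin /dd.
    apply: le_lt_trans int_sum; rewrite le_eqVlt; apply/orP; left; apply/eqP.
    apply: eq_integral => t _; rewrite gee0_abs//.
    by apply: nneseries_ge0 => k _ _; rewrite lee_fin /dd.
  have := integrable_ae measurableT isum; apply: filterS => t /(_ I) fin.
  have cdd : cvgn (series (dd ^~ t)).
    apply: nondecreasing_is_cvgn.
      by apply: nondecreasing_series => k _ _; rewrite /dd.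
    exists (fine (\sum_(0 <= k <oo) (dd k t)%:E)%E) => _ [n _ <-].
    rewrite -lee_fin fineK// /series /= -sumEFin.
    by apply: nneseries_lim_ge => k _ _; rewrite lee_fin /dd.
  have cg : cvgn (g ^~ t).
    have cs : cvgn (series (fun k => g k.+1 t - g k t)) by exact: normed_cvg.
    have -> : g^~ t = (fun k => g 0%N t + series (fun k => g k.+1 t - g k t) k).
      apply/funext => k; rewrite /series /= telescope_sumr//; first by ring.
    by apply: is_cvgD => //; exact: is_cvg_cst.
  have -> : f t = limn (g ^~ t); last exact: cg.
  have cgE : (g k t)%:E @[k --> \oo] --> (limn (g^~ t))%:E.
    by apply: cvg_EFin => //; exact: nearW.
  rewrite /f is_cvg_limn_esupE; last by apply/cvg_ex; eexists; exact: cgE.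
  by rewrite (cvg_lim _ cgE).
have mf : measurable_fun setT f.
  apply: (@measurableT_comp _ _ _ _ _ _ fine) => //.
  by apply: measurable_fun_limn_esup => k; apply/measurable_EFinP; exact: mg.
have fatou_bound j : (\int[mu]_t ((f t - g j t) ^+ 2)%:E <= (4^-1 ^+ j)%:E)%E.
  have -> : (\int[mu]_t ((f t - g j t) ^+ 2)%:E =
     \int[mu]_t limn_einf (fun k => ((g k t - g j t) ^+ 2)%:E))%E.
    apply: ae_eq_integral => //.
    - by apply/measurable_EFinP/measurable_funX/measurable_funB.
    - apply: (@measurableT_comp _ _ _ _ _ _ oppe) => //.
      apply: measurable_fun_limn_esup => k; apply: measurableT_comp => //.
      by apply/measurable_EFinP/measurable_funX/measurable_funB.
    - apply: filterS gf => t gft _; apply/esym.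
      have cE : ((g k t - g j t) ^+ 2)%:E @[k --> \oo] --> ((f t - g j t) ^+ 2)%:E.
        apply: cvg_EFin; first exact: nearW.
        have cB : g k t - g j t @[k --> \oo] --> f t - g j t.
          by apply: cvgB => //; exact: cvg_cst.
        exact: cvgM.
      rewrite is_cvg_limn_einfE; last by apply/cvg_ex; eexists; exact: cE.
      exact: cvg_lim cE.
  apply: (le_trans (fatou _ _ _ _)) => //.
  - by move=> k; apply/measurable_EFinP/measurable_funX/measurable_funB.
  - by move=> k t _; rewrite lee_fin sqr_ge0.
  apply: limn_einf_le_near; near=> k.
  have -> : (\int[mu]_t ((g k t - g j t) ^+ 2)%:E =
      (ip (g k - g j) (g k - g j))%:E)%E.
    by rewrite ip_EFin; [under eq_integral do rewrite expr2| exact: L2B..].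
  by rewrite lee_fin; apply: gg; near: k; exact: nbhs_infty_ge.
have fgL j : f - g j \in L2.
  apply: L2P; first exact: measurable_funB.
  exact: le_lt_trans (fatou_bound j) (ltry _).
have fL : f \in L2 by rewrite -(subrK (g 0%N) f); exact: L2D.
have fg_le j : ip (f - g j) (f - g j) <= 4^-1 ^+ j.
  rewrite -lee_fin ip_EFin//; apply: le_trans (fatou_bound j).
  by under eq_integral do rewrite -expr2.
have c40 : (4^-1 ^+ j : R) @[j --> \oo] --> 0 by apply: cvg_expr; rewrite ger0_norm; lra.
(* By Bessel, the square of one coefficient of [f - g j] is at most its squared norm, which tends to
   0; as soon as [i < phi j] this coefficient is [ip f (e i) - a i]. *)
have fa i : ip f (e i) = a i.
  apply/eqP; rewrite -subr_eq0 -sqrf_eq0; apply/eqP/le_anti; rewrite sqr_ge0 andbT.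
  rewrite -(cvg_lim _ c40)//; apply: limr_ge; first by apply/cvg_ex; eexists; exact: c40.
  near=> j.
  have ij : (i < phi j)%N.
    have [jphi _] := phiP j; apply: leq_trans jphi; near: j; exact: nbhs_infty_gt.
  have -> : ip f (e i) - a i = ip (f - g j) (e i).
    by rewrite ipBl// ip_fsum_basis ij.
  apply: le_trans (fg_le j); apply: le_trans (bessel i.+1 (fgL j)).
  rewrite big_ord_recr /= lerDr; apply: sumr_ge0 => k _; exact: sqr_ge0.
split=> //.
have ffA j : ip (f - g j) (f - g j) = ip f f - A (phi j).
  rewrite (ip_sub_fsum (phi j) fL (fun i => esym (fa i))).
  by rewrite /A /series /= big_mkord.
have phioo : phi @ \oo --> \oo.
  move=> P [N _ NP]; exists N => // n /= Nn; apply: NP => /=.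
  by have [+ _] := phiP n; exact: leq_trans.
have c1 : ip f f - A (phi j) @[j --> \oo] --> ip f f - limn A.
  apply: cvgB; first exact: cvg_cst.
  exact: cvg_comp phioo cA.
have c2 : ip f f - A (phi j) @[j --> \oo] --> 0.
  apply: (squeeze_cvgr _ (cvg_cst 0) c40); apply: nearW => j.
  by rewrite -ffA ip_ge0 fg_le.
apply/eqP; rewrite -subr_eq0; apply/eqP.
by rewrite -(cvg_lim (@Rhausdorff R) c1) (cvg_lim (@Rhausdorff R) c2).
Unshelve. all: by end_near. Qed.

Hypothesis complete : forall h, h \in L2 -> (forall i, ip h (e i) = 0) ->
  {ae mu, forall t, h t = 0}.

(** The Riesz-Fischer function built from the coefficients of [f] has the sum of their squares as
    squared norm, and completeness identifies it with [f] almost everywhere. *)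
Lemma parseval f : f \in L2 ->
  series (fun i => ip f (e i) ^+ 2) @ \oo --> ip f f.
Proof.
move=> fL; have cf := bessel_cvg fL.
have [phi] := riesz_fischer cf; set g := (X in let f := X in _) => -[gL ga gg].
have /(complete (L2B fL gL)) fg i : ip (f - g) (e i) = 0.
  by rewrite ipBl// ga subrr.
have {}fg : {ae mu, forall t, f t = g t}.
  by apply: filterS fg => t /eqP; rewrite subr_eq0 => /eqP.
rewrite (ae_eq_ip fL gL fL fg) ipC (ae_eq_ip fL gL gL fg) gg.
exact: cf.
Qed.

End Orthonormal.

End SquareIntegrable.

(** * Finite powers of a probability on the line: slices, marginals and boxes *)

Section TupleProbability.
Context {R : realType}.
Local Notation TR := (measurableTypeR R).
Variable P : probability TR R.

Lemma tuple_probS n (A : set (n.+1.-tuple TR)) :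
  tuple_prob P n.+1 A =
  (P \x tuple_prob P n)%E ((fun p : TR * n.-tuple TR => [tuple of p.1 :: p.2]) @^-1` A).
Proof. by []. Qed.

(** Both orders of integration serve in [integral_slice0]: the head outermost to recurse into the
    tail, the head innermost to integrate along the first coordinate. *)
Lemma integral_tuple_probS n (f : n.+1.-tuple TR -> R) (C : R) :
  measurable_fun setT f -> (forall t, `|f t| <= C) ->
  (\int[tuple_prob P n.+1]_t (f t)%:E =
   \int[P]_x \int[tuple_prob P n]_t (f [tuple of x :: t])%:E)%E /\
  (\int[tuple_prob P n.+1]_t (f t)%:E =
   \int[tuple_prob P n]_t \int[P]_x (f [tuple of x :: t])%:E)%E.
Proof.
move=> mf fC.
have mfE : measurable_fun setT (fun p : TR * n.-tuple TR => (f [tuple of p.1 :: p.2])%:E).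
  by apply/measurable_EFinP; apply: measurableT_comp mf _; exact: measurable_cons.
have intf : (P \x tuple_prob P n)%E.-integrable setT
    (fun p : TR * n.-tuple TR => (f [tuple of p.1 :: p.2])%:E).
  apply: (@le_integrable _ _ _ _ _ _ _ (cst C%:E)) => //.
    by move=> p _ /=; rewrite lee_fin (le_trans (fC _))// ler_norm.
  exact: (@finite_measure_integrable_cst _ _ _ ((P \x tuple_prob P n)%E : probability _ R)).
have E : (\int[tuple_prob P n.+1]_t (f t)%:E =
    \int[P \x tuple_prob P n]_p (f [tuple of p.1 :: p.2])%:E)%E.
  rewrite /= integral_distribution//; exact/measurable_EFinP.
rewrite E; split.
  by rewrite -integral12_prod_meas1.
by rewrite -integral21_prod_meas1.
Qed.

Definition set_tnth n (t : n.-tuple TR) (j : 'I_n) (s : TR) : n.-tuple TR :=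
  [tuple if i == j then s else tnth t i | i < n].

Lemma set_tnth_cons0 n (x s : TR) (t : n.-tuple TR) :
  set_tnth [tuple of x :: t] ord0 s = [tuple of s :: t].
Proof.
apply: eq_from_tnth => i; rewrite tnth_mktuple.
by case: (unliftP ord0 i) => [i' ->|->]; rewrite ?tnthS ?tnth0.
Qed.

Lemma set_tnth_consS n (x s : TR) (t : n.-tuple TR) (j : 'I_n) :
  set_tnth [tuple of x :: t] (lift ord0 j) s = [tuple of x :: set_tnth t j s].
Proof.
apply: eq_from_tnth => i; rewrite tnth_mktuple.
case: (unliftP ord0 i) => [i' ->|->]; rewrite ?tnthS ?tnth0//.
by rewrite tnth_mktuple (inj_eq lift_inj).
Qed.

(** Fubini with the coordinate [j] integrated first; the induction strips the coordinates that
    precede [j]. *)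
Lemma integral_slice0 n (j : 'I_n) (f : n.-tuple TR -> R) (C : R) :
  measurable_fun setT f -> (forall t, `|f t| <= C) ->
  (forall t, (\int[P]_s (f (set_tnth t j s))%:E = 0)%E) ->
  (\int[tuple_prob P n]_t (f t)%:E = 0)%E.
Proof.
elim: n j f => [[]//|n IHn] j f mf fC f0.
have [E1 E2] := integral_tuple_probS mf fC.
case: (unliftP ord0 j) => [j' jE|jE].
  rewrite E1; under eq_integral => x _.
    rewrite (IHn j' (fun t => f [tuple of x :: t])); first over.
    - apply: measurableT_comp mf _; exact: measurable_cons.
    - by move=> t.
    - move=> t; rewrite -[RHS](f0 [tuple of x :: t]) jE.
      by apply: eq_integral => s _; rewrite set_tnth_consS.
  by rewrite integral0.
rewrite E2; under eq_integral => t _.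
  rewrite (_ : (\int[P]_x _)%E = 0%E); first over.
  rewrite -[RHS](f0 [tuple of 0 :: t]) jE.
  by apply: eq_integral => s _; rewrite set_tnth_cons0.
by rewrite integral0.
Qed.

Lemma tuple_prob_tnth n (j : 'I_n) (A : set TR) : measurable A ->
  tuple_prob P n [set t | A (tnth t j)] = P A.
Proof.
move=> mA; elim: n j => [[]//|n IHn] j; rewrite tuple_probS.
case: (unliftP ord0 j) => [j' jE|jE].
  rewrite [X in (_ \x _)%E X](_ : _ = setT `*` [set t | A (tnth t j')]).
    rewrite product_measure1E//.
      apply: etrans (congr1 (mule (P setT)) (IHn j')) _.
      exact: etrans (congr1 (fun z => mule z (P A)) (probability_setT P)) (mul1e _).
    by rewrite -[X in measurable X]setTI; exact: measurable_tnth.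
  by apply/seteqP; split => -[x t] /=; rewrite jE tnthS // => -[].
rewrite [X in (_ \x _)%E X](_ : _ = A `*` setT).
  rewrite product_measure1E//.
  exact: etrans (congr1 (mule (P A)) (probability_setT (tuple_prob P n))) (mule1 _).
by apply/seteqP; split => -[x t] /=; rewrite jE tnth0 // => -[].
Qed.

Lemma measurable_tuple_box n (A : 'I_n -> set TR) : (forall j, measurable (A j)) ->
  measurable [set t : n.-tuple TR | forall j, A j (tnth t j)].
Proof.
move=> mA.
rewrite (_ : mkset _ = \bigcap_(j in [set: 'I_n]) [set t | A j (tnth t j)]).
  apply: fin_bigcap_measurable => // j _.
  by rewrite -[X in measurable X]setTI; exact: measurable_tnth.
by apply/seteqP; split => t /= H j; [move=> _; exact: H|exact: H].
Qed.

Lemma tuple_prob_box_gt0 n (A : 'I_n -> set TR) :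
  (forall j, measurable (A j)) -> (forall j, (0 < P (A j))%E) ->
  (0 < tuple_prob P n [set t | forall j, A j (tnth t j)])%E.
Proof.
elim: n A => [|n IHn] A mA A0.
  rewrite (_ : mkset _ = setT); last by apply/seteqP; split => // t _ [].
  by rewrite (probability_setT (tuple_prob P 0)).
rewrite tuple_probS [X in (_ \x _)%E X](_ : _ =
    A ord0 `*` [set t | forall j, A (lift ord0 j) (tnth t j)]).
  rewrite product_measure1E//; last first.
    exact: (@measurable_tuple_box n (fun j => A (lift ord0 j)) (fun j => mA _)).
  apply: mule_gt0; first exact: A0.
  exact: (IHn (fun j => A (lift ord0 j)) (fun j => mA _) (fun j => A0 _)).
apply/seteqP; split => -[x t] /=.
  move=> H; split; first by have := H ord0; rewrite tnth0.
  by move=> j; have := H (lift ord0 j); rewrite tnthS.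
move=> [H0 HS] j; by case: (unliftP ord0 j) => [j' ->|->]; rewrite ?tnthS ?tnth0.
Qed.

End TupleProbability.

(** * Periodic functions and the Haar measure of the torus *)

Section TorusFunctions.
Context {R : realType} {m : nat}.
Local Notation TR := (measurableTypeR R).
Local Notation tp := (@torus_point R m).
Implicit Types (w : 'rV[R]_m -> R).

Lemma periodic_int (h : R -> R) (c : R) : (forall a, h (a + c) = h a) ->
  forall (k : int) a, h (a + c * k%:~R) = h a.
Proof.
move=> hc; have pos n a : h (a + c * n%:R) = h a by rewrite mulr_natr periodicn.
case=> n a; first by rewrite -pmulrn pos.
by rewrite NegzE mulrNz mulrN -pmulrn -(pos n.+1) subrK.
Qed.

Definition rperiodic w := forall (j : 'I_m) (x : 'rV[R]_m),
  w (x + (2 * pi) *: delta_mx 0 j) = w x.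

Lemma rperiodic_int w (j : 'I_m) (k : int) x : rperiodic w ->
  w (x + (2 * pi * k%:~R) *: delta_mx 0 j) = w x.
Proof.
move=> pw; have hc a : w (x + (a + 2 * pi) *: delta_mx 0 j) = w (x + a *: delta_mx 0 j).
  by rewrite scalerDl addrA pw.
by have := periodic_int hc k 0; rewrite add0r scale0r addr0.
Qed.

(** Brings questions on all of R^m, such as boundedness, back to the compact box [0, 2 pi]^m. *)
Lemma rperiodic_fundamental w x : rperiodic w ->
  exists2 y : 'rV[R]_m, (forall j, 0 <= y 0 j < 2 * pi) & w y = w x.
Proof.
move=> pw.
have p0 : (0 : R) < 2 * pi by rewrite mulr_gt0 ?pi_gt0.
pose k j : int := Num.floor (x 0 j / (2 * pi)).
pose y := x - \sum_(j < m) (2 * pi * (k j)%:~R) *: delta_mx 0 j.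
have yE j : y 0 j = x 0 j - 2 * pi * (k j)%:~R.
  rewrite /y !mxE summxE (bigD1 j)//= big1 => [|i ij]; rewrite !mxE eqxx /=.
    by rewrite eqxx mulr1 addr0.
  by rewrite eq_sym (negPf ij) mulr0.
exists y.
  move=> j; rewrite yE; have := floor_itv (x 0 j / (2 * pi)).
  rewrite -/(k j) ler_pdivlMr// ltr_pdivrMr// intrD => /andP[h1 h2].
  apply/andP; split; lra.
rewrite /y; elim/big_rec: _ => [|i z _ IH]; first by rewrite subr0.
rewrite opprD addrA -IH -[in RHS](rperiodic_int i (- k i) _ pw).
by congr w; rewrite mulrNz mulrN scaleNr addrAC.
Qed.

Lemma compact_box (a b : R) :
  compact [set x : 'rV[R]_m | forall j, `[a, b]%classic (x ord0 j)].
Proof. exact: (@rV_compact _ m (fun=> `[a, b]%classic) (fun _ => @segment_compact _ a b)). Qed.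

Lemma continuous_compact_bounded (E : normedModType R) (K : set E) (f : E -> R) :
  compact K -> (forall x, K x -> {for x, continuous f}) ->
  exists C, forall x, K x -> `|f x| <= C.
Proof.
move=> cK cf.
have cf' : {within K, continuous f}.
  apply: continuous_in_subspaceT => x; rewrite inE; exact: cf.
have [M [_ HM]] := compact_bounded (continuous_compact cf' cK).
exists (M + 1) => x Kx; apply: (HM (M + 1)); first by rewrite ltrDl.
by exists x.
Qed.

Lemma rperiodic_bounded w : rperiodic w -> continuous w ->
  exists C, forall x, `|w x| <= C.
Proof.
move=> pw cw.
have [C HC] := @continuous_compact_bounded _ _ w (@compact_box 0 (2 * pi)) (fun x _ => cw x).
exists C => x; have [y hy <-] := rperiodic_fundamental x pw; apply: HC => j /=.
by have /andP[y0 y1] := hy j; rewrite in_itv /= y0 ltW.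
Qed.

(** A slice of the torus is a line, so partial derivatives become derivatives in one variable. *)
Lemma torus_point_set_tnth (t : m.-tuple TR) (j : 'I_m) (s : TR) :
  tp (set_tnth t j s) = s *: delta_mx 0 j + (tp t - tnth t j *: delta_mx 0 j).
Proof.
apply/rowP => i; rewrite !mxE tnth_mktuple eqxx /= [i == j]eq_sym.
case: eqVneq => [->|ij]; first by rewrite !mulr1; ring.
by rewrite !mulr0 subr0 add0r.
Qed.

(* A continuous function is the limit of its values at the lattice points
   obtained by rounding every coordinate down to a multiple of 1 / n. *)
Lemma measurable_fun_cylinder (Phi : R * 'rV[R]_m -> R) : continuous Phi ->
  measurable_fun setT (fun z : TR * m.-tuple TR => Phi (z.1, tp z.2)).
Proof.
move=> cPhi.
pose K : countType := (int * {ffun 'I_m -> int})%type.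
pose pt n (k : K) : R * 'rV[R]_m :=
  (k.1%:~R / n.+1%:R, \row_j ((k.2 j)%:~R / n.+1%:R)).
pose q n (z : TR * m.-tuple TR) : K :=
  (Num.floor (z.1 * n.+1%:R), [ffun j => Num.floor (tnth z.2 j * n.+1%:R)]).
have mfl n (i : int) : measurable [set x : TR | Num.floor (x * n.+1%:R) = i].
  rewrite (_ : mkset _ = `[i%:~R / n.+1%:R, (i + 1)%:~R / n.+1%:R[%classic) //.
  apply/seteqP; split => x /=; rewrite in_itv /= ler_pdivrMr// ltr_pdivlMr//.
    by move=> <-; rewrite floor_itv.
  exact: floor_def.
have mfib n k : measurable [set z | q n z = k].
  rewrite (_ : mkset _ = [set x : TR | Num.floor (x * n.+1%:R) = k.1] `*`
     [set t : m.-tuple TR | forall j, [set x : TR | Num.floor (x * n.+1%:R) = k.2 j] (tnth t j)]).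
    apply: measurableX => //.
    exact: (@measurable_tuple_box _ m (fun j => [set x : TR | Num.floor (x * n.+1%:R) = k.2 j])).
  apply/seteqP; split => -[x t] /=.
    by move=> <-; split=> //= j; rewrite ffunE.
  by case: k => k1 k2 [/= <- H]; congr pair; apply/ffunP => j; rewrite ffunE H.
apply: (@measurable_fun_cvg _ _ _ _ (fun n z => Phi (pt n (q n z)))).
(* The approximant factors through the countable type [K], so each preimage is a countable union of
   measurable fibres of [q n]. *)
- move=> n _ Y mY; rewrite setTI.
  rewrite (_ : _ @^-1` _ = \bigcup_(k in [set: K])
      (if pselect (Y (Phi (pt n k))) then [set z | q n z = k] else set0)).
    apply: countable_bigcupT_measurable; first exact: countableP.
    by move=> k; case: pselect => Yk; [exact: mfib|exact: measurable0].
  apply/seteqP; split => z /=.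
    by move=> Yz; exists (q n z) => //; case: pselect.
  by move=> [k _]; case: pselect => //= Yk qk; rewrite qk.
- move=> z _.
  have : pt n (q n z) @[n --> \oo] --> (z.1, tp z.2); last first.
    by move=> /cvg_comp; apply; exact: cPhi.
  have fl n (x : R) : `|x - (Num.floor (x * n.+1%:R))%:~R / n.+1%:R| < n.+1%:R^-1 *+ 2.
    have /andP[h1 h2] := floor_itv (x * n.+1%:R).
    rewrite -[X in `|X - _|](@mulfK _ n.+1%:R)// -mulrBl normrM normfV normr_nat.
    rewrite -[_^-1 *+ 2]mulr_natl ltr_pM2r ?invr_gt0//.
    move: h2; rewrite intrD ger0_norm ?subr_ge0//; lra.
  apply/cvg_ballP => e e0; near=> n.
  have en : n.+1%:R^-1 *+ 2 < e.
    rewrite -[_^-1 *+ 2]mulr_natr -ltr_pdivlMr//; near: n.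
    by apply: near_infty_natSinv_lt (PosNum (divr_gt0 e0 _)).
  split => /=; first by apply: lt_trans en; exact: fl.
  split=> // i j; rewrite /ball /= !mxE ffunE; apply: lt_trans en; exact: fl.
Unshelve. all: by end_near. Qed.

Lemma measurable_fun_torus w : continuous w ->
  measurable_fun setT (fun t : m.-tuple TR => w (tp t)).
Proof.
move=> cw.
have cPhi : continuous (fun z : R * 'rV[R]_m => w z.2).
  by move=> z; apply: cvg_comp; [exact: cvg_snd|exact: cw].
have := measurable_fun_cylinder cPhi.
move=> /(@measurableT_comp _ _ _ _ _ _ _ _ (fun t : m.-tuple TR => (0 : TR, t))).
apply; exact: measurable_pair1.
Qed.

Local Notation mu := (haar R m).

(** The fundamental theorem of calculus on every slice in direction [j]: the two boundary values
    cancel by periodicity. *)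
Lemma integral_haar_derive w w' (j : 'I_m) : rperiodic w -> rperiodic w' ->
  continuous w' -> (forall x, is_derive x (delta_mx 0 j) w (w' x)) ->
  (\int[mu]_t (w' (tp t))%:E = 0)%E.
Proof.
move=> pw pw' cw' dw.
have [C HC] := rperiodic_bounded pw' cw'.
have C0 : 0 <= C by exact: le_trans (HC 0).
apply: (@integral_slice0 _ _ _ j _ C) => //; first exact: measurable_fun_torus.
move=> t; set U := uniform_prob _.
pose y := tp t - tnth t j *: delta_mx 0 j.
pose g s := w' (s *: delta_mx 0 j + y).
have cline : continuous (fun s : R => s *: delta_mx 0 j + y).
  move=> s; apply: cvgD; last exact: cvg_cst.
  by apply: cvgZr_tmp; exact: cvg_id.
have cg : continuous g by move=> s; apply: cvg_comp; [exact: cline|exact: cw'].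
have mg : measurable_fun setT (g : measurableTypeR R -> R).
  exact: continuous_measurable_fun.
(* The term [C * s] makes the derivative nonnegative, so that it can be integrated against the
   uniform density; the constant [C] is subtracted at the end. *)
pose F s := w (s *: delta_mx 0 j + y) + C * s.
have dF (s : R) : is_derive s 1 F (g s + C).
  have dws : derivable w (s *: delta_mx 0 j + y) (delta_mx 0 j) by exact: ex_derive.
  have Dw := is_derive_line dws.
  have -> : g s + C = 'D_(delta_mx 0 j) w (s *: delta_mx 0 j + y) + C *: 1.
    by rewrite (@derive_val _ _ _ _ _ _ _ (dw _)) [C *: 1]mulr1.
  apply: is_deriveD.
have p0 : (0 : R) < 2 * pi by rewrite mulr_gt0 ?pi_gt0.
have gC0 s : 0 <= g s + C.
  by have := HC (s *: delta_mx 0 j + y); rewrite ler_norml -/(g s); lra.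
have cgC : continuous (fun s => g s + C).
  by move=> s; apply: cvgD; [exact: cg|exact: cvg_cst].
have I1 : (\int[U]_s (g s + C)%:E = C%:E)%E.
  rewrite integral_uniform//; last by apply/measurable_EFinP/measurable_funD.
  rewrite (@continuous_FTC2 _ _ F)//.
  - have -> : F (2 * pi) = F 0 + 2 * pi * C.
      rewrite /F scale0r add0r mulr0 addr0 [_ + y]addrC pw.
      by rewrite [C * _]mulrC.
    rewrite -EFinB -EFinM; congr EFin.
    by rewrite addrAC subrr add0r subr0 mulrA mulVf ?mul1r// gt_eqF.
  - exact: continuous_subspaceT.
  - split.
    + by move=> s _; exact: ex_derive.
    + apply: cvg_at_right_filter; apply: differentiable_continuous.
      by apply/derivable1_diffP; exact: ex_derive.
    + apply: cvg_at_left_filter; apply: differentiable_continuous.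
      by apply/derivable1_diffP; exact: ex_derive.
  - by move=> s _; rewrite derive1E (@derive_val _ _ _ _ _ _ _ (dF s)).
have intg : U.-integrable setT (EFin \o g).
  apply: (@le_integrable _ _ _ _ _ _ _ (EFin \o cst C)) => //.
  - exact/measurable_EFinP.
  - by move=> s _ /=; rewrite lee_fin (le_trans (HC _))// ler_norm.
  - exact: finite_measure_integrable_cst.
have I2 : (\int[U]_s (g s + C)%:E = \int[U]_s (g s)%:E + C%:E)%E.
  rewrite -[in RHS](integral_prob_cst U C%:E).
  under eq_integral do rewrite EFinD.
  by rewrite integralD//; exact: finite_measure_integrable_cst.
have : (\int[U]_s (g s)%:E + C%:E = C%:E)%E by rewrite -I2.
under [X in _ -> X = _]eq_integral do rewrite torus_point_set_tnth.
move/(congr1 (fun z => z - C%:E)%E); rewrite subee// => <-.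
by rewrite -addeA subee// adde0.
Qed.

(** The uniform law sits on the closed interval, and its right endpoint is a null set. The half-open
    box is the domain on which [cos_arc] describes rays. *)
Lemma haar_full : {ae mu, forall t, forall j, 0 <= tnth t j < 2 * pi}.
Proof.
pose N (j : 'I_m) := [set t : m.-tuple TR | ~ (0 <= tnth t j < 2 * pi)].
have p0 : (0 : R) < 2 * pi by rewrite mulr_gt0 ?pi_gt0.
have neg j : mu.-negligible (N j).
  pose B := ~` [set` `[0, 2 * pi[ ] : set TR.
  exists [set t | B (tnth t j)]; split => //.
  - by rewrite -[X in measurable X]setTI; apply: measurable_tnth => //; exact: measurableC.
  - rewrite [LHS]tuple_prob_tnth; last exact: measurableC.
    transitivity (\int[lebesgue_measure]_(x in B) (uniform_pdf 0 (2 * pi) x)%:E)%E => //.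
    rewrite integral_uniform_pdf.
    apply: null_set_integral => //.
    + by apply: measurableI => //; exact: measurableC.
    + apply: measurable_funTS; apply/measurable_EFinP; exact: measurable_uniform_pdf.
    apply: (@subset_measure0 _ _ _ lebesgue_measure _ [set 2 * pi]) => //.
    + by apply: measurableI => //; exact: measurableC.
    + move=> x [] /=; rewrite !in_itv /= => /negP nx /andP[x0 x2].
      by apply/eqP; rewrite eq_le x2 leNgt; apply/negP => xx; move: nx; rewrite in_itv /= x0 xx.
    + exact: lebesgue_measure_set1.
apply: filter_forall => j; apply: negligibleS (neg j) => t /= h; exact: h.
Qed.

(** A nonzero value persists on a small box, and boxes with nonempty interior in the fundamental
    domain have positive measure. *)
Lemma haar_eq0 w : rperiodic w -> continuous w ->
  {ae mu, forall t, w (tp t) = 0} -> w = cst 0.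
Proof.
move=> pw cw [N [mN N0 HN]]; apply/funext => x; apply/eqP/negPn/negP => wx.
have [y hy wy] := rperiodic_fundamental x pw; rewrite -wy in wx.
have p0 : (0 : R) < 2 * pi by rewrite mulr_gt0 ?pi_gt0.
have /nbhs_ballP[d /= d0 Hd] : \forall z \near y, w z != 0.
  exact: cvgr_neq0 (cw y) wx.
(* The box extends only upwards from [y] and is cut at [2 * pi], so it stays in the fundamental
   domain even if [y] lies on the lower boundary. *)
pose A (j : 'I_m) : set TR := [set` `]y 0 j, Num.min (y 0 j + d) (2 * pi)[].
have sub : [set t : m.-tuple TR | forall j, A j (tnth t j)] `<=` N.
  move=> t At; apply: HN => /= w0.
  have /Hd /= : ball y d (tp t); last by rewrite w0 eqxx.
  split=> // i j; rewrite ord1 /ball /= mxE ltr_norml.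
  have := At j; rewrite /A /= in_itv /= lt_min => /and3P[h1 h2 h3].
  by apply/andP; split; lra.
have mA j : measurable (A j) by exact: measurable_itv.
have : (0 < mu [set t : m.-tuple TR | forall j, A j (tnth t j)])%E.
  apply: tuple_prob_box_gt0 => // j.
  have /andP[y0 y2] := hy j.
  have lt_A : y 0 j < Num.min (y 0 j + d) (2 * pi) by rewrite lt_min ltrDl d0.
  change (0 < \int[lebesgue_measure]_(x in A j) (uniform_pdf 0 (2 * pi) x)%:E)%E.
  rewrite (eq_integral (cst (2 * pi)^-1%:E)).
    rewrite (integral_cst lebesgue_measure (mA j)).
    rewrite [X in (_ * X)%E](_ : _ = (Num.min (y 0 j + d) (2 * pi) - y 0 j)%:E); last first.
      by apply: etrans (lebesgue_measure_itv _) _; rewrite /= lte_fin lt_A.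
    rewrite -EFinM lte_fin.
    by rewrite mulr_gt0 ?invr_gt0// subr_gt0.
  move=> s; rewrite /A inE /= in_itv /= lt_min => /and3P[h1 h2 h3].
  by rewrite /uniform_pdf subr0 !ltW//; exact: le_lt_trans h1.
rewrite lt_neqAle => /andP[/eqP + _]; apply; apply/esym.
by apply: subset_measure0 N0 => //; exact: measurable_tuple_box.
Qed.

End TorusFunctions.

(** * The Hartley kernels: derivatives, integration by parts, orthonormality *)

Section Hartley.
Context {R : realType} {m : nat}.
Implicit Types (p : 'rV[int]_m) (x v : 'rV[R]_m).

Definition cas (a : R) : R := cos a + sin a.

Definition dotp p x : R := \sum_j (p 0 j)%:~R * x 0 j.

Definition hart p x : R := cas (dotp p x).

Lemma dotpDr p x v : dotp p (x + v) = dotp p x + dotp p v.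
Proof. by rewrite -big_split; apply: eq_bigr => j _; rewrite mxE mulrDr. Qed.

Lemma dotpZr p a x : dotp p (a *: x) = a * dotp p x.
Proof. by rewrite mulr_sumr; apply: eq_bigr => j _; rewrite mxE mulrCA. Qed.

Lemma dotpDl p q x : dotp (p + q) x = dotp p x + dotp q x.
Proof.
by rewrite -big_split; apply: eq_bigr => j _; rewrite mxE intrD mulrDl.
Qed.

Lemma dotpNl p x : dotp (- p) x = - dotp p x.
Proof. by rewrite -sumrN; apply: eq_bigr => j _; rewrite mxE mulrNz mulNr. Qed.

Lemma dotp0l x : dotp 0 x = 0.
Proof. by rewrite /dotp big1 // => j _; rewrite mxE mul0r. Qed.

Lemma dotp0r p : dotp p 0 = 0.
Proof. by rewrite /dotp big1 // => j _; rewrite mxE mulr0. Qed.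

Lemma dotp_delta p (j : 'I_m) : dotp p (delta_mx 0 j) = (p 0 j)%:~R.
Proof.
rewrite /dotp (bigD1 j)//= !mxE !eqxx mulr1 big1 ?addr0// => i ij.
by rewrite !mxE eqxx (negPf ij) mulr0.
Qed.

Lemma hart_norm p x : `|hart p x| <= 2.
Proof.
rewrite (le_trans (ler_normD _ _))// (_ : 2 = 1 + 1)// lerD//.
  by rewrite ler_norml cos_geN1 cos_le1.
by rewrite ler_norml sin_geN1 sin_le1.
Qed.

Lemma continuous_dotp p : continuous (dotp p).
Proof.
move=> x; rewrite /dotp; apply: (@cvg_big _ _ _ _ _ _ _ (nbhs x)) => [|j _].
  exact: add_continuous.
by apply: cvgM; [exact: cvg_cst|exact: coord_continuous].
Qed.

(** cas'(a) = cas(- a), so differentiation sends the mode [p] to the mode [- p]. *)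
Lemma is_derive_hart p x v :
  is_derive x v (hart p) (dotp p v * hart (- p) x).
Proof.
rewrite (_ : _ * _ = (- sin (dotp p x) + cos (dotp p x)) * dotp p v); last first.
  by rewrite /hart dotpNl /cas cosN sinN; ring.
apply: (@is_derive_comp1 _ _ (dotp p) cas).
by apply: is_derive_affine => h; rewrite dotpDr dotpZr.
Qed.

Lemma continuous_hart p : continuous (hart p).
Proof.
move=> x; apply: (@continuous_comp _ _ _ (dotp p) cas); first exact: continuous_dotp.
by apply: cvgD; [exact: continuous_cos|exact: continuous_sin].
Qed.

Lemma hart_periodic p : rperiodic (hart p).
Proof.
have cas2pi b : cas (b + 2 * pi) = cas b by rewrite /cas mulr_natl cosD2pi sinD2pi.
by move=> j x; rewrite /hart dotpDr dotpZr dotp_delta (periodic_int cas2pi).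
Qed.

Local Notation mu := (haar R m).
Local Notation tp := (@torus_point R m).

Definition char p : m.-tuple (measurableTypeR R) -> R := fun t => hart p (tp t).

Lemma measurable_char p : measurable_fun setT (char p).
Proof. by apply: measurable_fun_torus; exact: continuous_hart. Qed.

Lemma char_norm p t : `|char p t| <= 2. Proof. exact: hart_norm. Qed.

Lemma integrable_bounded (f : m.-tuple (measurableTypeR R) -> R) (C : R) :
  measurable_fun setT f -> (forall t, `|f t| <= C) ->
  mu.-integrable setT (EFin \o f).
Proof.
move=> mf fC; apply: (@le_integrable _ _ _ _ _ _ _ (EFin \o cst C)) => //.
- exact/measurable_EFinP.
- by move=> t _ /=; rewrite lee_fin (le_trans (fC _))// ler_norm.
- exact: finite_measure_integrable_cst.
Qed.

Lemma L2_bounded (f : m.-tuple (measurableTypeR R) -> R) (C : R) :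
  measurable_fun setT f -> (forall t, `|f t| <= C) -> f \in Lfun mu 2%:E.
Proof.
move=> mf fC; apply: L2P => //.
have : mu.-integrable setT (EFin \o (fun t => f t ^+ 2)).
  apply: (@integrable_bounded _ (C ^+ 2)); first exact: measurable_funX.
  by move=> t; rewrite normrX lerXn2r ?nnegrE// (le_trans _ (fC t)).
move=> /integrableP[_]; apply: le_lt_trans; apply: ge0_le_integral => //.
- by move=> t _; rewrite lee_fin sqr_ge0.
- exact/measurable_EFinP/measurable_funX.
- by apply: measurableT_comp => //; exact/measurable_EFinP/measurable_funX.
- by move=> t _; rewrite /= lee_fin ler_norm.
Qed.

Lemma L2_char p : char p \in Lfun mu 2%:E.
Proof. by apply: (@L2_bounded _ 2) => [|t]; [exact: measurable_char|exact: char_norm]. Qed.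

Lemma L2_continuous (w : 'rV[R]_m -> R) : rperiodic w -> continuous w ->
  (w \o tp) \in Lfun mu 2%:E.
Proof.
move=> pw cw; have [C HC] := rperiodic_bounded pw cw.
by apply: (@L2_bounded _ C) => [|t]; [exact: measurable_fun_torus|exact: HC].
Qed.

(** Integration by parts: the derivative of [w * hart p] has integral 0, and the derivative of
    [hart p] produces the mode [- p]. *)
Lemma ip_derive_hart (w w' : 'rV[R]_m -> R) p (j : 'I_m) :
  rperiodic w -> continuous w -> rperiodic w' -> continuous w' ->
  (forall x, is_derive x (delta_mx 0 j) w (w' x)) ->
  ip mu (w' \o tp) (char p) = - ((p 0 j)%:~R * ip mu (w \o tp) (char (- p))).
Proof.
move=> pw cw pw' cw' dw.
apply/eqP; rewrite -subr_eq0 opprK; apply/eqP/EFin_inj.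
pose z x := w' x * hart p x + (p 0 j)%:~R * (w x * hart (- p) x).
rewrite -[RHS](_ : (\int[mu]_t (z (tp t))%:E = 0)%E); last first.
  apply: (@integral_haar_derive _ _ (fun x => w x * hart p x) z j).
  - by move=> i x; rewrite pw hart_periodic.
  - by move=> i x; rewrite /z pw pw' !hart_periodic.
  - move=> x; apply: (@continuousD _ _ _ (fun x => w' x * hart p x)).
      by apply: (@continuousM _ _ w' (hart p)); [exact: cw'|exact: continuous_hart].
    apply: (@continuousM _ _ (cst (p 0 j)%:~R) (fun x => w x * hart (- p) x)).
      exact: cst_continuous.
    by apply: (@continuousM _ _ w (hart (- p))); [exact: cw|exact: continuous_hart].
  - move=> x; have d1 := dw x; have d2 := is_derive_hart p x (delta_mx 0 j).
    have d12 := is_deriveM d1 d2.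
    apply: is_derive_eq d12 _.
    by rewrite /z dotp_delta /GRing.scale /=; ring.
have L1 := L2_continuous pw' cw'; have L2 := L2_continuous pw cw.
have LZ : mu.-integrable setT
    (fun t => ((p 0 j)%:~R)%:E * (w (tp t) * char (- p) t)%:E)%E.
  by apply: integrableZl => //; exact: ip_integrable L2 (L2_char _).
transitivity (\int[mu]_t z (tp t))%:E.
  congr EFin; rewrite /ip -RintegralZl//; last exact: ip_integrable L2 (L2_char _).
  rewrite -RintegralD//; first exact: ip_integrable L1 (L2_char _).
rewrite /Rintegral fineK//; apply: integrable_fin_num => //.
exact: (integrableD measurableT (ip_integrable L1 (L2_char p)) LZ).
Qed.

(** This is cas a cas b = cos (a - b) + sin (a + b), with cos and sin written as the even and odd
    parts of cas. *)
Lemma charM p q t : char p t * char q t =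
  (char (p - q) t + char (q - p) t + (char (p + q) t - char (- (p + q)) t)) / 2.
Proof.
rewrite /char /hart dotpNl !dotpDl !dotpNl -[dotp q _ - _]opprB /cas !cosN !sinN.
by set a := dotp p _; set b := dotp q _; rewrite cosB [sin (a + b)]sinD; field.
Qed.

Lemma char0E t : char 0 t = 1.
Proof. by rewrite /char /hart dotp0l /cas cos0 sin0 addr0. Qed.

(** If [p 0 j] is nonzero, [hart p] is up to a nonzero factor the j-th derivative of [hart (- p)];
    integration by parts against the constant [char 0] then gives 0. *)
Lemma ip_char0 p : ip mu (char p) (char 0) = (p == 0)%:R.
Proof.
have [->|p0] := eqVneq p 0.
  apply: EFin_inj; rewrite (ip_EFin (L2_char 0) (L2_char 0)).
  by under eq_integral do rewrite char0E mulr1; exact: integral_prob_cst.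
have [j pj] : exists j, p 0 j != 0.
  by apply/existsP; rewrite -negb_forall; apply: contra p0 => /forallP p0;
     apply/eqP/rowP => j; rewrite mxE; apply/eqP.
pose c : R := ((- p) 0 j)%:~R.
have c0 : c != 0 by rewrite intr_eq0 mxE oppr_eq0.
apply: (mulfI c0); rewrite mulr0 -ipZl; [|exact: L2_char..].
have := @ip_derive_hart (hart (- p)) (c \*: hart p) 0 j.
rewrite mxE mul0r oppr0; apply; [exact: hart_periodic|exact: continuous_hart| | |].
- by move=> i x; rewrite /= hart_periodic.
- by move=> x; apply: (@continuousM _ _ (cst c) (hart p)); [exact: cst_continuous|exact: continuous_hart].
- move=> x; apply: is_derive_eq (is_derive_hart (- p) x _) _.
  by rewrite dotp_delta opprK.
Qed.

Lemma char_orthonormal p q : ip mu (char p) (char q) = (p == q)%:R.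
Proof.
transitivity (ip mu (2^-1 *: (char (p - q) + char (q - p) +
    (char (p + q) - char (- (p + q))))) (char 0)).
  by apply: eq_Rintegral => t _; rewrite char0E mulr1 charM mulrC.
have L := L2_char; have LD := L2D (L (p - q)) (L (q - p)).
have LB := L2B (L (p + q)) (L (- (p + q))).
rewrite (ipZl _ (L2D LD LB) (L 0)) (ipDl LD LB (L 0)) (ipDl (L (p - q)) (L (q - p)) (L 0)).
rewrite (ipBl (L (p + q)) (L (- (p + q))) (L 0)) !ip_char0 oppr_eq0 subrr addr0 !subr_eq0 [q == p]eq_sym.
by case: (p == q); field.
Qed.

End Hartley.

(** * Partial sums of the exponential series *)

Section ExponentialSums.
Context {R : realType}.
Implicit Types (x y r : R).

Definition exp_psum y n : R := series (exp_coeff y) n.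

Lemma exp_psum_le y n : `|exp_psum y n| <= expR `|y|.
Proof.
rewrite /exp_psum /series /=; apply: le_trans (ler_norm_sum _ _ _) _.
have -> : \sum_(0 <= i < n) `|exp_coeff y i| = series (exp_coeff `|y|) n.
  by apply: eq_bigr => i _; rewrite /exp_coeff /= normrM normrX normfV (@ger0_norm _ i`!%:R).
apply: nondecreasing_cvgn_le; last exact: is_cvg_series_exp_coeff.
by apply: nondecreasing_series => i _ _; rewrite exp_coeff_ge0.
Qed.

Lemma exp_psum_cvg y : exp_psum y n @[n --> \oo] --> expR y.
Proof. exact: is_cvg_series_exp_coeff. Qed.

End ExponentialSums.

(** * Completeness of the Hartley system *)

Section HartleyComplete.
Context {R : realType} {m : nat}.
Local Notation TR := (measurableTypeR R).
Local Notation T := (m.-tuple TR).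
Local Notation mu := (haar R m).
Variable f : T -> R.
Hypothesis fL : f \in Lfun mu 2%:E.
Hypothesis f_char : forall p : 'rV[int]_m, ip mu f (char p) = 0.

Definition bounded_measurable (g : T -> R) :=
  measurable_fun setT g /\ exists C, forall t, `|g t| <= C.

Definition annihilates (g : T -> R) :=
  bounded_measurable g /\ forall p, ip mu (g * char p) f = 0.

(* The bounded functions that preserve the annihilator of f form an algebra
   closed under bounded pointwise limits; it contains the Hartley kernels,
   hence the indicator functions of all measurable sets. *)
Definition multiplier (h : T -> R) :=
  bounded_measurable h /\ forall g, annihilates g -> annihilates (h * g).

Lemma bounded_measurable_L2 g : bounded_measurable g -> g \in Lfun mu 2%:E.
Proof. by move=> [mg [C HC]]; exact: L2_bounded HC. Qed.

Lemma bounded_measurable_char p : bounded_measurable (char p).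
Proof. by split; [exact: measurable_char|exists 2; exact: char_norm]. Qed.

Lemma bounded_measurableM g h : bounded_measurable g -> bounded_measurable h ->
  bounded_measurable (g * h).
Proof.
move=> [mg [C HC]] [mh [D HD]]; split; first exact: measurable_funM.
by exists (C * D) => t; rewrite normrM ler_pM.
Qed.

Lemma bounded_measurableD g h : bounded_measurable g -> bounded_measurable h ->
  bounded_measurable (g + h).
Proof.
move=> [mg [C HC]] [mh [D HD]]; split; first exact: measurable_funD.
by exists (C + D) => t; rewrite (le_trans (ler_normD _ _))// lerD.
Qed.

Lemma bounded_measurableZ a g : bounded_measurable g ->
  bounded_measurable (a *: g).
Proof.
move=> [mg [C HC]]; split; first by apply: measurable_funM.
by exists (`|a| * C) => t; rewrite normrM ler_wpM2l.
Qed.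

Lemma bounded_measurable_cst a : bounded_measurable (cst a).
Proof. by split => //; exists `|a|. Qed.

Lemma char_L2M g p : bounded_measurable g -> g * char p \in Lfun mu 2%:E.
Proof.
move=> bg; apply: bounded_measurable_L2; apply: bounded_measurableM => //.
exact: bounded_measurable_char.
Qed.

Lemma annihilatesD g h : annihilates g -> annihilates h -> annihilates (g + h).
Proof.
move=> [bg ag] [bh ah]; split; first exact: bounded_measurableD.
by move=> p; rewrite mulrDl ipDl// ?char_L2M// ag ah addr0.
Qed.

Lemma annihilatesZ a g : annihilates g -> annihilates (a *: g).
Proof.
move=> [bg ag]; split; first exact: bounded_measurableZ.
move=> p; have -> : (a *: g) * char p = a *: (g * char p).
  by apply/funext => t; rewrite !fctE /GRing.scale /= mulrA.
by rewrite ipZl// ?char_L2M// ag mulr0.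
Qed.

Lemma annihilates1 : annihilates (cst 1).
Proof.
split; first exact: bounded_measurable_cst.
move=> p; rewrite -[RHS](f_char p) ipC; congr ip.
by apply/funext => t; rewrite !fctE mul1r.
Qed.

Lemma multiplierD g h : multiplier g -> multiplier h -> multiplier (g + h).
Proof.
move=> [bg ag] [bh ah]; split; first exact: bounded_measurableD.
by move=> k ak; rewrite mulrDl; apply: annihilatesD; [exact: ag|exact: ah].
Qed.

Lemma multiplierZ a g : multiplier g -> multiplier (a *: g).
Proof.
move=> [bg ag]; split; first exact: bounded_measurableZ.
move=> k ak; have -> : (a *: g) * k = a *: (g * k).
  by apply/funext => t; rewrite !fctE /GRing.scale /= mulrA.
by apply: annihilatesZ; exact: ag.
Qed.

Lemma multiplierM g h : multiplier g -> multiplier h -> multiplier (g * h).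
Proof.
move=> [bg ag] [bh ah]; split; first exact: bounded_measurableM.
by move=> k ak; rewrite -mulrA; apply: ag; exact: ah.
Qed.

Lemma multiplier_cst a : multiplier (cst a).
Proof.
split; first exact: bounded_measurable_cst.
move=> k ak; have -> : cst a * k = a *: k by [].
exact: annihilatesZ.
Qed.

(** By [charM] a product of two kernels is a combination of four kernels, all of which are
    annihilated once multiplied by [k]. *)
Lemma multiplier_char p : multiplier (char p).
Proof.
split; first exact: bounded_measurable_char.
move=> k [bk ak]; split.
  by apply: bounded_measurableM => //; exact: bounded_measurable_char.
move=> q.
have -> : char p * k * char q = 2^-1 *: (k * char (p - q)) +
    (2^-1 *: (k * char (- (p - q))) + (2^-1 *: (k * char (p + q)) +
    (- 2^-1) *: (k * char (- (p + q))))).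
  by apply/funext => t; rewrite !fctE /GRing.scale /= mulrAC charM opprB; field.
have L := fun p => char_L2M p bk.
rewrite !ipDl ?ipZl ?ak ?mulr0 ?addr0//; do ?[apply: L2D]; by apply: L2Z.
Qed.

Lemma multiplier_ae g h : bounded_measurable h -> {ae mu, forall t, g t = h t} ->
  multiplier g -> multiplier h.
Proof.
move=> bh gh [bg ag]; split => // k ak; have [bk _] := ak.
have bhk := bounded_measurableM bh bk.
have bgk := bounded_measurableM bg bk.
split => // p; have [_ agk] := ag _ ak; rewrite -(agk p); apply/esym.
apply: ae_eq_ip; rewrite ?char_L2M//.
by apply: filterS gh => t; rewrite !fctE => ->.
Qed.

(** Dominated convergence with the majorant [C * D * 2] times |f|; [f] is integrable because it is
    square integrable for a probability. *)
Lemma multiplier_lim (u : nat -> T -> R) h C : (forall n, multiplier (u n)) ->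
  (forall n t, `|u n t| <= C) -> (forall t, u n t @[n --> \oo] --> h t) ->
  multiplier h.
Proof.
move=> mu_ uC uh.
have mh : measurable_fun setT h.
  apply: (measurable_fun_cvg (h := u)) => [n|t _]; last exact: uh.
  by have [[]] := mu_ n.
have bh : bounded_measurable h.
  split => //; exists C => t.
  have cn : `|u n t| @[n --> \oo] --> `|h t| by apply: cvg_norm; exact: uh.
  rewrite -(cvg_lim _ cn)//; apply: limr_le; first by apply/cvg_ex; eexists; exact: cn.
  exact: nearW.
split => // k ak; have [bk _] := ak; have bhk := bounded_measurableM bh bk.
split => // p; have [_ [D HD]] := bk.
have L n : u n * k * char p \in Lfun mu 2%:E.
  by apply: char_L2M; apply: bounded_measurableM => //; have [] := mu_ n.
have Lh : h * k * char p \in Lfun mu 2%:E by exact: char_L2M.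
have mf := L2_measurable fL.
have mE (g : T -> R) : g \in Lfun mu 2%:E ->
    measurable_fun setT (fun t => (g t * f t)%:E).
  by move=> gL; apply/measurable_EFinP/measurable_funM => //; exact: L2_measurable gL.
have cpt : {ae mu, forall t, setT t -> ((u n * k * char p) t * f t)%:E @[n --> \oo]
    --> ((h * k * char p) t * f t)%:E}.
  apply: aeW => t _; apply: cvg_EFin; first exact: nearW.
  have cu : u n t * k t * char p t * f t @[n --> \oo] --> h t * k t * char p t * f t.
    do 3![apply: cvgM; last exact: cvg_cst]; exact: uh.
  exact: cu.
have dom : {ae mu, forall t n, setT t -> (`|((u n * k * char p) t * f t)%:E| <=
    (C * D * 2)%:E * `|(f t)%:E|)%E}.
  apply: aeW => t n _; rewrite lee_fin normrM ler_wpM2r// !fctE !normrM.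
  have C0 : 0 <= C by exact: le_trans (uC 0%N t).
  by rewrite ler_pM ?mulr_ge0// ?char_norm// ler_pM.
have int_dom : mu.-integrable setT (fun t => (C * D * 2)%:E * `|(f t)%:E|)%E.
  by apply: integrableZl => //; apply: integrable_abse; exact: L2_integrable.
have [_ _ cI] := dominated_convergence measurableT (fun n => mE _ (L n)) (mE _ Lh)
  cpt int_dom dom.
apply: EFin_inj; rewrite ip_EFin//.
rewrite -(cvg_lim _ cI)//; apply/cvg_lim => //; apply: cvg_near_cst; apply: nearW => n /=.
by rewrite -ip_EFin//; have [_ ma] := mu_ n; have [_ ->] := ma _ ak.
Qed.

Lemma multiplier_prod (I : Type) (r : seq I) (F : I -> T -> R) :
  (forall i, multiplier (F i)) -> multiplier (\prod_(i <- r) F i).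
Proof.
move=> mF; elim/big_rec: _ => [|i g _ mg]; first exact: multiplier_cst.
exact: multiplierM.
Qed.

Lemma multiplierX h n : multiplier h -> multiplier (h ^+ n).
Proof.
move=> mh; elim: n => [|n IHn]; first exact: multiplier_cst.
by rewrite exprS; exact: multiplierM.
Qed.

(** The partial sums of the exponential series are polynomials in [h], bounded uniformly by the
    exponential of a bound for [h]. *)
Lemma multiplier_expR h : multiplier h -> multiplier (fun t => expR (h t)).
Proof.
move=> mh; have [[_ [C HC]] _] := mh.
apply: (@multiplier_lim (fun n t => exp_psum (h t) n) _ (expR C)) => [n|n t|t].
- elim: n => [|n IHn].
    rewrite (_ : (fun t => _) = cst 0); first exact: multiplier_cst.
    by apply/funext => t; rewrite /exp_psum /series /= big_geq.
  rewrite (_ : (fun t => _) = (fun t => exp_psum (h t) n) + n`!%:R^-1 *: h ^+ n).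
    by apply: multiplierD => //; apply: multiplierZ; exact: multiplierX.
  apply/funext => t; rewrite !fctE /exp_psum /series /= big_nat_recr//=.
  by rewrite /exp_coeff /= mulrC.
- by apply: le_trans (exp_psum_le _ _) _; rewrite ler_expR.
- exact: exp_psum_cvg.
Qed.

Definition multiplier_set (A : set T) := multiplier (\1_A).

Lemma multiplier_setC A : multiplier_set A -> multiplier_set (~` A).
Proof.
move=> mA; rewrite /multiplier_set.
have -> : \1_(~` A) = cst 1 + (-1) *: \1_A :> (T -> R).
  by apply/funext => t; rewrite !fctE /GRing.scale /= !indicE in_setC; case: (t \in A) => /=; lra.
by apply: multiplierD; [exact: multiplier_cst|exact: multiplierZ].
Qed.

Lemma multiplier_setI A B : multiplier_set A -> multiplier_set B ->
  multiplier_set (A `&` B).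
Proof.
move=> mA mB; rewrite /multiplier_set.
by rewrite indicI; exact: multiplierM.
Qed.

Lemma multiplier_bigcap (F : nat -> set T) : (forall n, multiplier_set (F n)) ->
  multiplier_set (\bigcap_n F n).
Proof.
move=> mF; apply: (@multiplier_lim (fun n => \prod_(i < n) \1_(F i)) _ 1).
- by move=> n; rewrite -(big_mkord xpredT (fun i => \1_(F i) : T -> R)); exact: multiplier_prod.
- move=> n t; elim: n => [|n IHn]; first by rewrite big_ord0 normr1.
  rewrite big_ord_recr /= fctE normrM -[leRHS]mulr1 ler_pM//.
  by rewrite indicE; case: (_ \in _); rewrite ?normr1 ?normr0.
- move=> t; apply: cvg_near_cst.
  have prodE n : (\prod_(i < n) \1_(F i) : T -> R) t = \prod_(i < n) \1_(F i) t.
    by elim: n => [|n IHn]; rewrite ?big_ord0// !big_ord_recr /= fctE IHn.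
  have [tF|/existsNP[n tF]] := pselect (forall n, F n t).
    apply: nearW => n; rewrite prodE big1 => [|i _].
      by rewrite indicE mem_set// => i _; exact: tF.
    by rewrite indicE mem_set.
  exists n.+1 => // k /= nk; rewrite prodE (bigD1 (Ordinal nk))//= indicE memNset// mul0r.
  by rewrite indicE memNset// => /(_ n I).
Qed.

Lemma multiplier_bigcup (F : nat -> set T) : (forall n, multiplier_set (F n)) ->
  multiplier_set (\bigcup_n F n).
Proof.
move=> mF; rewrite -[X in multiplier_set X]setCK setC_bigcup.
apply: multiplier_setC; apply: multiplier_bigcap => n; exact: multiplier_setC.
Qed.

Lemma multiplier_set0 : multiplier_set set0.
Proof. by rewrite /multiplier_set indic0; exact: multiplier_cst. Qed.

(* exp (- exp (n h)) tends to 1 where h < 0, to 1 / e where h = 0 and to 0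
   where h > 0; powers of the limit tend to the indicator function. *)
Lemma multiplier_lt0 h : multiplier h -> multiplier_set [set t | h t < 0].
Proof.
move=> mh; pose e t : R := if h t < 0 then 1 else if h t == 0 then expR (- 1) else 0.
have [e0 e1] : 0 <= expR (- 1 : R) /\ expR (- 1 : R) < 1 by rewrite expR_ge0 expR_lt1; split=> //; lra.
have me : multiplier e.
  apply: (@multiplier_lim (fun n t => expR (- (expR (h t) ^+ n))) _ 1) => [n|n t|t].
  - apply: multiplier_expR.
    have := multiplierZ (-1) (multiplierX n (multiplier_expR mh)); congr multiplier.
    by apply/funext => t; rewrite !fctE scaleN1r.
  - by rewrite ger0_norm ?expR_ge0// -expR0 ler_expR oppr_le0 exprn_ge0// expR_ge0.
  - rewrite /e; case: (ltgtP (h t) 0) => h0.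
    + have c : - (expR (h t) ^+ n) @[n --> \oo] --> (- 0 : R).
        by apply: cvgN; apply: cvg_expr; rewrite ger0_norm ?expR_ge0// expR_lt1.
      by have := cvg_comp _ _ c (@continuous_expR R (- 0)); rewrite oppr0 expR0.
    + have c : expR (- h t) ^+ n @[n --> \oo] --> 0.
        by apply: cvg_expr; rewrite ger0_norm ?expR_ge0// expR_lt1 oppr_lt0.
      apply: (squeeze_cvgr _ (cvg_cst 0) c); apply: nearW => n; rewrite expR_ge0 /=.
      rewrite -!expRM_natl ler_expR mulrN lerN2.
      by apply: le_trans (expR_ge1Dx _); rewrite lerDr.
    + by apply: cvg_near_cst; apply: nearW => n; rewrite h0 expR0 expr1n.
apply: (@multiplier_lim (fun n => e ^+ n) _ 1) => [n|n t|t].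
- exact: multiplierX.
- rewrite fctE normrX exprn_ile1// /e; case: ifP => _; rewrite ?normr1//.
  by case: ifP => _; rewrite ?normr0// ger0_norm; lra.
- rewrite indicE; have [h0|h0] := ltP (h t) 0.
    rewrite mem_set//; apply: cvg_near_cst; apply: nearW => n.
    by rewrite fctE /e h0 expr1n.
  rewrite memNset; last by apply/negP; rewrite -leNgt.
  have c : e t ^+ n @[n --> \oo] --> 0.
    by apply: cvg_expr; rewrite /e [h t < 0]ltNge h0 /=; case: ifP => _; rewrite ?normr0// ger0_norm; lra.
  by apply: cvg_trans c; apply: near_eq_cvg; apply: nearW => n; rewrite fctE.
Qed.

(** The arc [0, a] of the circle consists of the points whose distance to the midpoint a / 2 is at
    most a / 2. Cosine turns this into the sign of a trigonometric polynomial, to which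
    [multiplier_lt0] applies. *)
Lemma cos_arc (a x : R) : 0 <= a < 2 * pi -> 0 <= x < 2 * pi ->
  (0 <= cos (x - a / 2) - cos (a / 2)) = (x <= a).
Proof.
move=> /andP[a0 a2] /andP[x0 x2]; have pi0 := pi_gt0 R.
have ina : a / 2 \in `[0, pi] by rewrite in_itv /=; apply/andP; split; lra.
rewrite subr_ge0; have [xa|ax] := leP x a.
  have -> : cos (x - a / 2) = cos `|x - a / 2|.
    by case: (ger0P (x - a / 2)) => _; rewrite ?cosN.
  have dle : `|x - a / 2| <= a / 2 by rewrite ler_norml; apply/andP; split; lra.
  rewrite leNgt ltr_cos -?leNgt// in_itv /= normr_ge0 /=; apply: le_trans dle _; lra.
apply/negbTE; rewrite -ltNge.
have [dpi|pid] := leP (x - a / 2) pi.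
  rewrite ltr_cos//; last by rewrite in_itv /=; apply/andP; split; lra.
  lra.
have -> : cos (x - a / 2) = cos (2 * pi - (x - a / 2)).
  by rewrite -cosN -cosD2pi -[pi *+ 2]mulr_natl; congr cos; ring.
rewrite ltr_cos//; last by rewrite in_itv /=; apply/andP; split; lra.
lra.
Qed.

Lemma measurable_ray (j : 'I_m) (a : R) : measurable [set t : T | tnth t j <= a].
Proof.
have := @measurable_tnth _ TR m j measurableT (`]-oo, a]%classic) (measurable_itv _).
by rewrite setTI; congr measurable; apply/seteqP; split => t /=; rewrite in_itv.
Qed.

Lemma bounded_measurable_indic (A : set T) : measurable A ->
  bounded_measurable (\1_A).
Proof.
move=> mA; split; first exact: measurable_indic.
by exists 1 => t; rewrite indicE; case: (_ \in _); rewrite ?normr1 ?normr0.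
Qed.

Lemma multiplier_cos_tnth (j : 'I_m) (a : R) :
  multiplier (fun t => cos (tnth t j - a)).
Proof.
pose p : 'rV[int]_m := delta_mx 0 j.
have dE t : dotp p (torus_point t) = tnth t j.
  rewrite /dotp (bigD1 j)//= !mxE !eqxx mul1r big1 ?addr0// => i ij.
  by rewrite !mxE eqxx (negPf ij) mul0r.
have -> : (fun t => cos (tnth t j - a)) =
    ((cos a + sin a) / 2) *: char p + ((cos a - sin a) / 2) *: char (- p).
  apply/funext => t; rewrite !fctE /GRing.scale /= /char /hart dotpNl dE.
  by rewrite cosB /cas cosN sinN; field.
by apply: multiplierD; apply: multiplierZ; exact: multiplier_char.
Qed.

(** Inside the fundamental domain a ray is an arc, hence by [cos_arc] the complement of a set
    [h < 0]; for [a] outside [0, 2 pi[ it is almost everywhere empty or full. *)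
Lemma multiplier_ray (j : 'I_m) (a : R) :
  multiplier_set [set t | tnth t j <= a].
Proof.
have bm := bounded_measurable_indic (measurable_ray j a).
have full := @haar_full R m; have FF := ae_filter_ringOfSetsType mu.
have [a0|a0] := ltP a 0.
  apply: (@multiplier_ae (cst 0)) => //; last exact: multiplier_cst.
  apply: filterS full => t /(_ j) /andP[t0 _].
  by rewrite indicE memNset// => /= ta; have := le_lt_trans (le_trans t0 ta) a0; rewrite ltxx.
have [a2|a2] := leP (2 * pi) a.
  apply: (@multiplier_ae (cst 1)) => //; last exact: multiplier_cst.
  apply: filterS full => t /(_ j) /andP[_ t2].
  by rewrite indicE mem_set//=; exact: ltW (lt_le_trans t2 a2).
pose h (t : T) := cos (tnth t j - a / 2) - cos (a / 2).
have mh : multiplier h.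
  have -> : h = (fun t => cos (tnth t j - a / 2)) + cst (- cos (a / 2)) by [].
  by apply: multiplierD; [exact: multiplier_cos_tnth|exact: multiplier_cst].
apply: (@multiplier_ae _ _ bm _ (multiplier_setC (multiplier_lt0 mh))).
apply: filterS full => t /(_ j) tj; rewrite !indicE in_setC; congr (_%:R).
have -> : (t \in [set t | h t < 0]) = (h t < 0) by apply/idP/idP; rewrite inE.
have -> : (t \in [set t | tnth t j <= a]) = (tnth t j <= a) by apply/idP/idP; rewrite inE.
by rewrite -leNgt /h cos_arc// a0.
Qed.

(** The sets [B] with this property form a sigma-algebra that contains the generating intervals ]a,
    b]. The same scheme is then repeated with these cylinders as generators of the product
    sigma-algebra. *)
Lemma multiplier_tnth (j : 'I_m) (B : set TR) : measurable B ->
  multiplier_set [set t | B (tnth t j)].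
Proof.
apply: (@smallest_sub _ (sigma_algebra setT) _
   [set B | multiplier_set [set t | B (tnth t j)]]).
  split.
  - exact: multiplier_set0.
  - move=> A mA; rewrite setTD; exact: (multiplier_setC mA).
  - move=> F mF /=; exact: multiplier_bigcup.
move=> _ [[a b] _ <-] /=.
have -> : [set t : T | `]a, b]%classic (tnth t j)] =
    [set t | tnth t j <= b] `&` ~` [set t | tnth t j <= a].
  apply/seteqP; split => t /=; rewrite in_itv /=.
    by move=> /andP[ta tb]; split => //; apply/negP; rewrite -ltNge.
  by move=> [tb /negP]; rewrite -ltNge => ->.
by apply: multiplier_setI; [|apply: multiplier_setC]; exact: multiplier_ray.
Qed.

Lemma multiplier_measurable (A : set T) : measurable A -> multiplier_set A.
Proof.
apply: (@smallest_sub _ (sigma_algebra setT) _ multiplier_set).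
  split.
  - exact: multiplier_set0.
  - move=> B mB; rewrite setTD; exact: (multiplier_setC mB).
  - move=> F mF /=; exact: multiplier_bigcup.
move=> B; rewrite -bigcup_seq => -[j _ [C mC <-]]; rewrite setTI.
exact: multiplier_tnth.
Qed.

(** With [\1_A] as multiplier of the constant 1, the mode 0 says that the integral of [f] over [A]
    vanishes, for every measurable [A]. *)
Lemma hartley_complete : {ae mu, forall t, f t = 0}.
Proof.
have fI := L2_integrable fL.
have : ae_eq mu setT (EFin \o f) (cst 0%E).
  apply: (integral_ae_eq measurableT fI); first exact: measurable_cst.
  move=> A _ mA; rewrite integral0.
  have [_ mA1] := multiplier_measurable mA.
  have [_ /(_ 0)] := mA1 _ annihilates1.
  have -> : \1_A * cst 1 * char 0 = \1_A :> (T -> R).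
    by apply/funext => t; rewrite !fctE char0E !mulr1.
  move=> A0; rewrite integral_mkcond -[RHS](congr1 EFin A0) ip_EFin//.
    apply: eq_integral => t _; rewrite patchE indicE; case: (t \in A).
      by rewrite mul1r.
    by rewrite mul0r.
  by apply: bounded_measurable_L2; exact: bounded_measurable_indic.
by apply: filterS => t /= /(_ I) [].
Qed.

End HartleyComplete.

(** * Gaussian sums over the lattice and tempered sequences *)

Section Enumeration.
Context {R : realType} {m : nat}.
Variable kap : nat -> 'rV[int]_m.
Hypothesis kap_inj : injective kap.
Implicit Types (a b : nat -> R) (s : R).

Definition sqn n : R := \sum_j (kap n 0 j)%:~R ^+ 2.

Lemma sqn_ge0 n : 0 <= sqn n.
Proof. by apply: sumr_ge0 => j _; exact: sqr_ge0. Qed.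

(** The Gaussian factors over the coordinates and each factor is below a geometric term, so partial
    sums are bounded by the m-th power of a geometric series. *)
Lemma cvg_series_gauss s : 0 < s -> cvgn (series (fun n => expR (- (s * sqn n)))).
Proof.
(* The exponent is s / 2 because the coding [idx] of the integers satisfies
   [idx k / 2 <= k ^+ 2]. *)
move=> s0; pose rho : R := expR (- (s / 2)).
have rho0 : 0 < rho by exact: expR_gt0.
have rho1 : rho < 1 by rewrite expR_lt1; lra.
pose idx (k : int) : nat := match k with Posz n => n.*2 | Negz n => n.*2.+1 end.
have idx_inj : injective idx.
  case=> n [] n' //= => [/double_inj->//|/(congr1 odd)|/(congr1 odd)|[/double_inj->]//];
  by rewrite /= !odd_double.
have w_le (k : int) : expR (- (s * k%:~R ^+ 2)) <= rho ^+ idx k.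
  have k2 : (idx k)%:R / 2 <= (k%:~R ^+ 2 : R).
    have sq (n : nat) : n%:R <= n%:R ^+ 2 :> R.
      by rewrite -natrX ler_nat; case: n => // n; rewrite leq_pmulr.
    case: k => n /=.
      by rewrite -pmulrn -muln2 natrM mulfK//; exact: sq.
    rewrite NegzE mulrNz sqrrN -pmulrn; apply: le_trans (sq n.+1).
    by rewrite ler_pdivrMr// -natrM ler_nat muln2 doubleS.
  by rewrite /rho -expRM_natl ler_expR mulrN lerN2 mulrCA ler_pM2l.
apply: nondecreasing_is_cvgn.
  by apply: nondecreasing_series => n _ _; exact: expR_ge0.
exists ((1 - rho)^-1 ^+ m) => _ [N _ <-].
(* All coordinates of the first N lattice points have codes below [D]; since [kap] is injective, the
   partial sum is at most the sum over the whole cube, which factors. *)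
pose D := (\max_(i < N) \max_(j < m) idx (kap i ord0 j)).+1.
have idxD (i : 'I_N) j : (idx (kap i ord0 j) < D)%N.
  rewrite ltnS; apply: leq_trans (leq_bigmax i).
  exact: (leq_bigmax (F := fun j => idx (kap i ord0 j))).
pose F (i : 'I_N) : {ffun 'I_m -> 'I_D} := [ffun j => Ordinal (idxD i j)].
have F_inj : injective F.
  move=> i i' /ffunP FE; apply/val_inj/kap_inj/rowP => j; apply: idx_inj.
  by have := FE j; rewrite !ffunE => /(congr1 val).
rewrite /series /= big_mkord.
apply: (@le_trans _ _ (\sum_(i < N) \prod_j rho ^+ F i j)).
  apply: ler_sum => i _; rewrite /sqn mulr_sumr -sumrN expR_sum.
  by apply: ler_prod => j _; rewrite expR_ge0 /= ffunE /= w_le.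
have G0 (g : {ffun 'I_m -> 'I_D}) : 0 <= \prod_j rho ^+ g j.
  by apply: prodr_ge0 => j _; rewrite exprn_ge0// ltW.
have -> : \sum_(i < N) \prod_j rho ^+ F i j =
    \sum_(g in [set F i | i in [set: 'I_N]]%SET) \prod_j rho ^+ g j.
  rewrite big_imset /=; last by move=> i i' _ _; exact: F_inj.
  by apply: eq_bigl => i; rewrite inE.
apply: (@le_trans _ _ (\sum_(g : {ffun 'I_m -> 'I_D}) \prod_j rho ^+ g j)).
  rewrite big_mkcond /=; apply: ler_sum => g _.
  by case: ifP => // _; exact: G0.
rewrite -(bigA_distr_bigA (fun (_ : 'I_m) (i : 'I_D) => rho ^+ i)) prodr_const card_ord.
have sumE : (1 - rho) * (\sum_(i < D) rho ^+ i) <= 1.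
  by rewrite -[1 - rho]opprB mulNr -subrX1 opprB lerBlDr lerDl exprn_ge0// ltW.
apply: lerXn2r; rewrite ?nnegrE.
- by apply: sumr_ge0 => i _; rewrite exprn_ge0// ltW.
- by rewrite invr_ge0 subr_ge0 ltW.
by rewrite -[leRHS]mul1r ler_pdivlMr ?subr_gt0// mulrC.
Qed.

(** Growth slower than every exp (s |k|^2), in summed form. Bounded sequences, hence L^2
    coefficients, qualify, and polynomial factors in k, hence all derivatives, preserve the
    property. *)
Definition tempered a := forall s, 0 < s ->
  cvgn (series (fun n => `|a n| * expR (- (s * sqn n)))).

Lemma tempered_bounded a (C : R) : (forall n, `|a n| <= C) -> tempered a.
Proof.
move=> aC s s0.
have C0 : 0 <= C by exact: le_trans (aC 0%N).
have cC : cvgn (series (fun n => C * expR (- (s * sqn n)))).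
  by apply: (@is_cvg_seriesZ _ (fun n => expR (- (s * sqn n)))); exact: cvg_series_gauss.
apply: (series_le_cvg _ _ _ cC) => n.
- by rewrite mulr_ge0// expR_ge0.
- by rewrite mulr_ge0// expR_ge0.
- by rewrite ler_wpM2r// expR_ge0.
Qed.

(** Half of the decay pays for the factor 1 + x; the constant 2 / s comes from s x / 2 <= exp (s x /
    2). *)
Lemma poly_exp_le s (x : R) : 0 < s -> 0 <= x ->
  (1 + x) * expR (- (s * x)) <= (1 + 2 / s) * expR (- (s / 2 * x)).
Proof.
move=> s0 x0.
have -> : expR (- (s * x)) = expR (- (s / 2 * x)) * expR (- (s / 2 * x)).
  by rewrite -expRD; congr expR; field.
rewrite mulrA ler_wpM2r ?expR_ge0//.
rewrite expRN ler_pdivrMr ?expR_gt0// mulrDl mul1r; apply: lerD.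
  by rewrite -expR0 ler_expR mulr_ge0// divr_ge0// ltW.
have := expR_ge1Dx (s / 2 * x); set y := expR _ => hy.
have s2 : 0 < s / 2 by rewrite divr_gt0.
rewrite (_ : x = 2 / s * (s / 2 * x)); last by field; rewrite gt_eqF.
apply: ler_wpM2l; first by rewrite divr_ge0// ltW.
lra.
Qed.

Lemma tempered_le a b (C : R) : tempered a ->
  (forall n, `|b n| <= C * ((1 + sqn n) * `|a n|)) -> tempered b.
Proof.
move=> ta bC s s0.
have c1 := @is_cvg_seriesZ _ _ (`|C| * (1 + 2 / s)) (ta _ (divr_gt0 s0 (ltr0n _ 2))).
apply: (series_le_cvg _ _ _ c1) => n.
- by rewrite mulr_ge0// expR_ge0.
- rewrite !fctE mulr_ge0// ?mulr_ge0// ?expR_ge0//.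
  by rewrite addr_ge0// divr_ge0// ltW.
- have q0 := sqn_ge0 n.
  apply: (@le_trans _ _ (`|C| * ((1 + sqn n) * `|a n|) * expR (- (s * sqn n)))).
    rewrite ler_wpM2r ?expR_ge0//; apply: le_trans (bC n) _.
    by rewrite ler_wpM2r ?ler_norm// mulr_ge0// addr_ge0.
  rewrite (_ : _ * _ = `|C| * `|a n| * ((1 + sqn n) * expR (- (s * sqn n)))); last by ring.
  rewrite (_ : (_ *: _) n = `|C| * `|a n| * ((1 + 2 / s) * expR (- (s / 2 * sqn n)))).
    by rewrite ler_wpM2l ?mulr_ge0// poly_exp_le.
  by rewrite !fctE /GRing.scale /=; ring.
Qed.

Lemma tempered0 : tempered (fun=> 0).
Proof. by apply: (@tempered_bounded _ 0) => n; rewrite normr0. Qed.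

Lemma temperedD a b : tempered a -> tempered b -> tempered (fun n => a n + b n).
Proof.
move=> ta tb s s0; have c1 := is_cvg_seriesD (ta _ s0) (tb _ s0).
apply: (series_le_cvg _ _ _ c1) => n.
- by rewrite mulr_ge0// expR_ge0.
- by rewrite !fctE addr_ge0// mulr_ge0// expR_ge0.
- by rewrite !fctE -mulrDl ler_wpM2r ?expR_ge0// ler_normD.
Qed.

Lemma abs_le_sqr (x : R) : `|x| <= 1 + x ^+ 2.
Proof.
rewrite -[x ^+ 2]real_normK ?num_real//; have := normr_ge0 x; set y := `|x|.
by move=> y0; have := sqr_ge0 (y - 1); rewrite sqrrB1 expr2; nra.
Qed.

Lemma kap_le n j : `|(kap n 0 j)%:~R : R| <= 1 + sqn n.
Proof.
apply: le_trans (abs_le_sqr _) _; rewrite lerD2l /sqn (bigD1 j)//= lerDl.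
by apply: sumr_ge0 => i _; exact: sqr_ge0.
Qed.

Lemma dotp_le n (x : 'rV[R]_m) :
  `|dotp (kap n) x| <= (\sum_j `|x 0 j|) * (1 + sqn n).
Proof.
apply: le_trans (ler_norm_sum _ _ _) _; rewrite mulr_suml; apply: ler_sum => j _.
by rewrite normrM mulrC ler_wpM2l// kap_le.
Qed.

Lemma tempered_dotp a (x : 'rV[R]_m) : tempered a ->
  tempered (fun n => dotp (kap n) x * a n).
Proof.
move=> ta; apply: (tempered_le (C := \sum_j `|x 0 j|) ta) => n.
by rewrite normrM mulrA ler_wpM2r// dotp_le.
Qed.

Lemma temperedN a : tempered a -> tempered (fun n => - a n).
Proof. by move=> ta s s0; have := ta _ s0; under [in X in _ -> X]eq_fun do rewrite normrN. Qed.

Lemma temperedZ (c : R) a : tempered a -> tempered (fun n => c * a n).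
Proof.
move=> ta; apply: (tempered_le (C := `|c|) ta) => n; rewrite normrM ler_wpM2l//.
by rewrite ler_peMl// lerDl sqn_ge0.
Qed.

End Enumeration.

Lemma continuous_slice_snd (X Y Z : topologicalType) (f : X * Y -> Z) (t : X) (x : Y) :
  {for (t, x), continuous f} -> {for x, continuous (fun y => f (t, y))}.
Proof.
move=> cf; apply: (@continuous_comp _ _ _ (fun y => (t, y)) f) => //.
have cx : cst t @ x --> t by exact: cvg_cst.
exact: (@cvg_pair _ _ _ (nbhs x) (nbhs t) (nbhs x) _ _ _ (cst t) id cx (@cvg_id _ (nbhs x))).
Qed.

(** * Functions of class C^k on an open set *)

Section SmoothOnOpen.
Context {R : realType} {E : normedModType R}.
Implicit Types (U : set E) (f g : E -> R).

(** As [U] is open, agreement on [U] is agreement near each of its points, which passes to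
    continuity and to directional derivatives. *)
Lemma Ck_ext U k f g : open U -> (forall x, U x -> f x = g x) ->
  Ck U k f -> Ck U k g.
Proof.
move=> oU fg; have near_fg f' g' : (forall x, U x -> f' x = g' x) ->
    forall x, U x -> \forall y \near x, f' y = g' y.
  by move=> e x Ux; have := open_nbhs_nbhs (conj oU Ux); apply: filterS => y; exact: e.
have cont_ext f' g' : (forall x, U x -> f' x = g' x) ->
    (forall x, U x -> {for x, continuous f'}) ->
    forall x, U x -> {for x, continuous g'}.
  move=> e c x Ux; suff : g' @ x --> f' x by rewrite (e _ Ux).
  by apply: cvg_trans (c x Ux); apply: near_eq_cvg; apply: near_fg Ux => y Uy; rewrite e.
elim: k f g fg => [|k IHk] f g fg /= [cf rest]; (split; first exact: cont_ext fg cf) => //.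
move=> v; have [df Cf] := rest v; split.
  move=> x Ux; have := df x Ux; apply: near_eq_derivable.
  exact: near_fg fg x Ux.
apply: IHk Cf => x Ux; apply: near_eq_derive; exact: near_fg fg x Ux.
Qed.

Lemma CkD U k f g : open U -> Ck U k f -> Ck U k g -> Ck U k (f \+ g).
Proof.
move=> oU; elim: k f g => [|k IHk] f g /= [cf rf] [cg rg].
  by split=> // x Ux; apply: continuousD; [exact: cf|exact: cg].
split; first by move=> x Ux; apply: continuousD; [exact: cf|exact: cg].
move=> v; have [df Cf] := rf v; have [dg Cg] := rg v.
split; first by move=> x Ux; apply: derivableD; [exact: df|exact: dg].
apply: Ck_ext (IHk _ _ Cf Cg) => // x Ux /=.
by rewrite deriveD//; [exact: df|exact: dg].
Qed.

End SmoothOnOpen.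

(** * Weighted series in the kernels of opposite frequencies *)

Section PairSeries.
Context {R : realType} {m : nat}.
Variable kap : nat -> 'rV[int]_m.
Hypothesis kap_inj : injective kap.
Implicit Types (a b w : nat -> R) (x : 'rV[R]_m).
Local Notation tempered := (tempered kap).

Definition weight w := forall a, tempered a -> cvgn (series (fun n => `|w n * a n|)).

(** Every frequency occurs both as [kap n] and as the opposite of some other one. This redundancy
    lets derivatives exchange [a] and [b] instead of reindexing the series. *)
Definition pair_series w a b x : R :=
  limn (series (fun n => w n * (a n * hart (kap n) x + b n * hart (- kap n) x))).

Definition pair_bound w a b n : R := 2 * (`|w n * a n| + `|w n * b n|).

(** The two kernels may carry different multipliers, as happens with the truncated cosh and sinh in
    [exp_psum_pair_cvg]. *)
Lemma pair_term_le (w c c' u v : R) (p : 'rV[int]_m) x : `|c| <= `|w| -> `|c'| <= `|w| ->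
  `|c * (u * hart p x) + c' * (v * hart (- p) x)| <= 2 * (`|w * u| + `|w * v|).
Proof.
move=> cw cw'; rewrite (le_trans (ler_normD _ _))// [2 * _]mulrDr !normrM.
by rewrite lerD// mulrA mulrC ler_pM ?mulr_ge0 ?hart_norm// ler_wpM2r.
Qed.

Lemma pair_bound_ge0 w a b n : 0 <= pair_bound w a b n.
Proof. by rewrite mulr_ge0// addr_ge0. Qed.

Lemma pair_bound_summable w a b : weight w -> tempered a -> tempered b ->
  cvgn (series (pair_bound w a b)).
Proof.
move=> ww ta tb; apply: (@is_cvg_seriesZ _ (fun n => `|w n * a n| + `|w n * b n|)).
by apply: is_cvg_seriesD; exact: ww.
Qed.

Lemma eq_pair_series w a b a' b' x : a =1 a' -> b =1 b' ->
  pair_series w a b x = pair_series w a' b' x.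
Proof. by move=> /funext -> /funext ->. Qed.

Lemma pair_series_cvg w a b x : weight w -> tempered a -> tempered b ->
  cvgn (series (fun n => w n * (a n * hart (kap n) x + b n * hart (- kap n) x))).
Proof.
move=> ww ta tb; apply: (series_tail _ (pair_bound_summable ww ta tb)).1 => n.
by rewrite mulrDr; exact: pair_term_le.
Qed.

Lemma pair_seriesD w a b a' b' x (s : R) : weight w ->
  tempered a -> tempered b -> tempered a' -> tempered b' ->
  pair_series w (fun n => s * a n + a' n) (fun n => s * b n + b' n) x =
  s * pair_series w a b x + pair_series w a' b' x.
Proof.
move=> ww ta tb ta' tb'.
have c1 := pair_series_cvg (x := x) ww ta tb; have c2 := pair_series_cvg (x := x) ww ta' tb'.
rewrite /pair_series -[s * limn _]/(s *: limn (series _)) -lim_seriesZ// -lim_seriesD//; last exact: is_cvg_seriesZ.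
congr (limn (series _)); apply/funext => n.
rewrite -[RHS]/(s * (w n * (a n * hart (kap n) x + b n * hart (- kap n) x)) +
  w n * (a' n * hart (kap n) x + b' n * hart (- kap n) x)); ring.
Qed.

Lemma pair_series0 w x : pair_series w (fun=> 0) (fun=> 0) x = 0.
Proof.
apply/cvg_lim; first exact: Rhausdorff.
apply: cvg_near_cst; apply: nearW => k.
by rewrite /series /= big1// => n _; rewrite !mul0r addr0 mulr0.
Qed.

Lemma pair_seriesZ w a b x (s : R) : weight w -> tempered a -> tempered b ->
  pair_series w (fun n => s * a n) (fun n => s * b n) x = s * pair_series w a b x.
Proof.
move=> ww ta tb; rewrite -[RHS]addr0 -(pair_series0 w x) -pair_seriesD//; do ?exact: tempered0.
by apply: eq_pair_series => n; rewrite addr0.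
Qed.

Lemma tempered_sum (I : Type) (r : seq I) (s : I -> R) (a : I -> nat -> R) :
  (forall i, tempered (a i)) ->
  tempered (fun n => \sum_(i <- r) s i * a i n).
Proof.
move=> ta; elim: r => [|i r IHr].
  rewrite (_ : (fun _ => _) = (fun=> 0)); first exact: tempered0.
  by apply/funext => n; rewrite big_nil.
rewrite (_ : (fun _ => _) = (fun n => s i * a i n + \sum_(i <- r) s i * a i n)).
  by apply: temperedD => //; exact: temperedZ.
by apply/funext => n; rewrite big_cons.
Qed.

Lemma pair_series_sum w (I : Type) (r : seq I) (s : I -> R) (a b : I -> nat -> R) x :
  weight w -> (forall i, tempered (a i)) -> (forall i, tempered (b i)) ->
  pair_series w (fun n => \sum_(i <- r) s i * a i n) (fun n => \sum_(i <- r) s i * b i n) x =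
  \sum_(i <- r) s i * pair_series w (a i) (b i) x.
Proof.
move=> ww ta tb; elim: r => [|i r IHr].
  rewrite [RHS]big_nil; apply: etrans (pair_series0 w x).
  by apply: eq_pair_series => n; rewrite big_nil.
rewrite big_cons -IHr -pair_seriesD; [|exact: ww|exact: ta|exact: tb| |]; do ?exact: tempered_sum.
by apply: eq_pair_series => n; rewrite big_cons.
Qed.

Lemma pair_series_periodic w a b : rperiodic (pair_series w a b).
Proof.
move=> j x; congr (limn _); apply/funext => n; apply: eq_bigr => i _.
by rewrite !hart_periodic.
Qed.

Lemma weightZ (c : R) w : weight w -> weight (fun n => c * w n).
Proof.
move=> ww a ta; have := @is_cvg_seriesZ _ _ `|c| (ww _ ta).
by congr (cvgn (series _)); apply/funext => n; rewrite -mulrA [RHS]normrM.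
Qed.

Lemma weight_gauss (t : R) : 0 < t -> weight (fun n => expR (- (t * (sqn kap n / 2)))).
Proof.
move=> t0 a ta; have := ta _ (divr_gt0 t0 (ltr0n _ 2)).
rewrite [X in series X](_ : _ = (fun n => `|expR (- (t * (sqn kap n / 2))) * a n|))//.
apply/funext => k; rewrite normrM [`|expR _|]ger0_norm ?expR_ge0// [RHS]mulrC.
by congr (_ * expR (- _)); field.
Qed.

End PairSeries.

(* Common treatment of the heat flow and of the exponentials exp(-x0 D): on
   the n-th Fourier modes both act by weights W t n with dW/dt = be n W. *)
Section FlowSeries.
Context {R : realType} {m : nat}.
Variable kap : nat -> 'rV[int]_m.
Variables (W : R -> nat -> R) (be : nat -> R) (U : set R).
Local Notation tempered := (tempered kap).
Local Notation weight := (weight kap).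
Hypothesis oU : open U.
Hypothesis dW : forall (t : R) n, is_derive t 1 (W ^~ n) (be n * W t n).
Hypothesis W_le : forall t, U t ->
  exists2 w, weight w & \forall s \near t, forall n, `|W s n| <= `|w n|.
Hypothesis tempered_be : forall (c : R) a, tempered a -> tempered (fun n => c * be n * a n).
Implicit Types (a b : nat -> R) (z v : R * 'rV[R]_m) (x : 'rV[R]_m).

Definition flow_term a b n z : R :=
  W z.1 n * (a n * hart (kap n) z.2 + b n * hart (- kap n) z.2).

Definition flow_series a b z : R := pair_series kap (W z.1) a b z.2.

(** Coefficients of the derivative along [v]: the weight contributes the rate [be n] to both
    families, and the kernels exchange the families with opposite signs since their frequencies are
    opposite. *)
Definition dflow1 v a b n : R := v.1 * be n * a n - dotp (kap n) v.2 * b n.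
Definition dflow2 v a b n : R := v.1 * be n * b n + dotp (kap n) v.2 * a n.

Lemma is_derive_hart_snd p z v :
  is_derive z v (fun y => hart p y.2 : R) (dotp p v.2 * hart (- p) z.2).
Proof.
by apply: (is_derive_comp_affine (hart p) (phi := snd) _ _).2; last exact: is_derive_hart.
Qed.

Lemma is_derive_flow_weight n z v :
  is_derive z v (fun y : R * 'rV[R]_m => W y.1 n) (be n * W z.1 n * v.1).
Proof.
have d0 : is_derive z v (fun y : R * 'rV[R]_m => y.1) v.1 by exact: is_derive_affine.
exact: is_derive_comp1 d0 (dW z.1 n).
Qed.

Lemma is_derive_flow_term a b n z v : is_derive z v (flow_term a b n)
  (flow_term (dflow1 v a b) (dflow2 v a b) n z).
Proof.
have d2 : is_derive z v
    (fun y : R * 'rV[R]_m => a n * hart (kap n) y.2 + b n * hart (- kap n) y.2 : R)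
    (a n * (dotp (kap n) v.2 * hart (- kap n) z.2) +
     b n * (dotp (- kap n) v.2 * hart (- - kap n) z.2)) :=
  is_deriveD (is_deriveZ (a n) (is_derive_hart_snd (kap n) z v))
    (is_deriveZ (b n) (is_derive_hart_snd (- kap n) z v)).
have d3 : is_derive z v (flow_term a b n)
    (W z.1 n * (a n * (dotp (kap n) v.2 * hart (- kap n) z.2) +
     b n * (dotp (- kap n) v.2 * hart (- - kap n) z.2)) +
     (a n * hart (kap n) z.2 + b n * hart (- kap n) z.2) * (be n * W z.1 n * v.1)) :=
  is_deriveM (is_derive_flow_weight n z v) d2.
apply: is_derive_eq d3 _.
by rewrite /flow_term /dflow1 /dflow2 opprK dotpNl; ring.
Qed.

Lemma tempered_dflow1 v a b : tempered a -> tempered b -> tempered (dflow1 v a b).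
Proof.
move=> ta tb; apply: temperedD; first exact: tempered_be.
by apply: temperedN; exact: tempered_dotp.
Qed.

Lemma tempered_dflow2 v a b : tempered a -> tempered b -> tempered (dflow2 v a b).
Proof. by move=> ta tb; apply: temperedD; [exact: tempered_be|exact: tempered_dotp]. Qed.

Lemma flow_term_le w a b n z : `|W z.1 n| <= `|w n| ->
  `|flow_term a b n z| <= pair_bound w a b n.
Proof. by move=> Ww; rewrite /flow_term mulrDr; exact: pair_term_le. Qed.

Lemma near_flow_weight z : U z.1 ->
  exists2 w, weight w & \forall y \near z, forall n, `|W y.1 n| <= `|w n|.
Proof.
move=> /W_le[w ww Ww]; exists w => //.
have : (fun y : R * 'rV[R]_m => y.1) @ z --> z.1 by exact: cvg_fst.
by move=> /(_ _ Ww).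
Qed.

Lemma is_derive_flow_series a b z v : tempered a -> tempered b -> U z.1 ->
  is_derive z v (flow_series a b) (flow_series (dflow1 v a b) (dflow2 v a b) z).
Proof.
move=> ta tb /near_flow_weight[w ww near_z].
have t1 : tempered (dflow1 v a b) by exact: tempered_dflow1.
have t2 : tempered (dflow2 v a b) by exact: tempered_dflow2.
have c := is_cvg_seriesD (pair_bound_summable ww ta tb) (pair_bound_summable ww t1 t2).
have := @is_derive_lim_series _ _ (fun n y => flow_term a b n y) _ z v c.
have -> : (fun n => 'D_v (flow_term a b n) z) =
    (fun n => flow_term (dflow1 v a b) (dflow2 v a b) n z).
  by apply/funext => n; case: (is_derive_flow_term a b n z v).
apply; near=> y => n.
have Wy : forall n, `|W y.1 n| <= `|w n| by near: y.
have [d1 d2] := is_derive_flow_term a b n y v; split => //.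
- by apply: le_trans (flow_term_le _ _ (Wy n)) _; rewrite !fctE lerDl pair_bound_ge0.
- by rewrite d2; apply: le_trans (flow_term_le _ _ (Wy n)) _; rewrite !fctE lerDr pair_bound_ge0.
Unshelve. all: by end_near. Qed.

Lemma continuous_flow_series a b z : tempered a -> tempered b -> U z.1 ->
  {for z, continuous (flow_series a b)}.
Proof.
move=> ta tb /near_flow_weight[w ww near_z].
apply: (@continuous_lim_series _ _ (flow_term a b) _ z (pair_bound_summable ww ta tb)).
  by apply: filterS near_z => y Wy n; exact: flow_term_le.
move=> n; have cd p : {for z, continuous (fun y : R * 'rV[R]_m => hart p y.2 : R)}.
  by apply: continuous_comp; [exact: cvg_snd|exact: continuous_hart].
apply: (@continuousM _ _ (fun y : R * 'rV[R]_m => W y.1 n)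
    (fun y => a n * hart (kap n) y.2 + b n * hart (- kap n) y.2)).
  apply: (@continuous_comp _ _ _ (fun y : R * 'rV[R]_m => y.1) (W ^~ n)); first exact: cvg_fst.
  by apply: differentiable_continuous; apply/derivable1_diffP; case: (dW z.1 n).
apply: (@continuousD _ _ _ (fun y : R * 'rV[R]_m => a n * hart (kap n) y.2)
    (fun y => b n * hart (- kap n) y.2)).
  by apply: (@continuousM _ _ (cst (a n)) (fun y : R * 'rV[R]_m => hart (kap n) y.2));
     [exact: cst_continuous|exact: cd].
by apply: (@continuousM _ _ (cst (b n)) (fun y : R * 'rV[R]_m => hart (- kap n) y.2));
   [exact: cst_continuous|exact: cd].
Qed.

(** A derivative is again a flow series with tempered coefficients, so the induction on [k]
    closes. *)
Lemma Ck_flow_series k a b : tempered a -> tempered b ->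
  Ck [set z : R * 'rV[R]_m | U z.1] k (flow_series a b).
Proof.
have oU2 : open [set z : R * 'rV[R]_m | U z.1].
  by apply: (@open_comp _ _ fst U) => // z _; exact: cvg_fst.
elim: k a b => [|k IHk] a b ta tb /=; split=> //;
  do ?by move=> z Uz; exact: continuous_flow_series.
move=> v; split.
  by move=> z Uz; case: (is_derive_flow_series v ta tb Uz).
apply: Ck_ext (IHk _ _ (tempered_dflow1 (v := v) ta tb) (tempered_dflow2 (v := v) ta tb)) => // z Uz.
by case: (is_derive_flow_series v ta tb Uz).
Qed.

End FlowSeries.

(** * Regularity in the space variable for a fixed weight *)

Section PairSeriesCalculus.
Context {R : realType} {m : nat}.
Variable kap : nat -> 'rV[int]_m.
Hypothesis kap_inj : injective kap.
Local Notation tempered := (tempered kap).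
Implicit Types (a b w : nat -> R) (x v : 'rV[R]_m).

(** A fixed weight is a flow with rate 0, and the space derivative is read off on a slice. *)
Lemma is_derive_pair_series w a b x v : weight kap w -> tempered a -> tempered b ->
  is_derive x v (pair_series kap w a b)
    (pair_series kap w (fun n => - (dotp (kap n) v * b n)) (fun n => dotp (kap n) v * a n) x).
Proof.
move=> ww ta tb; apply: (@is_derive_slice_snd _ _ _ (flow_series kap (fun=> w) a b) 0).
have dw (t : R) n : is_derive t 1 ((fun=> w) ^~ n) ((fun=> 0) n * w n).
  by rewrite mul0r; exact: is_derive_cst.
have w_le (t : R) : setT t ->
    exists2 w', weight kap w' & \forall s \near t, forall n, `|(fun=> w) s n| <= `|w' n|.
  by move=> _; exists w => //; near=> s.
have t0 (c : R) a' : tempered a' -> tempered (fun n => c * (fun=> 0) n * a' n).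
  by move=> ta'; apply: (tempered_bounded kap_inj (C := 0)) => n; rewrite mulr0 mul0r normr0.
have := is_derive_flow_series dw w_le t0 (0, v) ta tb (z := (0, x)) I.
by congr is_derive; apply: eq_pair_series => n; rewrite /dflow1 /dflow2 mulr0 mul0r add0r.
Unshelve. all: by end_near. Qed.

Lemma continuous_pair_series w a b : weight kap w -> tempered a -> tempered b ->
  continuous (pair_series kap w a b).
Proof.
move=> ww ta tb x; apply: (continuous_lim_series (pair_bound_summable ww ta tb)).
  by near=> y => n; rewrite mulrDr; exact: pair_term_le.
move=> n; apply: (@continuousM _ _ (cst (w n))); first exact: cst_continuous.
apply: (@continuousD _ _ _ (fun y => a n * hart (kap n) y) (fun y => b n * hart (- kap n) y)).
  by apply: (@continuousM _ _ (cst (a n))); [exact: cst_continuous|exact: continuous_hart].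
by apply: (@continuousM _ _ (cst (b n))); [exact: cst_continuous|exact: continuous_hart].
Unshelve. all: by end_near. Qed.

Lemma Ck_pair_series k w a b : weight kap w -> tempered a -> tempered b ->
  Ck setT k (pair_series kap w a b).
Proof.
move=> ww; elim: k a b => [|k IHk] a b ta tb /=; (split; first by move=> x _; exact: continuous_pair_series) => //.
move=> v; split.
  by move=> x _; case: (is_derive_pair_series x v ww ta tb).
have t1 : tempered (fun n => - (dotp (kap n) v * b n)).
  by apply: temperedN; exact: tempered_dotp.
have t2 : tempered (fun n => dotp (kap n) v * a n) by exact: tempered_dotp.
apply: Ck_ext (IHk _ _ t1 t2); first exact: openT.
by move=> x _; case: (is_derive_pair_series x v ww ta tb).
Qed.

End PairSeriesCalculus.

(** * Series solutions of the heat equation *)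

Section HeatSeries.
Context {R : realType} {m : nat}.
Variable kap : nat -> 'rV[int]_m.
Implicit Types (a b : nat -> R) (z v : R * 'rV[R]_m) (t : R).
Local Notation q := (sqn kap : nat -> R).
Local Notation tempered := (tempered kap).

Definition heat_weight t n : R := expR (- (t * (q n / 2))).
Definition heat_rate n : R := - (q n / 2).

Definition heat_series a b z : R := pair_series kap (heat_weight z.1) a b z.2.

Lemma is_derive_heat_weight t n :
  is_derive t 1 (heat_weight ^~ n) (heat_rate n * heat_weight t n).
Proof.
have d0 : is_derive t 1 (fun t : R => - (t * (q n / 2))) (heat_rate n).
  by apply: is_derive_affine => h; rewrite /heat_rate [h *: 1]mulr1; ring.
by apply: is_derive_eq (is_derive_comp1 d0 (is_derive_expR _)) _; rewrite mulrC.
Qed.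

Lemma heat_weight_le t : 0 < t ->
  exists2 w, weight kap w & \forall s \near t, forall n, `|heat_weight s n| <= `|w n|.
Proof.
(* Halving the time leaves a Gaussian weight that dominates all times near [t]. *)
move=> t0; exists (heat_weight (t / 2)); first by apply: weight_gauss; rewrite divr_gt0.
have near_t : \forall s \near t, t / 2 <= s.
  by apply: (@cvgr_ge _ _ _ _ id t (@cvg_id _ (nbhs t))); lra.
apply: filterS near_t => s ts n.
by rewrite !ger0_norm ?expR_ge0// ler_expR lerN2 ler_wpM2r// divr_ge0// sqn_ge0.
Qed.

Lemma tempered_heat_rate (c : R) a : tempered a -> tempered (fun n => c * heat_rate n * a n).
Proof.
move=> ta; apply: (tempered_le (C := `|c|) ta) => n; rewrite !normrM -mulrA ler_wpM2l//.
by rewrite ler_wpM2r// normrN ger0_norm ?divr_ge0 ?sqn_ge0//; have := sqn_ge0 kap n : 0 <= q n; lra.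
Qed.

Lemma is_derive_heat_series a b z v : tempered a -> tempered b -> 0 < z.1 ->
  is_derive z v (heat_series a b)
    (heat_series (dflow1 kap heat_rate v a b) (dflow2 kap heat_rate v a b) z).
Proof.
by move=> ta tb; exact: (is_derive_flow_series is_derive_heat_weight heat_weight_le
  tempered_heat_rate v ta tb).
Qed.

Lemma Ck_heat_series k a b : tempered a -> tempered b ->
  Ck [set z : R * 'rV[R]_m | 0 < z.1] k (heat_series a b).
Proof.
move=> ta tb; have oU : open [set t : R | 0 < t] by exact: open_gt.
exact: (Ck_flow_series oU is_derive_heat_weight heat_weight_le tempered_heat_rate k ta tb).
Qed.

End HeatSeries.

(** * Fourier coefficients in the enumerated Hartley basis *)

Section TorusFourier.
Context {R : realType} {m : nat}.
Local Notation TR := (measurableTypeR R).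
Local Notation mu := (haar R m).
Local Notation tp := (@torus_point R m).
Variable kap : nat -> 'rV[int]_m.
Hypothesis kap_inj : injective kap.
Hypothesis kap_surj : forall p, exists n, kap n = p.
Implicit Types (h : m.-tuple TR -> R) (f : 'rV[R]_m -> R) (a b w : nat -> R).

Definition coef f n : R := ip mu (f \o tp) (char (kap n)).

Lemma ip_char n k : ip mu (char (kap n)) (char (kap k)) = (n == k)%:R.
Proof. by rewrite char_orthonormal (inj_eq kap_inj). Qed.

Lemma coef_complete h : h \in Lfun mu 2%:E ->
  (forall n, ip mu h (char (kap n)) = 0) -> {ae mu, forall t, h t = 0}.
Proof.
by move=> hL h0; apply: hartley_complete => // p; have [n <-] := kap_surj p.
Qed.

Lemma coef_parseval f : (f \o tp) \in Lfun mu 2%:E ->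
  series (fun n => coef f n ^+ 2) @ \oo --> ip mu (f \o tp) (f \o tp).
Proof.
move=> fL; apply: (parseval (e := fun n => char (kap n))) => //.
- by move=> n; exact: L2_char.
- exact: ip_char.
- exact: coef_complete.
Qed.

Lemma coefB f g n : (f \o tp) \in Lfun mu 2%:E -> (g \o tp) \in Lfun mu 2%:E ->
  coef (f - g) n = coef f n - coef g n.
Proof. by move=> fL gL; rewrite /coef -ipBl//; exact: L2_char. Qed.

Lemma coefD f g n : (f \o tp) \in Lfun mu 2%:E -> (g \o tp) \in Lfun mu 2%:E ->
  coef (f + g) n = coef f n + coef g n.
Proof. by move=> fL gL; rewrite /coef -ipDl//; exact: L2_char. Qed.

Lemma coefZ c f n : (f \o tp) \in Lfun mu 2%:E ->
  coef (c *: f) n = c * coef f n.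
Proof. by move=> fL; rewrite /coef -ipZl//; exact: L2_char. Qed.

Lemma coef_sum (I : finType) (s : I -> R) (w : I -> 'rV[R]_m -> R) n :
  (forall i, w i \o tp \in Lfun mu 2%:E) ->
  coef (fun x => \sum_i s i * w i x) n = \sum_i s i * coef (w i) n.
Proof.
move=> wL.
pose rel (u : 'rV[R]_m -> R) (y : R) := u \o tp \in Lfun mu 2%:E /\ coef u n = y.
suff [_ <-] : rel (\sum_i s i *: w i) (\sum_i s i * coef (w i) n).
  by congr coef; apply/funext => x; rewrite fct_sumE.
apply: (big_ind2 rel) => [|u y u' y' [uL <-] [uL' <-]|i _].
- split; last exact: ip0l.
  by apply: (L2_bounded (C := 0)) => [|y]; [exact: measurable_cst|rewrite normr0].
- by split; [exact: L2D uL uL'|exact: coefD].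
- split; last exact: coefZ.
  exact: (L2Z _ (wL i)).
Qed.

Lemma coef_ae f g : (f \o tp) \in Lfun mu 2%:E -> (g \o tp) \in Lfun mu 2%:E ->
  {ae mu, forall t, f (tp t) = g (tp t)} <-> coef f =1 coef g.
Proof.
move=> fL gL; split.
  by move=> fg n; apply: ae_eq_ip => //; exact: L2_char.
move=> fg; have := coef_complete (L2B fL gL).
move=> /(_ _)/wrap[n|].
  by rewrite ipBl//; [rewrite -/(coef f n) fg subrr|exact: L2_char].
have FF := ae_filter_ringOfSetsType mu.
by apply: filterS => t /eqP; rewrite subr_eq0 => /eqP.
Qed.

(** Completeness gives equality almost everywhere, and [haar_eq0] upgrades it to every point. *)
Lemma coef_ext f g : rperiodic f -> continuous f -> rperiodic g -> continuous g ->
  coef f =1 coef g -> f = g.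
Proof.
move=> pf cf pg cg fg.
have fL := L2_continuous pf cf; have gL := L2_continuous pg cg.
have : f - g = cst 0.
  apply: haar_eq0.
  - by move=> j x; rewrite !fctE pf pg.
  - by move=> x; apply: continuousB; [exact: cf|exact: cg].
  - have [_ /(_ fg)] := coef_ae fL gL.
    have FF := ae_filter_ringOfSetsType mu.
    by apply: filterS => t; rewrite !fctE => ->; rewrite subrr.
by move=> /eqP; rewrite subr_eq0 => /eqP.
Qed.

(** The function of [riesz_fischer] is given by an explicit limsup of partial sums. The same formula
    makes sense on all of R^m, where it is periodic because every kernel is. *)
Lemma coef_riesz_fischer a : cvgn (series (fun n => a n ^+ 2)) ->
  exists f, [/\ rperiodic f, (f \o tp) \in Lfun mu 2%:E & coef f =1 a].
Proof.
move=> /(riesz_fischer (fun n => L2_char (kap n)) ip_char)[phi] /= [fL fa _].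
exists (fun x => fine (limn_esup (fun k => (\sum_(i < phi k) a i * hart (kap i) x)%:E))).
have E : (fun x => fine (limn_esup (fun k => (\sum_(i < phi k) a i * hart (kap i) x)%:E))) \o tp =
    (fun t => fine (limn_esup (fun k => (fsum (fun n => char (kap n)) a (phi k) t)%:E))).
  apply/funext => t /=; congr (fine (limn_esup _)); apply/funext => k.
  by rewrite fsumE /series /= big_mkord.
split.
- move=> j x; congr (fine (limn_esup _)); apply/funext => k; congr EFin.
  by apply: eq_bigr => i _; rewrite hart_periodic.
- by rewrite E.
- by move=> n; rewrite /coef E fa.
Qed.

Lemma ip_norm_le (g h : m.-tuple TR -> R) (c d : R) : g \in Lfun mu 2%:E ->
  h \in Lfun mu 2%:E -> (forall t, `|g t| <= c) -> (forall t, `|h t| <= d) ->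
  `|ip mu g h| <= c * d.
Proof.
move=> gL hL gc hd.
rewrite /ip; apply: le_trans (le_normr_Rintegral measurableT (ip_integrable gL hL)) _.
rewrite (_ : c * d = \int[mu]_t (c * d)); last by rewrite /Rintegral integral_prob_cst.
apply: le_Rintegral => //.
- by have := integrable_abse (ip_integrable gL hL).
- exact: finite_measure_integrable_cst.
- by move=> t _; rewrite normrM ler_pM.
Qed.

(** Absolute summability makes the convergence uniform. For [N > l] the partial sum has the right
    coefficient, and the supremum of the remainder bounds the error. *)
Lemma coef_series (phi : nat -> R) l : cvgn (series (fun n => `|phi n|)) ->
  coef (fun x => limn (series (fun n => phi n * hart (kap n) x))) l = phi l.
Proof.
move=> cphi; pose e n := char (kap n) : m.-tuple TR -> R.
pose G t := limn (series (fun n => phi n * e n t)).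
have gM n t : `|phi n * e n t| <= 2 * `|phi n|.
  by rewrite normrM mulrC ler_wpM2r// char_norm.
have cM : cvgn (series (fun n => 2 * `|phi n|)) by exact: is_cvg_seriesZ.
have tail t := series_tail (gM^~ t) cM; set M := series _ in cM tail.
have eL n : e n \in Lfun mu 2%:E by exact: L2_char.
have SL N : fsum e phi N \in Lfun mu 2%:E by exact: fsum_L2.
have mG : measurable_fun setT G.
  apply: (measurable_fun_cvg (h := fsum e phi)) => [n|t _]; first exact: L2_measurable.
  under eq_fun do rewrite fsumE; exact: (tail t).1.
have GL : G \in Lfun mu 2%:E.
  apply: (@L2_bounded _ _ _ (limn M - M 0%N)) => // t.
  by have := (tail t).2 0%N; rewrite {2}/series /= big_geq// subr0.
have M0 : (limn M - M N) * 2 @[N --> \oo] --> (limn M - limn M) * 2.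
  by apply: cvgMl; apply: cvgB => //; exact: cvg_cst.
rewrite subrr mul0r in M0; apply/eqP; rewrite -subr_eq0 -normr_le0.
rewrite -(cvg_lim _ M0)//; apply: limr_ge; first exact: cvgP M0.
near=> N; have lN : (l < N)%N by near: N; exact: nbhs_infty_gt.
have -> : coef (fun x => limn (series (fun n => phi n * hart (kap n) x))) l - phi l =
    ip mu (G - fsum e phi N) (e l).
  by rewrite ipBl// (ip_fsum_basis eL ip_char) lN.
apply: ip_norm_le => [| |t|t]; [exact: L2B|exact: eL| |exact: char_norm].
by have := (tail t).2 N; rewrite -fsumE.
Unshelve. all: by end_near. Qed.

Definition neg_index (n : nat) : nat := projT1 (cid (kap_surj (- kap n))).

Lemma kap_neg_index n : kap (neg_index n) = - kap n.
Proof. by rewrite /neg_index; case: cid. Qed.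

Lemma neg_indexK : involutive neg_index.
Proof. by move=> n; apply: kap_inj; rewrite !kap_neg_index opprK. Qed.

End TorusFourier.

(** * Differentiation of Fourier coefficients in a parameter *)

Section CoefDerivative.
Context {R : realType} {m : nat}.
Local Notation mu := (haar R m).
Local Notation tp := (@torus_point R m).

Lemma rperiodic_derive (w w' : 'rV[R]_m -> R) v : rperiodic w ->
  (forall x, is_derive x v w (w' x)) -> rperiodic w'.
Proof.
move=> pw dw i x.
have [_ <-] := dw (x + (2 * pi) *: delta_mx 0 i); have [_ <-] := dw x.
rewrite /derive; congr (lim (_ @ 0^')); apply/funext => s /=.
by rewrite addrA !pw.
Qed.

Lemma is_derive_ip_char (g dg : R * 'rV[R]_m -> R) (u v t : R) (p : 'rV[int]_m) :
  (forall s, u < s < v -> rperiodic (fun x => g (s, x))) ->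
  (forall s, u < s < v -> rperiodic (fun x => dg (s, x))) ->
  (forall s x, u < s < v -> {for (s, x), continuous g}) ->
  (forall s x, u < s < v -> {for (s, x), continuous dg}) ->
  (forall s x, u < s < v -> is_derive s 1 (fun s => g (s, x)) (dg (s, x))) ->
  u < t < v -> is_derive t 1 (fun s => ip mu (fun y => g (s, tp y)) (char p))
    (ip mu (fun y => dg (t, tp y)) (char p)).
Proof.
move=> pg pdg cg cdg Dg /andP[ut tv].
(* On a smaller closed interval of parameters [dg] is bounded, by compactness of the fundamental box
   and periodicity; the bound is the majorant for differentiating under the integral. *)
pose u' := (u + t) / 2; pose v' := (t + v) / 2.
have uv s : s \in `[u', v'] -> u < s < v.
  by rewrite in_itv /= /u' /v' => /andP[h1 h2]; apply/andP; split; lra.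
pose K : set (R * 'rV[R]_m) := `[u', v']%classic `*`
  [set x : 'rV[R]_m | forall j, `[0, 2 * pi]%classic (x ord0 j)].
have cK : compact K by apply: compact_setX; [exact: segment_compact|exact: compact_box].
have [|C HC] := @continuous_compact_bounded _ _ _ dg cK.
  by move=> [s x] [/= sI _]; apply: cdg; exact: uv.
have bound s x : s \in `[u', v'] -> `|dg (s, x)| <= C.
  move=> sI; have [y hy <-] := rperiodic_fundamental x (pdg _ (uv _ sI)).
  apply: HC; split => //= j; have /andP[y0 y1] := hy j.
  by rewrite in_itv /= y0 ltW.
pose F s y := g (s, tp y) * char p y.
have tI : `]u', v'[%classic t by rewrite /= in_itv /= /u' /v'; apply/andP; split; lra.
have oc s : `]u', v'[%classic s -> s \in `[u', v'] by exact: subset_itv_oo_cc.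
have dF s y : `]u', v'[%classic s -> is_derive s 1 (F ^~ y) (dg (s, tp y) * char p y).
  move=> /oc/uv sI; have D1 := Dg s (tp y) sI.
  have D2 : is_derive s 1 (F ^~ y) (g (s, tp y) * 0 + char p y * dg (s, tp y)) :=
    is_deriveM D1 (is_derive_cst (char p y) s 1).
  by apply: is_derive_eq D2 _; ring.
have intF s : `]u', v'[%classic s -> mu.-integrable setT (EFin \o F s).
  move=> /oc/uv sI; apply: (ip_integrable (f := (fun x => g (s, x)) \o tp)); last exact: L2_char.
  apply: L2_continuous; first exact: pg.
  by move=> x; apply: continuous_slice_snd; exact: cg.
have dE s y : `]u', v'[%classic s -> partial1of2 F s y = dg (s, tp y) * char p y.
  by move=> sI; rewrite partial1of2E; case: (dF s y sI).
have C0 : 0 <= C by apply: le_trans (bound t 0 (oc _ tI)).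
have intG : mu.-integrable setT (EFin \o cst (C * 2)).
  exact: finite_measure_integrable_cst.
have G0 (y : m.-tuple (measurableTypeR R)) : 0 <= cst (C * 2) y by rewrite mulr_ge0.
have Gub s y : `]u', v'[%classic s -> setT y -> `|partial1of2 F s y| <= cst (C * 2) y.
  move=> sI _; rewrite dE// normrM ler_pM ?char_norm//.
  by apply: bound; exact: oc.
have derF s y : `]u', v'[%classic s -> setT y -> derivable (F ^~ y) s 1.
  by move=> sI _; case: (dF s y sI).
apply: DeriveDef.
  exact: (derivable_under_integral measurableT tI intF derF G0 intG Gub).
have := differentiation_under_integral measurableT tI intF derF G0 intG Gub.
rewrite derive1E => ->; apply: eq_Rintegral => y _; exact: dE.
Qed.

End CoefDerivative.

(** * The heat equation on coefficients, and its initial value in L^2 *)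

Section HeatCoefficients.
Context {R : realType} {m : nat}.
Local Notation TR := (measurableTypeR R).
Local Notation mu := (haar R m).
Local Notation tp := (@torus_point R m).
Variable kap : nat -> 'rV[int]_m.
Hypothesis kap_inj : injective kap.
Hypothesis kap_surj : forall p, exists n, kap n = p.
Implicit Types (f w : 'rV[R]_m -> R) (a b : nat -> R).
Local Notation q := (sqn kap : nat -> R).
Local Notation tempered := (tempered kap).
Local Notation coef := (coef kap).
Local Notation heat_series := (heat_series kap).

Lemma Lnorm2E (h : m.-tuple TR -> R) : h \in Lfun mu 2%:E ->
  ('N[mu]_2%:E[EFin \o h] = (Num.sqrt (ip mu h h))%:E)%E.
Proof.
move=> hL; rewrite unlock /Lnorm /=.
under eq_integral do rewrite /= powR_mulrn// -normrX ger0_norm ?sqr_ge0// expr2.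
by rewrite -ip_EFin// poweR_EFin powR12_sqrt// ip_ge0.
Qed.

Lemma coef_sqr_le f n : (f \o tp) \in Lfun mu 2%:E ->
  coef f n ^+ 2 <= ip mu (f \o tp) (f \o tp).
Proof.
move=> fL; have := bessel (fun n => L2_char (kap n)) (ip_char kap_inj) n.+1 fL.
rewrite big_ord_recr /=; apply: le_trans; rewrite lerDr.
by apply: sumr_ge0 => i _; exact: sqr_ge0.
Qed.

Lemma coef_tempered f : (f \o tp) \in Lfun mu 2%:E -> tempered (coef f).
Proof.
move=> fL; apply: (tempered_bounded kap_inj (C := 1 + ip mu (f \o tp) (f \o tp))) => n.
by apply: le_trans (abs_le_sqr _) _; rewrite lerD2l coef_sqr_le.
Qed.

Lemma coef_heat_series a (t : R) n : tempered a -> 0 < t ->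
  coef (fun x => heat_series a (fun=> 0) (t, x)) n = expR (- (t * (q n / 2))) * a n.
Proof.
move=> ta t0; rewrite -(coef_series kap_inj n (weight_gauss t0 ta)); congr coef; apply/funext => x.
by congr (limn (series _)); apply/funext => k; rewrite mul0r addr0 mulrA.
Qed.

(* The Fourier coefficients of h t solve c' = - |k|^2 / 2 c. *)
Lemma heat_coef_unique f (h : R * 'rV[R]_m -> R) : (f \o tp) \in Lfun mu 2%:E ->
  (forall t, 0 < t -> rperiodic (fun x => h (t, x))) ->
  Ck [set z : R * 'rV[R]_m | 0 < z.1] 2 h ->
  (forall t x, 0 < t -> 'D_1 (fun s => h (s, x)) t =
     2^-1 * \sum_j 'D_(delta_mx 0 j) (fun y => 'D_(delta_mx 0 j) (fun y => h (t, y)) y) x) ->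
  (fun t => 'N[mu]_2%:E [EFin \o (((fun x => h (t, x)) - f) \o tp)%R])%E @ 0^'+ --> 0%E ->
  forall t n, 0 < t -> coef (fun x => h (t, x)) n = expR (- (t * (q n / 2))) * coef f n.
Proof.
move=> fL ph Ch heat_eq h_f.
pose U := [set z : R * 'rV[R]_m | 0 < z.1].
have [ch h1] := Ch.
pose e1 : R * 'rV[R]_m := (1, 0).
pose ej (j : 'I_m) : R * 'rV[R]_m := (0, delta_mx 0 j).
have ct t x : 0 < t -> {for (t, x), continuous h} by move=> t0; exact: (ch (t, x)).
have hcont t : 0 < t -> continuous (fun x => h (t, x)).
  by move=> t0 x; apply: continuous_slice_snd; exact: ct.
pose dth := 'D_e1 h.
have dtc t x : 0 < t -> {for (t, x), continuous dth}.
  by move=> t0; have [_ [+ _]] := h1 e1; apply.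
have dtD (t : R) x : 0 < t -> is_derive t 1 (fun s => h (s, x)) (dth (t, x)).
  move=> t0; apply: is_derive_slice_fst; apply: DeriveDef => //.
  by have [+ _] := h1 e1; apply.
pose djh j := 'D_(ej j) h.
have djD (t : R) x j : 0 < t -> is_derive x (delta_mx 0 j) (fun y => h (t, y)) (djh j (t, x)).
  move=> t0; apply: is_derive_slice_snd; apply: DeriveDef => //.
  by have [+ _] := h1 (ej j); apply.
pose djjh j := 'D_(ej j) (djh j).
have djc t j : 0 < t -> continuous (fun x => djh j (t, x)).
  move=> t0 x; apply: continuous_slice_snd.
  by have [_ [+ _]] := h1 (ej j); apply.
have djjc t j : 0 < t -> continuous (fun x => djjh j (t, x)).
  move=> t0 x; apply: continuous_slice_snd.
  by have [_ [_ /(_ (ej j))[_ [+ _]]]] := h1 (ej j); apply.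
have djjD t x j : 0 < t ->
    is_derive x (delta_mx 0 j) (fun y => djh j (t, y)) (djjh j (t, x)).
  move=> t0; apply: is_derive_slice_snd; apply: DeriveDef => //.
  by have [_ [_ /(_ (ej j))[+ _]]] := h1 (ej j); apply.
have pdj t j : 0 < t -> rperiodic (fun x => djh j (t, x)).
  by move=> t0; apply: (rperiodic_derive (ph _ t0)) => x; exact: djD.
have pdjj t j : 0 < t -> rperiodic (fun x => djjh j (t, x)).
  by move=> t0; apply: (rperiodic_derive (pdj _ j t0)) => x; exact: djjD.
have lapl t x : 0 < t -> dth (t, x) = 2^-1 * \sum_j djjh j (t, x).
  move=> t0; have [_ e] := dtD _ x t0; rewrite -e (heat_eq _ x t0).
  apply: (congr1 ( *%R 2^-1)).
  apply: eq_bigr => j _; have [_ e'] := djjD _ x j t0.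
  have E : 'D_(delta_mx 0 j) (fun y => h (t, y)) = (fun y => djh j (t, y)).
    by apply/funext => y; have [_ e2] := djD _ y j t0; exact: e2.
  by rewrite E; exact: e'.
have pdt t : 0 < t -> rperiodic (fun x => dth (t, x)).
  move=> t0 j x; rewrite (lapl _ (x + _) t0) (lapl _ x t0); apply: (congr1 ( *%R 2^-1)).
  by apply: eq_bigr => i _; exact: (pdjj _ i t0 j x).
(* Two integrations by parts go from the mode k to - k and back, leaving the factor - k_j^2. *)
have coef_djj t j n : 0 < t -> coef (fun x => djjh j (t, x)) n =
    - ((kap n 0 j)%:~R ^+ 2 * coef (fun x => h (t, x)) n).
  move=> t0; rewrite /coef.
  have djj' x := djjD t x j t0; have dj' x := djD t x j t0.
  rewrite (ip_derive_hart (kap n) (pdj _ j t0) (djc _ j t0) (pdjj _ j t0) (djjc _ j t0) djj').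
  rewrite (ip_derive_hart (- kap n) (ph _ t0) (hcont _ t0) (pdj _ j t0) (djc _ j t0) dj').
  by rewrite opprK mxE mulrNz; ring.
have coef_dt t n : 0 < t -> coef (fun x => dth (t, x)) n =
    - (q n / 2) * coef (fun x => h (t, x)) n.
  move=> t0.
  have -> : (fun x => dth (t, x)) = (fun x => \sum_j 2^-1 * djjh j (t, x)).
    by apply/funext => x; rewrite lapl// mulr_sumr.
  rewrite (@coef_sum _ _ kap _ (fun=> 2^-1) (fun j x => djjh j (t, x))); last first.
    by move=> j; apply: L2_continuous; [exact: pdjj|exact: djjc].
  rewrite -mulr_sumr.
  under eq_bigr do rewrite coef_djj//.
  rewrite sumrN -mulr_suml /sqn; set S := \sum_i _; set c := coef _ n.
  by rewrite mulrN mulNr; congr (- _); rewrite mulrA [2^-1 * S]mulrC.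
have coef_D (t : R) n : 0 < t ->
    is_derive t 1 (fun s => coef (fun x => h (s, x)) n) (- (q n / 2) * coef (fun x => h (t, x)) n).
  move=> t0; rewrite -coef_dt//.
  have lt0 s : t / 2 < s < 2 * t -> 0 < s by move=> /andP[+ _]; apply: lt_trans; rewrite divr_gt0.
  apply: (@is_derive_ip_char R m h dth (t / 2) (2 * t) t (kap n)) => //.
  - by move=> s /lt0; exact: ph.
  - by move=> s /lt0; exact: pdt.
  - by move=> s x /lt0; exact: ct.
  - by move=> s x /lt0; exact: dtc.
  - by move=> s x /lt0; exact: dtD.
  - by apply/andP; split; lra.
move=> t n t0.
(* The integrating factor makes [z] constant on s > 0. Its value is the limit at 0+, for which L^2
   convergence suffices because a coefficient is bounded by the norm. *)
pose z (s : R) := expR (s * (q n / 2)) * coef (fun x => h (s, x)) n.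
have zD (s : R) : 0 < s -> is_derive s 1 z 0.
  move=> s0; have d0 : is_derive s 1 (fun s : R => s * (q n / 2)) (q n / 2).
    by apply: is_derive_affine => r; rewrite [r *: 1]mulr1 mulrDl.
  have d1 := is_derive_comp1 d0 (is_derive_expR _).
  have d2 : is_derive s 1 z (expR (s * (q n / 2)) * (- (q n / 2) * coef (fun x => h (s, x)) n) +
     coef (fun x => h (s, x)) n * (expR (s * (q n / 2)) * (q n / 2))) :=
    is_deriveM d1 (coef_D _ n s0).
  by apply: is_derive_eq d2 _; ring.
have z_cst s s' : 0 < s -> s <= s' -> z s = z s'.
  move=> s0 ss'; apply/eqP; rewrite -subr_eq0 -normr_le0.
  have -> : z s = z ((s - s') *: 1 + s') by rewrite [_ *: 1]mulr1 subrK.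
  rewrite -[leRHS](mul0r `|s - s'|); apply: mean_value_line => r.
  rewrite ler_norml ler0_norm ?subr_le0// => /andP[r1 _].
  have r0 : 0 < r *: 1 + s' by rewrite [_ *: 1]mulr1; lra.
  have [d e] := zD _ r0.
  by split=> //; rewrite e normr0.
have z_lim : z s @[s --> 0^'+] --> coef f n.
  rewrite -[X in _ --> X]mul1r; apply: cvgM.
    have : expR (s * (q n / 2)) @[s --> 0^'+] --> expR (0 * (q n / 2)).
      apply: cvg_at_right_filter; apply: (@continuous_comp _ _ _ (fun s : R => s * (q n / 2)) expR); last exact: continuous_expR.
      by apply: cvgM; [exact: cvg_id|exact: cvg_cst].
    by rewrite mul0r expR0.
  pose N s := fine ('N[mu]_2%:E [EFin \o (((fun x => h (s, x)) - f) \o tp)%R])%E.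
  have N0 : N s @[s --> 0^'+] --> 0 by exact: fine_cvg h_f.
  have c0 : (fun=> 0 : R) @ (0 : R)^'+ --> (0 : R) by exact: cvg_cst.
  suff nz : `|coef (fun x => h (s, x)) n - coef f n| @[s --> 0^'+] --> 0.
    by apply: cvg_zero; apply: norm_cvg0; exact: nz.
  apply: squeeze_cvgr c0 N0; near=> s.
  have s0 : 0 < s by near: s; exact: nbhs_right_gt.
  have hL : (fun x => h (s, x)) \o tp \in Lfun mu 2%:E.
    by apply: L2_continuous; [exact: ph|exact: hcont].
  have hfL : ((fun x => h (s, x)) - f) \o tp \in Lfun mu 2%:E by exact: L2B hL fL.
  rewrite normr_ge0 /= /N Lnorm2E//= -sqrtr_sqr ler_wsqrtr// !fctE.
  by rewrite -coefB//; exact: coef_sqr_le.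
have zt : z t = coef f n.
  rewrite -(cvg_lim _ z_lim)//; apply/esym/cvg_lim => //.
  apply: cvg_near_cst; near=> s; apply: z_cst.
    by near: s; exact: nbhs_right_gt.
  by apply: ltW; near: s; exact: nbhs_right_lt.
by rewrite -zt /z mulrA -expRD addNr expR0 mul1r.
Unshelve. all: by end_near. Qed.

(** By Parseval the squared distance is the sum of (exp (- t |k|^2 / 2) - 1)^2 c_k^2, dominated by
    that of c_k^2, so Tannery's theorem applies as t tends to 0+. *)
Lemma heat_series_L2_cvg f : (f \o tp) \in Lfun mu 2%:E ->
  (fun t => 'N[mu]_2%:E [EFin \o (((fun x => heat_series (coef f) (fun=> 0) (t, x)) - f) \o tp)%R])%E
     @ 0^'+ --> 0%E.
Proof.
move=> fL; have ta := coef_tempered fL.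
pose g t x := heat_series (coef f) (fun=> 0) (t, x).
have gL t : 0 < t -> g t \o tp \in Lfun mu 2%:E.
  move=> t0; apply: L2_continuous; first by move=> j x; exact: (@pair_series_periodic R m kap _ _ _ j x).
  exact: (continuous_pair_series (weight_gauss t0) ta (tempered0 kap_inj)).
pose S t := limn (series (fun n => (expR (- (t * (q n / 2))) - 1) ^+ 2 * coef f n ^+ 2)).
have nE t : 0 < t -> ('N[mu]_2%:E [EFin \o ((g t - f) \o tp)%R] = (Num.sqrt (S t))%:E)%E.
  move=> t0; rewrite (@Lnorm2E ((g t - f) \o tp)); last exact: L2B (gL _ t0) fL.
  congr (Num.sqrt _)%:E.
  have gfL : (g t - f) \o tp \in Lfun mu 2%:E by exact: L2B (gL _ t0) fL.
  rewrite -(cvg_lim _ (coef_parseval kap_inj kap_surj gfL))//.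
  congr (limn (series _)); apply/funext => n.
  by rewrite coefB ?gL// coef_heat_series// -[X in _ - X]mul1r -mulrBl exprMn.
have SL : S t @[t --> 0^'+] --> 0.
  have z0 : limn (series (fun=> 0 : R)) = 0.
    apply/cvg_lim => //; apply: cvg_near_cst; apply: nearW => n.
    by rewrite /series /= big1.
  rewrite -[X in _ --> X]z0.
  apply: (cvg_lim_series (M := fun n => coef f n ^+ 2)).
  - exact: cvgP (coef_parseval kap_inj kap_surj fL).
  - near=> t => n; have t0 : 0 < t by near: t; exact: nbhs_right_gt.
    rewrite (ger0_norm (mulr_ge0 (sqr_ge0 _) (sqr_ge0 _))) ler_piMl ?sqr_ge0//.
    have e1 : expR (- (t * (q n / 2))) <= 1.
      by rewrite -expR0 ler_expR oppr_le0 !mulr_ge0 ?(ltW t0)// sqn_ge0.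
    have e0 := expR_gt0 (- (t * (q n / 2))).
    rewrite -sqrrN opprB exprn_ile1//; lra.
  - move=> n.
    have cE : expR (- (t * (q n / 2))) - 1 @[t --> (0 : R)] --> expR (- (0 * (q n / 2))) - 1.
      apply: cvgB; last exact: cvg_cst.
      apply: (@continuous_comp _ _ _ (fun t : R => - (t * (q n / 2))) expR); last exact: continuous_expR.
      by apply: cvgN; apply: cvgM; [exact: cvg_id|exact: cvg_cst].
    have cE' : (expR (- (t * (q n / 2))) - 1) * (expR (- (t * (q n / 2))) - 1) * coef f n ^+ 2 @[t --> (0 : R)] -->
        (expR (- (0 * (q n / 2))) - 1) * (expR (- (0 * (q n / 2))) - 1) * coef f n ^+ 2.
      by apply: cvgM; [exact: cvgM|exact: cvg_cst].
    rewrite mul0r oppr0 expR0 subrr !mul0r in cE'.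
    exact: cvg_at_right_filter cE'.
have cL : (Num.sqrt (S t))%:E @[t --> 0^'+] --> 0%E.
  apply: cvg_EFin; first exact: nearW.
  rewrite -[X in _ --> X]sqrtr0; exact: cvg_comp SL (@sqrt_continuous R 0).
apply: cvg_trans cL; apply: near_eq_cvg; near=> t.
by rewrite nE//; near: t; exact: nbhs_right_gt.
Unshelve. all: by end_near. Qed.

End HeatCoefficients.

(** * Clifford multiplication in real coordinates *)

Section CliffordCoordinates.
Context {R : realType} {m : nat}.
Local Notation Cl := (clifford R m).
Implicit Types (u v : Cl) (A B : {set 'I_m}) (b : bool) (p : 'rV[int]_m) (x : R).

Lemma cl_coordP u v : (forall A b, cl_coord A b u = cl_coord A b v) -> u = v.
Proof.
move=> uv; apply/ffunP => A; have := uv A false; have := uv A true.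
by rewrite /cl_coord; case: (u A) => ? ?; case: (v A) => ? ? /= -> ->.
Qed.

Lemma cl_coordD A b u v : cl_coord A b (u + v) = cl_coord A b u + cl_coord A b v.
Proof. by rewrite /cl_coord ffunE; case: b; case: (u A); case: (v A). Qed.

Lemma cl_coordN A b u : cl_coord A b (- u) = - cl_coord A b u.
Proof. by rewrite /cl_coord ffunE; case: b; case: (u A). Qed.

Lemma cl_coordB A b u v : cl_coord A b (u - v) = cl_coord A b u - cl_coord A b v.
Proof. by rewrite cl_coordD cl_coordN. Qed.

Lemma cl_coord0 A b : cl_coord A b (0 : Cl) = 0.
Proof. by rewrite /cl_coord ffunE; case: b. Qed.

Lemma cl_coordZ A b x u : cl_coord A b (x%:C%C *: u) = x * cl_coord A b u.
Proof. by rewrite /cl_coord ffunE; case: (u A) => ? ?; case: b => /=; ring. Qed.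

Lemma cl_coord_sum (I : Type) (r : seq I) (P : pred I) (w : I -> Cl) A b :
  cl_coord A b (\sum_(i <- r | P i) w i) = \sum_(i <- r | P i) cl_coord A b (w i).
Proof.
by apply: (big_morph (cl_coord A b)); [exact: cl_coordD|exact: cl_coord0].
Qed.

Lemma cl_coord_lift (T : Type) (phi : (T -> R) -> R) (f : T -> Cl) A b :
  cl_coord A b (cl_lift phi f) = phi (cl_coord A b \o f).
Proof. by rewrite /cl_coord /cl_lift ffunE; case: b. Qed.

(** The product of [cl_gen j] and [cl_basis B] is a multiple of [cl_basis A] exactly for
    [B = gen_flip j A], and then the factor is [gen_sign j A]. *)
Definition gen_flip (j : 'I_m) A : {set 'I_m} := symdiff [set j] A.

Definition gen_sign (j : 'I_m) A : R := (-1) ^+ cl_inv [set j] (gen_flip j A).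

Lemma gen_flipK j : involutive (gen_flip j).
Proof.
move=> A; apply/setP => i; rewrite /gen_flip /symdiff !inE.
by case: (i == j); case: (i \in A).
Qed.

Lemma cl_coord_gen A b j u :
  cl_coord A b (cl_gen j * u) = gen_sign j A * cl_coord (gen_flip j A) b u.
Proof.
have -> : (cl_gen j * u) = cl_mul (cl_gen j) u by [].
rewrite /cl_coord !ffunE (bigD1 (finset.set1 j))//= [X in _ + X]big1 ?addr0; last first.
  by move=> B Bj; rewrite big1// => C _; rewrite ffunE (negbTE Bj) mulr0 mul0r.
rewrite (big_pred1 (gen_flip j A)); last first.
  by move=> B; apply/eqP/eqP => [<-|->]; rewrite -/(gen_flip j _) gen_flipK.
rewrite ffunE eqxx mulr1 /gen_sign; set k := cl_inv _ _.
rewrite -(signr_odd _ k) -(signr_odd R k).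
by case: (u _) => ? ?; case: (odd _); case: b; rewrite /= ?expr0 ?expr1; ring.
Qed.

Lemma cl_gen_sqr j u : cl_gen j * (cl_gen j * u) = - u.
Proof.
rewrite mulrA; have := cl_gen_mul R j j; rewrite eqxx => e.
have -> : cl_gen j * cl_gen j = -1 :> Cl.
  apply: (@scalerI _ _ (2 : R[i])); first by rewrite pnatr_eq0.
  by rewrite scaler_nat mulr2n e mulr2n scalerDl scaleN1r scaler_nat mulr2n.
by rewrite mulN1r.
Qed.

(** Read off from the square -1 of [cl_gen j] acting on a basis element; it makes left
    multiplication by a generator skew-symmetric. *)
Lemma gen_sign_flip j A : gen_sign j (gen_flip j A) = - gen_sign j A.
Proof.
have := congr1 (cl_coord A false) (cl_gen_sqr j (cl_basis A)).
rewrite !cl_coord_gen gen_flipK cl_coordN /cl_coord ffunE eqxx /= mulr1 => e.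
have s2 : gen_sign j A * gen_sign j A = 1 by rewrite -expr2 sqrr_sign.
by rewrite -[LHS]mul1r -s2 -mulrA e mulrN1.
Qed.

Definition cl_vec p : Cl := \sum_j ((p 0 j)%:~R : R)%:C%C *: cl_gen j.

Lemma cl_vec_mul p u : cl_vec p * u = \sum_j ((p 0 j)%:~R : R)%:C%C *: (cl_gen j * u).
Proof. by rewrite mulr_suml; apply: eq_bigr => j _; rewrite scalerAl. Qed.

Lemma cl_coord_vec A b p u : cl_coord A b (cl_vec p * u) =
  \sum_j (p 0 j)%:~R * (gen_sign j A * cl_coord (gen_flip j A) b u).
Proof.
rewrite cl_vec_mul cl_coord_sum; apply: eq_bigr => j _.
by rewrite cl_coordZ cl_coord_gen.
Qed.

Lemma cl_vecN p : cl_vec (- p) = - cl_vec p.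
Proof.
rewrite /cl_vec -sumrN; apply: eq_bigr => j _.
by rewrite mxE mulrNz rmorphN scaleNr.
Qed.

(** Twice the square is a sum of anticommutators of generators, of which only the diagonal ones
    survive. *)
Lemma cl_vec_sqr p u :
  cl_vec p * (cl_vec p * u) = - ((\sum_j (p 0 j)%:~R ^+ 2 : R)%:C%C *: u).
Proof.
rewrite mulrA -scaleNr; pose c j : R[i] := ((p 0 j)%:~R : R)%:C%C.
have sqrE : cl_vec p * cl_vec p = \sum_i \sum_j (c i * c j) *: (cl_gen i * cl_gen j).
  rewrite mulr_suml; apply: eq_bigr => i _; rewrite mulr_sumr; apply: eq_bigr => j _.
  by rewrite -scalerAl -scalerAr scalerA.
suff -> : cl_vec p * cl_vec p = (- (\sum_j (p 0 j)%:~R ^+ 2 : R)%:C%C)%:A.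
  by rewrite -scalerAl mul1r.
apply: (@scalerI _ _ (2 : R[i])); first by rewrite pnatr_eq0.
rewrite scaler_nat mulr2n {2}sqrE exchange_big sqrE /= -big_split /=.
transitivity (\sum_i (- 2 * c i ^+ 2)%:A : Cl).
  apply: eq_bigr => i _; rewrite -big_split /= (bigD1 i)//= [X in _ + X]big1 ?addr0.
    rewrite -scalerDr cl_gen_mul eqxx scalerA; congr (_ *: _).
    by rewrite mulNrn mulrN mulr_natr expr2 mulNr mulr_natl.
  move=> j ji; rewrite [c j * c i]mulrC -scalerDr cl_gen_mul eq_sym (negbTE ji).
  by rewrite oppr0 mul0rn scale0r scaler0.
rewrite -scaler_suml scalerA -mulr_sumr; congr (_ *: _).
rewrite mulrN mulNr; congr (- (_ * _)); rewrite rmorph_sum; apply: eq_bigr => i _.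
by rewrite rmorphXn.
Qed.

Definition cl_rdot u v : R := \sum_A \sum_b cl_coord A b u * cl_coord A b v.

Lemma cl_rdotZl x u v : cl_rdot (x%:C%C *: u) v = x * cl_rdot u v.
Proof.
rewrite /cl_rdot mulr_sumr; apply: eq_bigr => A _; rewrite mulr_sumr.
by apply: eq_bigr => b _; rewrite cl_coordZ mulrA.
Qed.

Lemma cl_rdotC u v : cl_rdot u v = cl_rdot v u.
Proof. by apply: eq_bigr => A _; apply: eq_bigr => b _; rewrite mulrC. Qed.

Lemma cl_rdot_suml (I : finType) (w : I -> Cl) v :
  cl_rdot (\sum_i w i) v = \sum_i cl_rdot (w i) v.
Proof.
rewrite /cl_rdot [RHS]exchange_big; apply: eq_bigr => A _; rewrite [RHS]exchange_big.
by apply: eq_bigr => b _; rewrite cl_coord_sum mulr_suml.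
Qed.

Lemma cl_rdot_gen j u v : cl_rdot (cl_gen j * u) v = - cl_rdot u (cl_gen j * v).
Proof.
rewrite /cl_rdot (reindex_inj (inv_inj (gen_flipK j))) -sumrN; apply: eq_bigr => A _.
rewrite -sumrN; apply: eq_bigr => b _.
by rewrite !cl_coord_gen gen_flipK gen_sign_flip; ring.
Qed.

(** Multiplication by a vector is skew for [cl_rdot] and its square is - |p|^2. *)
Lemma cl_rdot_vec p u :
  cl_rdot (cl_vec p * u) (cl_vec p * u) = (\sum_j (p 0 j)%:~R ^+ 2) * cl_rdot u u.
Proof.
have skew v : cl_rdot (cl_vec p * u) v = - cl_rdot u (cl_vec p * v).
  rewrite [cl_rdot u _]cl_rdotC !cl_vec_mul !cl_rdot_suml -sumrN; apply: eq_bigr => j _.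
  by rewrite !cl_rdotZl cl_rdot_gen mulrN [cl_rdot (cl_gen j * v) _]cl_rdotC.
by rewrite skew cl_vec_sqr cl_rdotC -scaleNr -rmorphN cl_rdotZl mulNr opprK.
Qed.

(** The imaginary part is the real product with [i v], so that the Hermitian isometry will follow
    from the one for real products. *)
Lemma cl_dotE u v : cl_dot u v = Complex (cl_rdot u v) (cl_rdot u ('i%C *: v)).
Proof.
rewrite /cl_dot /cl_rdot.
transitivity (\sum_A Complex (\sum_b cl_coord A b u * cl_coord A b v)
    (\sum_b cl_coord A b u * cl_coord A b ('i%C *: v))).
  apply: eq_bigr => A _; rewrite !big_bool /cl_coord ffunE.
  by case: (u A) => a a'; case: (v A) => b b'; apply/eqP; rewrite eq_complex /=;
     apply/andP; split; apply/eqP; ring.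
by apply: (big_ind3 (fun (z : R[i]) x y => z = Complex x y)) => // _ x1 x2 _ y1 y2 -> ->.
Qed.

End CliffordCoordinates.

(** * Series with the weights exp (s x0 |k|) of the Dirac flow *)

Section WaveSeries.
Context {R : realType} {m : nat}.
Variable kap : nat -> 'rV[int]_m.
Implicit Types (a b : nat -> R) (z v : R * 'rV[R]_m) (s : R).
Local Notation q := (sqn kap : nat -> R).
Local Notation tempered := (tempered kap).

Definition knorm n : R := Num.sqrt (q n).

Lemma knorm_sqr n : knorm n ^+ 2 = q n.
Proof. by rewrite sqr_sqrtr ?sqn_ge0. Qed.

(** The time-1 heat factor times exp (s x0 |k|); the values s = 1 and s = -1 are the two
    exponentials in cosh and sinh. *)
Definition wave_weight s (x0 : R) n : R := expR (- (q n / 2)) * expR (s * (x0 * knorm n)).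

Definition wave_rate s n : R := s * knorm n.

Lemma tempered_wave_rate s (c : R) a : tempered a -> tempered (fun n => c * wave_rate s n * a n).
Proof.
move=> ta; apply: (tempered_le (C := `|c * s|) ta) => n.
rewrite /wave_rate mulrA !normrM -!mulrA ler_wpM2l// ler_wpM2l//.
by rewrite ler_wpM2r// -knorm_sqr abs_le_sqr.
Qed.

Definition wave_dom (M : R) n : R := expR (M ^+ 2) * expR (- (2^-1 * (q n / 2))).

Lemma weight_wave_dom (M : R) : weight kap (wave_dom M).
Proof. by apply: weightZ; apply: weight_gauss; rewrite invr_gt0. Qed.

(* [|s x0| r <= x0^2 + r^2 / 4] *)
Lemma wave_dom_le s (x0 M : R) n : `|s| <= 1 -> `|x0| <= M ->
  expR (- (q n / 2)) * expR `|s * (x0 * knorm n)| <= `|wave_dom M n|.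
Proof.
move=> s1 xM; rewrite [`|wave_dom _ _|]ger0_norm ?mulr_ge0 ?expR_ge0// /wave_dom -!expRD ler_expR.
have r0 : 0 <= knorm n by exact: sqrtr_ge0.
have M0 : 0 <= M by exact: le_trans xM.
have le1 : `|s * (x0 * knorm n)| <= M * knorm n.
  rewrite !normrM (ger0_norm r0) mulrA ler_wpM2r//.
  by rewrite -[M]mul1r ler_pM.
have := sqr_ge0 (M - knorm n / 2); rewrite -knorm_sqr; move: (knorm n) le1 => r le1.
rewrite sqrrB expr2 => h; nra.
Qed.

Lemma wave_weight_le s (x0 M : R) n : `|s| <= 1 -> `|x0| <= M ->
  `|wave_weight s x0 n| <= `|wave_dom M n|.
Proof.
move=> s1 xM; apply: le_trans (wave_dom_le n s1 xM).
rewrite /wave_weight normrM ![`|expR _|]ger0_norm ?expR_ge0//.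
by rewrite ler_wpM2l ?expR_ge0// ler_expR ler_norm.
Qed.

Lemma wave_weightP s (x0 : R) : `|s| <= 1 -> weight kap (wave_weight s x0).
Proof.
move=> s1 a ta; apply: (series_le_cvg _ _ _ (weight_wave_dom (M := `|x0|) ta)) => // n.
by rewrite !normrM ler_wpM2r// -!normrM wave_weight_le.
Qed.

Definition wave_series s a b z : R := pair_series kap (wave_weight s z.1) a b z.2.

Lemma is_derive_wave_weight s (t : R) n :
  is_derive t 1 (wave_weight s ^~ n) (wave_rate s n * wave_weight s t n).
Proof.
have d0 : is_derive t 1 (fun t : R => s * (t * knorm n)) (wave_rate s n).
  by apply: is_derive_affine => h; rewrite /wave_rate [h *: 1]mulr1; ring.
apply: is_derive_eq (is_deriveZ _ (is_derive_comp1 d0 (is_derive_expR _))) _.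
by rewrite /GRing.scale /wave_weight /=; ring.
Qed.

Lemma near_wave_weight s (t : R) : `|s| <= 1 ->
  exists2 w, weight kap w & \forall u \near t, forall n, `|wave_weight s u n| <= `|w n|.
Proof.
move=> s1; exists (wave_dom (`|t| + 1)); first exact: weight_wave_dom.
have near_t : \forall u \near t, `|u| <= `|t| + 1.
  have : (fun u : R => u) @ t --> t by exact: cvg_id.
  by move=> /cvg_norm/cvgr_le; apply; lra.
by apply: filterS near_t => u ut n; exact: wave_weight_le.
Qed.

Lemma is_derive_wave_series s a b z v : `|s| <= 1 -> tempered a -> tempered b ->
  is_derive z v (wave_series s a b)
    (wave_series s (dflow1 kap (wave_rate s) v a b) (dflow2 kap (wave_rate s) v a b) z).
Proof.
move=> s1 ta tb; exact: (@is_derive_flow_series _ _ kap (wave_weight s) (wave_rate s) setT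
  (is_derive_wave_weight s) (fun t _ => near_wave_weight t s1) (@tempered_wave_rate s) _ _ _ _ ta tb I).
Qed.

Lemma Ck_wave_series k s a b : `|s| <= 1 -> tempered a -> tempered b ->
  Ck setT k (wave_series s a b).
Proof.
move=> s1 ta tb; exact: (@Ck_flow_series _ _ kap (wave_weight s) (wave_rate s) setT openT
  (is_derive_wave_weight s) (fun t _ => near_wave_weight t s1) (@tempered_wave_rate s) k a b ta tb).
Qed.

End WaveSeries.

(** * Clifford-valued pair series and the action of D *)

Section CliffordSeries.
Context {R : realType} {m : nat}.
Local Notation Cl := (clifford R m).
Variable kap : nat -> 'rV[int]_m.
Hypothesis kap_inj : injective kap.
Implicit Types (w : nat -> R) (a b : nat -> Cl) (x : 'rV[R]_m) (f g : 'rV[R]_m -> Cl).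
Implicit Types (A B : {set 'I_m}) (c : bool).
Local Notation q := (sqn kap : nat -> R).
Local Notation tempered := (tempered kap).
Local Notation weight := (weight kap).
Local Notation knorm := (knorm kap : nat -> R).

Definition cl_tempered a := forall A c, tempered (cl_coord A c \o a).

(** [cl_lift] takes a single function as argument, so the two coefficient families are packed into
    one on [nat * bool]. *)
Definition cl_pair w a b x : Cl :=
  cl_lift (fun s => pair_series kap w (fun n => s (n, false)) (fun n => s (n, true)) x)
    (fun i => if i.2 then b i.1 else a i.1).

Lemma cl_coord_pair A c w a b x : cl_coord A c (cl_pair w a b x) =
  pair_series kap w (fun n => cl_coord A c (a n)) (fun n => cl_coord A c (b n)) x.
Proof. exact: cl_coord_lift. Qed.

Lemma cl_coord_pair_fun A c w a b : cl_coord A c \o cl_pair w a b =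
  pair_series kap w (fun n => cl_coord A c (a n)) (fun n => cl_coord A c (b n)).
Proof. by apply/funext => x; exact: cl_coord_pair. Qed.

Lemma eq_cl_pair w a b a' b' x : a =1 a' -> b =1 b' -> cl_pair w a b x = cl_pair w a' b' x.
Proof. by move=> /funext -> /funext ->. Qed.

Lemma dirac_coord A c f x : cl_coord A c (dirac_op f x) =
  \sum_j gen_sign j A * 'D_(delta_mx 0 j) (cl_coord (gen_flip j A) c \o f) x.
Proof.
rewrite /dirac_op cl_coord_sum; apply: eq_bigr => j _.
by rewrite cl_coord_gen /partial /cl_derive cl_coord_lift.
Qed.

Lemma dirac_pair w a b x : weight w -> cl_tempered a -> cl_tempered b ->
  dirac_op (cl_pair w a b) x =
  cl_pair w (fun n => - (cl_vec (kap n) * b n)) (fun n => cl_vec (kap n) * a n) x.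
Proof.
move=> ww ta tb; apply: cl_coordP => A c; rewrite dirac_coord.
rewrite cl_coord_pair.
pose d (j : 'I_m) n : R := dotp (kap n) (delta_mx 0 j).
transitivity (\sum_j gen_sign j A * pair_series kap w
    (fun n => - (d j n * cl_coord (gen_flip j A) c (b n)))
    (fun n => d j n * cl_coord (gen_flip j A) c (a n)) x).
  apply: eq_bigr => j _; congr (_ * _); rewrite cl_coord_pair_fun.
  have [_ e] := is_derive_pair_series kap_inj x (delta_mx 0 j) ww (ta (gen_flip j A) c) (tb (gen_flip j A) c).
  exact: e.
rewrite -pair_series_sum//; last 2 first.
- by move=> j; apply: temperedN; apply: tempered_dotp => //; exact: tb.
- by move=> j; apply: tempered_dotp => //; exact: ta.
apply: eq_pair_series => n /=; last first.
  rewrite cl_coord_vec; apply: eq_bigr => j _; rewrite /d dotp_delta; ring.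
rewrite cl_coordN cl_coord_vec -sumrN; apply: eq_bigr => j _; rewrite /d dotp_delta; ring.
Qed.

(* [cl_vec p u] divided by [|p|]; as [cl_vec 0 = 0], the junk value of [0^-1]
   is harmless. *)
Definition cl_unit n (u : Cl) : Cl := ((knorm n)^-1)%:C%C *: (cl_vec (kap n) * u).

Lemma cl_vec0 n : q n = 0 -> cl_vec (kap n) = 0 :> Cl.
Proof.
move=> /eqP; rewrite psumr_eq0 => [/allP k0|j _]; last exact: sqr_ge0.
rewrite /cl_vec big1// => j _; have := k0 j (mem_index_enum j).
by rewrite sqrf_eq0 => /eqP ->; rewrite rmorph0 scale0r.
Qed.

Lemma cl_vecE n u : cl_vec (kap n) * u = (knorm n)%:C%C *: cl_unit n u.
Proof.
rewrite /cl_unit scalerA -rmorphM; have [r0|r0] := eqVneq (knorm n) 0.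
  by rewrite cl_vec0 ?mul0r ?scaler0// -knorm_sqr r0 expr0n.
by rewrite mulfV// rmorph1 scale1r.
Qed.

Lemma cl_vec_unit n u : cl_vec (kap n) * cl_unit n u = - ((knorm n)%:C%C *: u).
Proof.
rewrite /cl_unit -scalerAr cl_vec_sqr -/(sqn kap n) -(knorm_sqr kap n) scalerN scalerA -rmorphM.
have [->|r0] := eqVneq (knorm n) 0; first by rewrite expr0n mulr0.
by rewrite expr2 mulKf.
Qed.

Lemma cl_tempered_unit a : cl_tempered a -> cl_tempered (fun n => cl_unit n (a n)).
Proof.
move=> ta A c; rewrite (_ : _ \o _ = (fun n => \sum_j gen_sign j A *
    ((kap n 0 j)%:~R / knorm n * cl_coord (gen_flip j A) c (a n)))); last first.
  apply/funext => n; rewrite /= /cl_unit cl_coordZ cl_coord_vec mulr_sumr.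
  by apply: eq_bigr => j _; ring.
apply: tempered_sum => //.
move=> j; apply: (tempered_le (C := 1) (ta (gen_flip j A) c)) => n.
rewrite normrM mul1r ler_wpM2r//; apply: (@le_trans _ _ 1); last by rewrite lerDl sqn_ge0.
have [->|r0] := eqVneq (knorm n) 0; first by rewrite invr0 mulr0 normr0.
have rp : 0 < knorm n by rewrite lt_def r0 sqrtr_ge0.
rewrite normrM normfV (gtr0_norm rp) ler_pdivrMr// mul1r.
rewrite -sqrtr_sqr ler_wsqrtr// /sqn (bigD1 j)//= lerDl.
by apply: sumr_ge0 => i _; exact: sqr_ge0.
Qed.

Lemma cl_tempered_knorm (s : R) j a : cl_tempered a ->
  cl_tempered (fun n => (s * knorm n ^+ j)%:C%C *: a n).
Proof.
move=> ta A c; rewrite (_ : _ \o _ = (fun n => s * (knorm n ^+ j * cl_coord A c (a n)))).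
  apply: temperedZ; elim: j => [|j IHj].
    by rewrite (_ : (fun _ => _) = cl_coord A c \o a)//; apply/funext => n; rewrite expr0 mul1r.
  rewrite (_ : (fun _ => _) = (fun n => 1 * wave_rate kap 1 n * (knorm n ^+ j * cl_coord A c (a n)))).
    exact: tempered_wave_rate.
  by apply/funext => n; rewrite /wave_rate exprS !mul1r mulrA.
by apply/funext => n; rewrite /= cl_coordZ mulrA.
Qed.

Lemma cl_temperedZ (s : R) a : cl_tempered a -> cl_tempered (fun n => s%:C%C *: a n).
Proof. move=> ta; have := cl_tempered_knorm (s := s) (j := 0) ta.
by under [X in cl_tempered X -> _]eq_fun do rewrite mulr1. Qed.

(** D sends the pair (a, b) to (- k b, k a), so its square multiplies by |k|^2: even powers stay on
    the first kernel, and odd ones land on the second through the unit vector. *)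
Lemma iter_dirac_pair w a j : weight w -> cl_tempered a ->
  iter j (@dirac_op R m) (cl_pair w a (fun=> 0)) =
  cl_pair w (fun n => ((~~ odd j)%:R * knorm n ^+ j)%:C%C *: a n)
            (fun n => ((odd j)%:R * knorm n ^+ j)%:C%C *: cl_unit n (a n)).
Proof.
move=> ww ta; have tu := cl_tempered_unit ta.
elim: j => [|j IHj].
  apply/funext => x; apply: eq_cl_pair => n; first by rewrite mul1r scale1r.
  by rewrite mul0r scale0r.
rewrite iterS IHj; apply/funext => x.
rewrite dirac_pair//; last 2 first; [exact: cl_tempered_knorm|exact: cl_tempered_knorm|].
apply: eq_cl_pair => n; rewrite -scalerAr.
  rewrite cl_vec_unit scalerN opprK scalerA -rmorphM /= negbK exprS.
  by rewrite -mulrA [_ ^+ j * _]mulrC.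
rewrite cl_vecE scalerA -rmorphM /= exprS.
by rewrite -mulrA [_ ^+ j * _]mulrC.
Qed.

End CliffordSeries.

(** * Even and odd parts of the truncated exponential *)

Section ExponentialParity.
Context {R : realType}.
Implicit Types (x r : R).

(** The even terms of the series of exp (- x r) form a truncated cosh (x r); the odd ones below form
    minus a truncated sinh (x r). *)
Lemma even_exp_psum x r n :
  \sum_(0 <= j < n) (-1) ^+ j * (x ^+ j / j`!%:R) * ((~~ odd j)%:R * r ^+ j) =
  (exp_psum (x * r) n + exp_psum (- (x * r)) n) / 2.
Proof.
rewrite /exp_psum /series /= -big_split mulr_suml; apply: eq_bigr => j _ /=.
rewrite /exp_coeff /= [(- (x * r)) ^+ j]exprNn !exprMn -signr_odd; case: (odd j) => /=.
  by rewrite expr1 mul0r mulr0 mulN1r mulNr subrr mul0r.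
by rewrite expr0; field; rewrite pnatr_eq0 -lt0n fact_gt0.
Qed.

Lemma odd_exp_psum x r n :
  \sum_(0 <= j < n) (-1) ^+ j * (x ^+ j / j`!%:R) * ((odd j)%:R * r ^+ j) =
  - ((exp_psum (x * r) n - exp_psum (- (x * r)) n) / 2).
Proof.
rewrite /exp_psum /series /= -sumrB mulr_suml -sumrN; apply: eq_bigr => j _ /=.
rewrite /exp_coeff /= [(- (x * r)) ^+ j]exprNn !exprMn -signr_odd; case: (odd j) => /=; last first.
  by rewrite expr0 mul0r mulr0 mul1r subrr mul0r oppr0.
by rewrite expr1; field; rewrite pnatr_eq0 -lt0n fact_gt0.
Qed.

End ExponentialParity.

(** * Summation of the exponential series of D *)

Section DiracExponential.
Context {R : realType} {m : nat}.
Local Notation Cl := (clifford R m).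
Variable kap : nat -> 'rV[int]_m.
Hypothesis kap_inj : injective kap.
Implicit Types (x : 'rV[R]_m) (A : {set 'I_m}) (c : bool).
Local Notation knorm := (knorm kap : nat -> R).
Local Notation tempered := (tempered kap).
Local Notation cl_tempered := (cl_tempered kap).
Local Notation gauss_weight := (fun n => expR (- (1 * (sqn kap n / 2))) : R).

(** Tannery's theorem in the truncation order [J]: the truncated cosh and sinh are bounded by exp
    |x0 |k||, which the heat factor absorbs by [wave_dom_le]. The limit is then regrouped by
    exponentials. *)
Lemma exp_psum_pair_cvg (a b : nat -> R) (x0 : R) x : tempered a -> tempered b ->
  pair_series kap gauss_weight
    (fun n => (exp_psum (x0 * knorm n) J + exp_psum (- (x0 * knorm n)) J) / 2 * a n)
    (fun n => - ((exp_psum (x0 * knorm n) J - exp_psum (- (x0 * knorm n)) J) / 2) * b n) x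
    @[J --> \oo] -->
  wave_series kap 1 (fun n => 2^-1 * a n) (fun n => - (1 / 2) * b n) (x0, x) +
  wave_series kap (-1) (fun n => 2^-1 * a n) (fun n => - (- 1 / 2) * b n) (x0, x).
Proof.
move=> ta tb.
pose h n : R := hart (kap n) x; pose h' n : R := hart (- kap n) x.
pose l n := gauss_weight n *
  ((expR (x0 * knorm n) + expR (- (x0 * knorm n))) / 2 * a n * h n +
   - ((expR (x0 * knorm n) - expR (- (x0 * knorm n))) / 2) * b n * h' n).
have -> : wave_series kap 1 (fun n => 2^-1 * a n) (fun n => - (1 / 2) * b n) (x0, x) +
    wave_series kap (-1) (fun n => 2^-1 * a n) (fun n => - (- 1 / 2) * b n) (x0, x) =
    limn (series l).
  rewrite /wave_series /pair_series -lim_seriesD.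
  - congr (limn (series _)); apply/funext => n.
    rewrite -[LHS]/(wave_weight kap 1 x0 n * (2^-1 * a n * h n + - (1 / 2) * b n * h' n) +
      wave_weight kap (-1) x0 n * (2^-1 * a n * h n + - (- 1 / 2) * b n * h' n)).
    by rewrite /l /wave_weight !mul1r !mulN1r; ring.
  - apply: pair_series_cvg; [|exact: temperedZ|exact: temperedZ].
    by apply: wave_weightP; rewrite normr1.
  - apply: pair_series_cvg; [|exact: temperedZ|exact: temperedZ].
    by apply: wave_weightP; rewrite normrN1.
have ww : weight kap (wave_dom kap `|x0|) by exact: weight_wave_dom.
apply: (cvg_lim_series (pair_bound_summable ww ta tb)).
- apply: nearW => J n; set y := x0 * knorm n.
  set u : R := (exp_psum y J + exp_psum (- y) J) / 2.
  set v : R := - ((exp_psum y J - exp_psum (- y) J) / 2).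
  have E1 := exp_psum_le y J; have E2 := exp_psum_le (- y) J; rewrite normrN in E2.
  have u_le : `|u| <= expR `|y|.
    rewrite /u normrM (@ger0_norm _ 2^-1)// ler_pdivrMr//.
    by apply: le_trans (ler_normD _ _) _; lra.
  have v_le : `|v| <= expR `|y|.
    rewrite /v normrN normrM (@ger0_norm _ 2^-1)// ler_pdivrMr//.
    by apply: le_trans (ler_normB _ _) _; lra.
  have le_dom t : `|t| <= expR `|y| -> `|gauss_weight n * t| <= `|wave_dom kap `|x0| n|.
    move=> t_le; have := @wave_dom_le _ _ kap 1 x0 `|x0| n.
    rewrite normr1 !lexx !mul1r => /(_ isT isT); apply: le_trans.
    by rewrite normrM ger0_norm ?expR_ge0// ler_wpM2l ?expR_ge0.
  rewrite -[u * _ * _]mulrA -[v * _ * _]mulrA mulrDr ![_ * (u * _)]mulrA ![_ * (v * _)]mulrA.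
  by apply: pair_term_le; exact: le_dom.
- move=> n; apply: cvgMr; apply: cvgD.
    apply: cvgMl; apply: cvgMl; apply: cvgMl; apply: cvgD; exact: exp_psum_cvg.
  apply: cvgMl; apply: cvgMl; apply: cvgN; apply: cvgMl; apply: cvgB; exact: exp_psum_cvg.
Qed.

(** The part of exp (- x0 D) whose dependence on x0 is exp (s x0 |k|). The halves s = 1 and s = -1
    add up to cosh on the first kernel and to - sinh times the unit vector on the second. *)
Definition half_wave (s : R) (a : nat -> Cl) (z : R * 'rV[R]_m) : Cl :=
  cl_pair kap (wave_weight kap s z.1) (fun n => (2^-1 : R)%:C%C *: a n)
    (fun n => (- (s / 2))%:C%C *: cl_unit kap n (a n)) z.2.

Definition wave_cl (a : nat -> Cl) z : Cl := half_wave 1 a z + half_wave (-1) a z.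

Lemma cl_coord_half_wave A c s a z : cl_coord A c (half_wave s a z) =
  wave_series kap s (fun n => 2^-1 * cl_coord A c (a n))
    (fun n => - (s / 2) * cl_coord A c (cl_unit kap n (a n))) z.
Proof. by rewrite cl_coord_pair; apply: eq_pair_series => n; exact: cl_coordZ. Qed.

Lemma exp_dirac_cvg a (x0 : R) x A c : cl_tempered a ->
  cl_coord A c (exp_dirac_psum x0 (cl_pair kap gauss_weight a (fun=> 0)) x J) @[J --> \oo]
  --> cl_coord A c (wave_cl a (x0, x)).
Proof.
move=> ta; rewrite cl_coordD !cl_coord_half_wave.
have ww : weight kap gauss_weight by exact: weight_gauss.
have tu := cl_tempered_unit kap_inj ta.
have := exp_psum_pair_cvg (x0 := x0) (x := x) (ta A c) (tu A c).
apply: cvg_trans; apply: near_eq_cvg; apply: nearW => J.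
rewrite /exp_dirac_psum cl_coord_sum.
under [RHS]eq_bigr => j _.
  rewrite iter_dirac_pair//.
  rewrite (_ : (-1) ^+ j * (x0 ^+ j / j`!%:R)%:C%C = ((-1) ^+ j * (x0 ^+ j / j`!%:R))%:C%C); last first.
    by rewrite [RHS]rmorphM; congr (_ * _); rewrite rmorph_sign.
  rewrite cl_coordZ cl_coord_pair.
  over.
rewrite -pair_series_sum//; last 2 first.
- by move=> j; exact: (@cl_tempered_knorm _ _ kap (~~ odd j)%:R j a ta A c).
- by move=> j; exact: (@cl_tempered_knorm _ _ kap (odd j)%:R j _ tu A c).
apply: eq_pair_series => n.
  rewrite -even_exp_psum mulr_suml; apply: eq_bigr => j _.
  by rewrite /= cl_coordZ mulrA.
rewrite -odd_exp_psum mulr_suml; apply: eq_bigr => j _.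
by rewrite [in RHS]cl_coordZ mulrA.
Qed.

Lemma exp_dirac_pair a (x0 : R) x : cl_tempered a ->
  exp_dirac x0 (cl_pair kap gauss_weight a (fun=> 0)) x = wave_cl a (x0, x).
Proof.
move=> ta; apply: cl_coordP => A c; rewrite /exp_dirac /cl_lim cl_coord_lift.
by apply/cvg_lim; [exact: Rhausdorff|exact: exp_dirac_cvg].
Qed.

End DiracExponential.

(** * Monogenicity of the wave series *)

Section WaveMonogenic.
Context {R : realType} {m : nat}.
Local Notation Cl := (clifford R m).
Variable kap : nat -> 'rV[int]_m.
Hypothesis kap_inj : injective kap.
Implicit Types (x : 'rV[R]_m) (A : {set 'I_m}) (c : bool) (f g : 'rV[R]_m -> Cl).
Local Notation knorm := (knorm kap : nat -> R).
Local Notation tempered := (tempered kap).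
Local Notation cl_tempered := (cl_tempered kap).

Lemma monogenicD (F G : R -> 'rV[R]_m -> Cl) : monogenic F -> monogenic G ->
  monogenic (fun (x0 : R) x => F x0 x + G x0 x).
Proof.
have slice H (x0 : R) x A c : monogenic H -> derivable (fun t => cl_coord A c (H t x)) x0 1 /\
    forall j, derivable (cl_coord A c \o H x0) x (delta_mx 0 j).
  move=> [_ CH _]; have [_ dH] := CH A c.
  have dv v : is_derive (x0, x) v (fun z => cl_coord A c (H z.1 z.2))
      ('D_v (fun z => cl_coord A c (H z.1 z.2)) (x0, x)).
    by apply: DeriveDef => //; have [+ _] := dH v; apply.
  by split=> [|j]; [case: (is_derive_slice_fst (dv (1, 0)))|case: (is_derive_slice_snd (dv (0, delta_mx 0 j)))].
move=> mF mG; have [pF CF eF] := mF; have [pG CG eG] := mG; split.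
- by move=> x0 j x; rewrite pF pG.
- move=> A c; apply: Ck_ext (CkD openT (CF A c) (CG A c)) => [|z _]; first exact: openT.
  by rewrite /= cl_coordD.
move=> x0 x; apply: cl_coordP => A c; rewrite cl_coord0.
have := congr1 (cl_coord A c) (congr2 +%R (eF x0 x) (eG x0 x)).
rewrite addr0 cl_coord0 => <-; rewrite addrACA [LHS]cl_coordD [RHS]cl_coordD; congr (_ + _).
  rewrite cl_coordD /cl_derive !cl_coord_lift -deriveD; [|exact: (slice _ _ _ _ _ mF).1|exact: (slice _ _ _ _ _ mG).1].
  by congr ('D_1 _ x0); apply/funext => t; exact: cl_coordD.
rewrite cl_coordD !dirac_coord -big_split; apply: eq_bigr => j _ /=; rewrite -mulrDr; congr (_ * _).
rewrite -deriveD; [|exact: (slice _ _ _ _ _ mF).2|exact: (slice _ _ _ _ _ mG).2].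
by congr ('D_ _ _ x); apply/funext => y; exact: cl_coordD.
Qed.

(** On each mode the pair (a, - s u a), with u = k / |k|, is an eigenvector of D for - s |k|, since
    s^2 = 1 and k u = - |k|; the derivative in x0 contributes + s |k|. *)
Lemma half_wave_monogenic (s : R) (a : nat -> Cl) : s ^+ 2 = 1 -> cl_tempered a ->
  monogenic (fun (x0 : R) x => half_wave kap s a (x0, x)).
Proof.
move=> s2 ta; have tu := cl_tempered_unit kap_inj ta.
have s1 : `|s| <= 1 by rewrite -sqrtr_sqr s2 sqrtr1.
pose a' A c n := 2^-1 * cl_coord A c (a n).
pose b' A c n := - (s / 2) * cl_coord A c (cl_unit kap n (a n)).
have ta' A c : tempered (a' A c) by apply: temperedZ; exact: ta.
have tb' A c : tempered (b' A c) by apply: temperedZ; exact: tu.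
have tk y : tempered y -> tempered (fun n => s * knorm n * y n).
  by move=> ty; have := tempered_wave_rate (s := s) (c := 1) ty; under eq_fun do rewrite mul1r.
split.
- move=> x0 j x; apply: cl_coordP => A c; rewrite !cl_coord_half_wave.
  exact: (pair_series_periodic kap _ _ _ j x).
- move=> A c; rewrite (_ : _ \o _ = wave_series kap s (a' A c) (b' A c)).
    exact: Ck_wave_series.
  by apply/funext => -[x0 x]; exact: cl_coord_half_wave.
move=> x0 x; have ww := wave_weightP (kap := kap) (x0 := x0) s1.
rewrite (dirac_pair kap_inj _ ww (cl_temperedZ (s := 2^-1) ta) (cl_temperedZ (s := - (s / 2)) tu)).
apply: cl_coordP => A c; rewrite cl_coordD cl_coord0 cl_coord_pair /cl_derive cl_coord_lift.
have dF : is_derive x0 1 (fun t => wave_series kap s (a' A c) (b' A c) (t, x) : R)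
    (pair_series kap (wave_weight kap s x0) (fun n => s * knorm n * a' A c n)
      (fun n => s * knorm n * b' A c n) x).
  have := is_derive_slice_fst (is_derive_wave_series (x0, x) (1, 0) s1 (ta' A c) (tb' A c)).
  by congr is_derive; apply: eq_pair_series => n; rewrite /dflow1 /dflow2 dotp0r mul1r mul0r ?subr0 ?addr0.
rewrite (_ : cl_coord A c \o _ = fun t => wave_series kap s (a' A c) (b' A c) (t, x)); last first.
  by apply/funext => t; exact: cl_coord_half_wave.
have [_ ->] := dF; apply/eqP; rewrite addrC addr_eq0 -[- pair_series _ _ _ _ _]mulN1r -(pair_seriesZ kap_inj)//; last 2 first.
- exact: tk.
- exact: tk.
apply/eqP/eq_pair_series => n; rewrite -scalerAr.
  by rewrite cl_vec_unit scalerN opprK !cl_coordZ /a'; ring.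
rewrite cl_vecE 2!cl_coordZ /b'; set u := cl_coord _ _ _.
have -> : -1 * (s * knorm n * (- (s / 2) * u)) = s ^+ 2 * (2^-1 * (knorm n * u)) by field.
by rewrite s2 mul1r.
Qed.

Lemma wave_cl_monogenic (a : nat -> Cl) : cl_tempered a ->
  monogenic (fun (x0 : R) x => wave_cl kap a (x0, x)).
Proof.
by move=> ta; apply: monogenicD; apply: half_wave_monogenic; rewrite ?sqrrN ?expr1n.
Qed.

End WaveMonogenic.

(** * Gaussian integrals of exponentials *)

Section GaussianMoments.
Context {R : realType}.
Local Notation TR := (measurableTypeR R).
Local Notation leb := (@lebesgue_measure R).
Local Notation gamma := (gauss R).
Local Notation sd := ((Num.sqrt 2)^-1 : R).

(** The Radon-Nikodym derivative of [gamma] and the normal density have the same integral over every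
    measurable set, hence agree almost everywhere. *)
Lemma integral_gauss (f : TR -> \bar R) : measurable_fun setT f -> (forall x, 0 <= f x)%E ->
  (\int[gamma]_x f x = \int[leb]_x (f x * (normal_pdf 0 sd x)%:E))%E.
Proof.
move=> mf f0; have dom : gamma `<< leb by exact: normal_prob_dominates.
have rn := Radon_Nikodym_SigmaFinite.f_integrable dom.
rewrite -(Radon_Nikodym_SigmaFinite.change_of_variables dom f0 measurableT mf).
have mpdf : measurable_fun setT (fun x : TR => (normal_pdf 0 sd x)%:E).
  by apply/measurable_EFinP; exact: measurable_normal_pdf.
apply: ae_eq_integral => //.
- by apply: emeasurable_funM => //; exact: measurable_int rn.
- exact: emeasurable_funM.
apply: ae_eqe_mul2l; apply: integral_ae_eq => //.
by move=> E _ mE; rewrite -(Radon_Nikodym_SigmaFinite.f_integral dom mE).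
Qed.

(** Completing the square: exp (2 x r) times the density of mean 0 is exp (r^2) times the density of
    mean r. *)
Lemma integral_gauss_expR (r : R) :
  (\int[gamma]_x (expR (2 * (x * r)))%:E = (expR (r ^+ 2))%:E)%E.
Proof.
have mE : measurable_fun setT (fun x : TR => (expR (2 * (x * r)))%:E).
  by apply/measurable_EFinP; apply: measurableT_comp => //; do ?apply: measurable_funM.
rewrite (integral_gauss mE); last by move=> x; rewrite lee_fin expR_ge0.
have s2 : (Num.sqrt 2 : R)^-1 ^+ 2 *+ 2 = 1.
  by rewrite exprVn sqr_sqrtr// -mulr_natr mulVf.
have s0 : sd != 0 by rewrite invr_eq0 sqrtr_eq0 -ltNge.
transitivity (\int[leb]_x ((expR (r ^+ 2))%:E * (normal_pdf r sd x)%:E))%E.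
  apply: eq_integral => x _; rewrite -!EFinM; congr EFin.
  rewrite !normal_pdfE//= /normal_fun s2 !divr1 mulrCA [RHS]mulrCA; congr (_ * _).
  by rewrite -!expRD; congr expR; ring.
rewrite ge0_integralZl//.
- by rewrite integral_normal_pdf mule1.
- by apply/measurable_EFinP; exact: measurable_normal_pdf.
- by move=> x _; rewrite lee_fin normal_pdf_ge0.
Qed.

Lemma integrable_gauss_expR (r : R) :
  gamma.-integrable setT (fun x => (expR (2 * (x * r)))%:E).
Proof.
apply/integrableP; split.
  by apply/measurable_EFinP; apply: measurableT_comp => //; do ?apply: measurable_funM.
under eq_integral do rewrite gee0_abs ?lee_fin ?expR_ge0//.
by rewrite integral_gauss_expR ltry.
Qed.

(** The integrand is the square of P cosh (x r) + B sinh (x r). Expanded in exp (2 x r), exp (- 2 x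
    r) and a constant, it involves two equal moments, and the mixed terms in P B cancel. *)
Lemma integral_gauss_wave (r P B : R) :
  (\int[gamma]_x (((expR (x * r) * (P + B) + expR (- (x * r)) * (P - B)) / 2) ^+ 2)%:E =
  ((expR (r ^+ 2) + 1) / 2 * P ^+ 2 + (expR (r ^+ 2) - 1) / 2 * B ^+ 2)%:E)%E.
Proof.
pose c1 := ((P + B) / 2) ^+ 2; pose c2 := ((P - B) / 2) ^+ 2.
pose c3 := (P ^+ 2 - B ^+ 2) / 2.
transitivity (\int[gamma]_x ((c1%:E * (expR (2 * (x * r)))%:E +
    c2%:E * (expR (2 * (x * - r)))%:E) + c3%:E))%E.
  apply: eq_integral => x _; rewrite -!EFinM -!EFinD; congr EFin.
  have -> : expR (2 * (x * r)) = expR (x * r) ^+ 2 by rewrite -expRM_natl.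
  have -> : expR (2 * (x * - r)) = expR (- (x * r)) ^+ 2 by rewrite -expRM_natl mulrN.
  have e1 : expR (x * r) * expR (- (x * r)) = 1 by rewrite -expRD subrr expR0.
  have -> : c3 = c3 * (expR (x * r) * expR (- (x * r))) by rewrite e1 mulr1.
  by rewrite /c1 /c2 /c3; field.
have i1 := integrableZl measurableT c1 (integrable_gauss_expR r).
have i2 := integrableZl measurableT c2 (integrable_gauss_expR (- r)).
rewrite integralD//=; last 2 first.
- exact: integrableD.
- exact: finite_measure_integrable_cst.
rewrite integralD//= !integralZl//; do ?exact: integrable_gauss_expR.
rewrite !integral_gauss_expR integral_prob_cst sqrrN -!EFinM -!EFinD; congr EFin.
by rewrite /c1 /c2 /c3; field.
Qed.

End GaussianMoments.

(** * Parseval's identity on the cylinder *)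

Section CylinderParseval.
Context {R : realType} {m : nat}.
Local Notation TR := (measurableTypeR R).
Local Notation tp := (@torus_point R m).
Variable kap : nat -> 'rV[int]_m.
Hypothesis kap_inj : injective kap.
Hypothesis kap_surj : forall p, exists n, kap n = p.
Local Notation q := (sqn kap : nat -> R).
Local Notation knorm := (knorm kap : nat -> R).

Lemma torus_parseval (w : 'rV[R]_m -> R) : w \o tp \in Lfun (haar R m) 2%:E ->
  (\int[haar R m]_t (w (tp t) ^+ 2)%:E = \sum_(l <oo) (coef kap w l ^+ 2)%:E)%E.
Proof.
move=> wL; under eq_integral do rewrite expr2.
rewrite -(ip_EFin wL wL); apply/esym/cvg_lim => //.
rewrite (_ : (fun n => _) = (fun n => (series (fun l => coef kap w l ^+ 2) n)%:E)).
  by apply: cvg_EFin; [exact: nearW|exact: coef_parseval].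
by apply/funext => n; rewrite /series /= -sumEFin.
Qed.

Definition wave_energy (P B : nat -> R) l : R :=
  (expR (q l) + 1) / 2 * P l ^+ 2 + (expR (q l) - 1) / 2 * B l ^+ 2.

(** Tonelli, Parseval on each slice, and a Gaussian moment for each mode. The identity lives in the
    extended reals, so finiteness of either side can be deduced from the other. *)
Lemma cylinder_parseval (g : R * 'rV[R]_m -> R) (P B : nat -> R) :
  continuous g -> (forall x0, rperiodic (fun x => g (x0, x))) ->
  (forall x0 l, coef kap (fun x => g (x0, x)) l =
    (expR (x0 * knorm l) * (P l + B l) + expR (- (x0 * knorm l)) * (P l - B l)) / 2) ->
  (\int[cylinder_measure R m]_z (g (z.1, tp z.2) ^+ 2)%:E =
   \sum_(l <oo) (wave_energy P B l)%:E)%E.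
Proof.
move=> cg pg gE.
have mg : measurable_fun setT (fun z : TR * m.-tuple TR => (g (z.1, tp z.2) ^+ 2)%:E).
  by apply/measurable_EFinP; apply: measurable_funX; exact: measurable_fun_cylinder.
have g0 (z : TR * m.-tuple TR) : (0 <= (g (z.1, tp z.2) ^+ 2)%:E)%E.
  by rewrite lee_fin sqr_ge0.
rewrite (@fubini_tonelli1 _ _ _ _ _ (gauss R) (haar R m) _ mg g0) /fubini_F /=.
pose c l (x0 : TR) : \bar R := (((expR (x0 * knorm l) * (P l + B l) +
  expR (- (x0 * knorm l)) * (P l - B l)) / 2) ^+ 2)%:E.
transitivity (\int[gauss R]_x (\sum_(l <oo) c l x))%E.
  apply: eq_integral => x0 _.
  have cx0 : continuous (fun x => g (x0, x)).
    by move=> x; apply: continuous_slice_snd; exact: cg.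
  have gL := L2_continuous (pg x0) cx0.
  by rewrite (torus_parseval gL); apply: eq_eseriesr => l _; rewrite gE.
rewrite integral_nneseries//; last 2 first.
- move=> l; apply/measurable_EFinP; apply: measurable_funX; apply: measurable_funM => //.
  by apply: measurable_funD; apply: measurable_funM => //; apply: measurableT_comp => //;
    do ?apply: measurableT_comp => //; apply: measurable_funM.
- by move=> l x _; rewrite lee_fin sqr_ge0.
apply: eq_eseriesr => l _.
by rewrite integral_gauss_wave /wave_energy knorm_sqr.
Qed.

(** A sum of nonnegative terms is unordered, so the involution k -> - k may permute it. *)
Lemma nneseries_neg_index (f : nat -> \bar R) : (forall l, 0 <= f l)%E ->
  (\sum_(l <oo) f (neg_index kap_surj l) = \sum_(l <oo) f l)%E.
Proof.
move=> f0; rewrite !nneseries_esumT//.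
rewrite [RHS](@reindex_esum _ _ _ setT setT (neg_index kap_surj))//.
split => //; first by move=> x y _ _ /(inv_inj (neg_indexK kap_inj kap_surj)).
by move=> y _; exists (neg_index kap_surj y) => //; rewrite neg_indexK.
Qed.

End CylinderParseval.

(** * A linear system with hyperbolic solutions *)

Section WaveEquation.
Context {R : realType}.
Implicit Types (r x : R).

(* p + b and p - b solve z' = r z and z' = - r z. *)
Lemma wave_ode (p b : R -> R) r : (forall x, is_derive x 1 p (r * b x)) ->
  (forall x, is_derive x 1 b (r * p x)) -> forall x,
  p x = (expR (x * r) * (p 0 + b 0) + expR (- (x * r)) * (p 0 - b 0)) / 2.
Proof.
move=> dp db x.
have expE (z : R -> R) (s : R) : (forall y : R, is_derive y 1 z (s * z y)) ->
    z x = expR (x * s) * z 0.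
  move=> dz; have c (y : R) : is_derive y 1 (fun y => expR (y * - s) * z y) 0.
    have d0 : is_derive y 1 (fun y : R => y * - s) (- s).
      by apply: is_derive_affine => h; rewrite [h *: 1]mulr1 mulrDl.
    have d : is_derive y 1 (fun y => expR (y * - s) * z y)
        (expR (y * - s) * (s * z y) + z y * (expR (y * - s) * - s)) :=
      is_deriveM (is_derive_comp1 d0 (is_derive_expR _)) (dz y).
    by apply: is_derive_eq d _; ring.
  have := is_derive_0_is_cst x 0 c; rewrite mul0r expR0 mul1r => <-.
  by rewrite mulrA -expRD mulrN subrr expR0 mul1r.
have e1 : p x + b x = expR (x * r) * (p 0 + b 0).
  apply: (expE (fun y => p y + b y)) => y.
  by apply: is_derive_eq (is_deriveD (dp y) (db y)) _; ring.
have e2 : p x - b x = expR (x * - r) * (p 0 - b 0).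
  apply: (expE (fun y => p y - b y)) => y.
  by apply: is_derive_eq (is_deriveB (dp y) (db y)) _; ring.
by rewrite -mulrN -e1 -e2; field.
Qed.

End WaveEquation.

(** * Evolution in x0 of the coefficients of a monogenic function *)

Section MonogenicCoefficients.
Context {R : realType} {m : nat}.
Local Notation Cl := (clifford R m).
Local Notation mu := (haar R m).
Local Notation tp := (@torus_point R m).
Variable kap : nat -> 'rV[int]_m.
Hypothesis kap_inj : injective kap.
Hypothesis kap_surj : forall p, exists n, kap n = p.
Implicit Types (F : R -> 'rV[R]_m -> Cl) (f : 'rV[R]_m -> Cl) (A : {set 'I_m}) (c : bool).
Local Notation knorm := (knorm kap : nat -> R).
Local Notation sigma := (neg_index kap_surj).

Definition ccoef f n : Cl := cl_lift (fun w => coef kap w n) f.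

Lemma cl_coord_ccoef A c f n : cl_coord A c (ccoef f n) = coef kap (cl_coord A c \o f) n.
Proof. exact: cl_coord_lift. Qed.

Lemma monogenic_slice F x0 A c : monogenic F ->
  rperiodic (cl_coord A c \o F x0) /\ continuous (cl_coord A c \o F x0).
Proof.
move=> [pF CF _]; split; first by move=> j x; rewrite /= pF.
have [cg _] := CF A c; move=> x; apply: (@continuous_slice_snd _ _ _ (cl_coord A c \o (fun z => F z.1 z.2)) x0).
exact: cg.
Qed.

(** The derivative in x0 is - D F, and integration by parts moves D onto the kernel, which exchanges
    [l] and [sigma l]; the two minus signs cancel. *)
Lemma monogenic_coef F A c (x0 : R) l : monogenic F ->
  is_derive x0 1 (fun t => cl_coord A c (ccoef (F t) l))
    (cl_coord A c (cl_vec (kap l) * ccoef (F x0) (sigma l))).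
Proof.
move=> mF; have [pF CF eqF] := mF.
pose g A c (z : R * 'rV[R]_m) := cl_coord A c (F z.1 z.2).
have cg A' c' z : {for z, continuous (g A' c')} by have [+ _] := CF A' c'; apply.
have Dg A' c' v z : derivable (g A' c') z v by have [_ /(_ v)[+ _]] := CF A' c'; apply.
have cDg A' c' v z : {for z, continuous ('D_v (g A' c'))}.
  by have [_ /(_ v)[_ [+ _]]] := CF A' c'; apply.
pose ej (j : 'I_m) : R * 'rV[R]_m := (0, delta_mx 0 j).
have pg A' c' t : rperiodic (fun x => g A' c' (t, x)).
  by move=> j x; rewrite /g /= pF.
have dj A' c' j t x : is_derive x (delta_mx 0 j) (fun y => g A' c' (t, y)) ('D_(ej j) (g A' c') (t, x)).
  by apply: is_derive_slice_snd; apply: DeriveDef.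
have pdj A' c' j t : rperiodic (fun x => 'D_(ej j) (g A' c') (t, x)).
  by apply: (rperiodic_derive (pg A' c' t)) => x; exact: dj.
have d0 (t : R) x : is_derive t 1 (fun s => g A c (s, x)) ('D_(1, 0) (g A c) (t, x)).
  by apply: is_derive_slice_fst; apply: DeriveDef.
have eqn t x : 'D_(1, 0) (g A c) (t, x) =
    \sum_j - gen_sign j A * 'D_(ej j) (g (gen_flip j A) c) (t, x).
  have := congr1 (cl_coord A c) (eqF t x).
  rewrite cl_coordD cl_coord0 /cl_derive cl_coord_lift dirac_coord => /eqP.
  rewrite addr_eq0 => /eqP e; have [_ e0] := d0 t x.
  rewrite -e0; apply: etrans e _; rewrite -sumrN; apply: eq_bigr => j _.
  by rewrite mulNr; congr (- (_ * _)); have [_ e1] := dj (gen_flip j A) c j t x.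
have dcoef : is_derive x0 1 (fun s => ip mu (fun y => g A c (s, tp y)) (char (kap l)))
    (ip mu (fun y => 'D_(1, 0) (g A c) (x0, tp y)) (char (kap l))).
  apply: (@is_derive_ip_char R m (g A c) ('D_(1, 0) (g A c)) (x0 - 1) (x0 + 1) x0 (kap l)) => //.
  - by move=> s _ j x; rewrite (eqn s (x + _)) (eqn s x); apply: eq_bigr => i _; rewrite (pdj _ _ i s j x).
  - by apply/andP; split; lra.
have -> : (fun t => cl_coord A c (ccoef (F t) l)) =
    (fun s => ip mu (fun y => g A c (s, tp y)) (char (kap l))).
  by apply/funext => t; rewrite cl_coord_ccoef.
apply: is_derive_eq dcoef _.
transitivity (coef kap (fun x => \sum_j - gen_sign j A * 'D_(ej j) (g (gen_flip j A) c) (x0, x)) l).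
  by rewrite /coef; congr ip; apply/funext => y; exact: eqn.
have cj A' c' j : continuous (fun x => 'D_(ej j) (g A' c') (x0, x)).
  by move=> x; apply: (@continuous_slice_snd _ _ _ ('D_(ej j) (g A' c')) x0); exact: cDg.
have cs A' c' : continuous (fun x => g A' c' (x0, x)).
  by move=> x; apply: (@continuous_slice_snd _ _ _ (g A' c') x0); exact: cg.
rewrite (@coef_sum _ _ kap _ (fun j => - gen_sign j A) (fun j x => 'D_(ej j) (g (gen_flip j A) c) (x0, x))); last first.
  by move=> j; apply: L2_continuous; [exact: pdj|exact: cj].
rewrite cl_coord_vec; apply: eq_bigr => j _.
rewrite cl_coord_ccoef /coef.
rewrite (ip_derive_hart (kap l) (pg _ _ x0) (cs _ _) (pdj _ _ j x0) (cj _ _ j) (fun x => dj _ _ j x0 x)).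
by rewrite kap_neg_index; ring.
Qed.

Lemma is_derive_cl_vec (u : R -> Cl) (du : Cl) (t : R) p A c :
  (forall A c, is_derive t 1 (fun t => cl_coord A c (u t)) (cl_coord A c du)) ->
  is_derive t 1 (fun t => cl_coord A c (cl_vec p * u t)) (cl_coord A c (cl_vec p * du)).
Proof.
move=> hu; rewrite cl_coord_vec.
have -> : (fun t => cl_coord A c (cl_vec p * u t)) =
    \sum_j (fun t => (p 0 j)%:~R * (gen_sign j A * cl_coord (gen_flip j A) c (u t))).
  by apply/funext => s; rewrite cl_coord_vec fct_sumE.
exact: is_derive_sum.
Qed.

(** The functions p = c_k and b = (k / |k|) c_(-k) solve p' = |k| b and b' = |k| p; in the second
    equation k meets - k and their product is |k|^2. *)
Lemma monogenic_coefE F A c (x0 : R) l : monogenic F ->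
  cl_coord A c (ccoef (F x0) l) =
  (expR (x0 * knorm l) * (cl_coord A c (ccoef (F 0) l) +
     cl_coord A c (cl_unit kap l (ccoef (F 0) (sigma l)))) +
   expR (- (x0 * knorm l)) * (cl_coord A c (ccoef (F 0) l) -
     cl_coord A c (cl_unit kap l (ccoef (F 0) (sigma l))))) / 2.
Proof.
move=> mF; pose p t := cl_coord A c (ccoef (F t) l).
pose b t := cl_coord A c (cl_unit kap l (ccoef (F t) (sigma l))).
apply: (@wave_ode _ p b) => t.
  apply: is_derive_eq (monogenic_coef A c t l mF) _.
  by rewrite cl_vecE cl_coordZ.
have d1 := is_derive_cl_vec (kap l) A c (fun A c => monogenic_coef A c t (sigma l) mF).
have -> : b = (knorm l)^-1 \*: (fun t => cl_coord A c (cl_vec (kap l) * ccoef (F t) (sigma l))).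
  by apply/funext => s; exact: cl_coordZ.
apply: is_derive_eq (is_deriveZ _ d1) _.
rewrite kap_neg_index cl_vecN neg_indexK// mulNr mulrN cl_vec_sqr opprK cl_coordZ.
rewrite -/(sqn kap l) -(knorm_sqr kap l) /GRing.scale /= expr2.
(* For k = 0 both sides contain the factor 0. *)
have [->|r0] := eqVneq (knorm l) 0; first by rewrite !mul0r mulr0.
by rewrite !mulrA mulVf// mul1r.
Qed.

End MonogenicCoefficients.

(** * The heat semigroup and the series expression of V *)

Section HeatSemigroup.
Context {R : realType} {m : nat}.
Local Notation Cl := (clifford R m).
Local Notation mu := (haar R m).
Local Notation tp := (@torus_point R m).
Variable kap : nat -> 'rV[int]_m.
Hypothesis kap_inj : injective kap.
Hypothesis kap_surj : forall p, exists n, kap n = p.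
Implicit Types (f g : 'rV[R]_m -> Cl) (A : {set 'I_m}) (c : bool) (x : 'rV[R]_m).
Local Notation q := (sqn kap : nat -> R).
Local Notation coef := (coef kap).
Local Notation ccoef := (ccoef kap).

Definition heat_cl f (t : R) : 'rV[R]_m -> Cl :=
  cl_pair kap (heat_weight kap t) (ccoef f) (fun=> 0).

Lemma L2torus_coord f A c : L2torus f ->
  rperiodic (cl_coord A c \o f) /\ (cl_coord A c \o f) \o tp \in Lfun mu 2%:E.
Proof. by move=> [pf fL]; split; [move=> j x; rewrite /= pf|exact: fL]. Qed.

Lemma cl_tempered_ccoef f : L2torus f -> cl_tempered kap (ccoef f).
Proof.
move=> fL A c; rewrite (_ : _ \o _ = coef (cl_coord A c \o f)).
  by apply: coef_tempered => //; exact: (L2torus_coord A c fL).2.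
by apply/funext => n; rewrite /= cl_coord_ccoef.
Qed.

Lemma cl_coord_heat A c f t x : cl_coord A c (heat_cl f t x) =
  heat_series kap (coef (cl_coord A c \o f)) (fun=> 0) (t, x).
Proof.
rewrite cl_coord_pair; apply: eq_pair_series => n; first exact: cl_coord_ccoef.
exact: cl_coord0.
Qed.

Lemma partial_coord A c j f :
  cl_coord A c \o partial j f = 'D_(delta_mx 0 j) (cl_coord A c \o f).
Proof. by apply/funext => x; rewrite /= /partial /cl_derive cl_coord_lift. Qed.

Lemma laplacian_coord A c f x : cl_coord A c (laplacian f x) =
  \sum_j 'D_(delta_mx 0 j) ('D_(delta_mx 0 j) (cl_coord A c \o f)) x.
Proof.
rewrite /laplacian cl_coord_sum; apply: eq_bigr => j _.
rewrite -[LHS]/((cl_coord A c \o partial j (partial j f)) x).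
by rewrite !partial_coord.
Qed.

Lemma half_complex : 2^-1 = ((2^-1 : R)%:C)%C :> R[i].
Proof. by rewrite fmorphV rmorph_nat. Qed.

Lemma heat_series_heat_equation (a : nat -> R) (t : R) x : tempered kap a -> 0 < t ->
  'D_1 (fun s => heat_series kap a (fun=> 0) (s, x)) t =
  2^-1 * \sum_j 'D_(delta_mx 0 j) ('D_(delta_mx 0 j)
    (fun y => heat_series kap a (fun=> 0) (t, y))) x.
Proof.
move=> ta t0; have z0 : tempered kap (fun=> 0 : R) by exact: tempered0.
have ww : weight kap (heat_weight kap t) := weight_gauss t0.
have d1 := is_derive_slice_fst (is_derive_heat_series (z := (t, x)) (1, 0) ta z0 t0).
have [_ ->] := d1.
pose d (j : 'I_m) n : R := dotp (kap n) (delta_mx 0 j).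
have d2 (j : 'I_m) : 'D_(delta_mx 0 j) ('D_(delta_mx 0 j)
    (fun y => heat_series kap a (fun=> 0) (t, y))) x =
    1 * pair_series kap (heat_weight kap t) (fun n => - (d j n * (d j n * a n))) (fun=> 0) x.
  have -> : 'D_(delta_mx 0 j) (fun y => heat_series kap a (fun=> 0) (t, y)) =
      pair_series kap (heat_weight kap t) (fun n => - (d j n * 0)) (fun n => d j n * a n).
    apply/funext => y; have [_ e] := is_derive_pair_series kap_inj y (delta_mx 0 j) ww ta z0.
    exact: e.
  have td : tempered kap (fun n => d j n * a n) by exact: tempered_dotp.
  have tz : tempered kap (fun n => - (d j n * 0)).
    by rewrite (_ : (fun _ => _) = (fun=> 0))//; apply/funext => n; rewrite mulr0 oppr0.
  have [_ e] := is_derive_pair_series kap_inj x (delta_mx 0 j) ww tz td.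
  rewrite mul1r; apply: etrans e _; apply: eq_pair_series => n //.
  by rewrite mulr0 oppr0 mulr0.
under eq_bigr do rewrite d2.
rewrite -pair_series_sum//; last first.
  by move=> j; apply: temperedN; do 2 apply: tempered_dotp => //.
rewrite -pair_seriesZ//; last 2 first.
- apply: tempered_sum => // j; apply: temperedN; do 2 apply: tempered_dotp => //.
- by apply: tempered_sum.
apply: eq_pair_series => n.
  have -> : \sum_i 1 * - (d i n * (d i n * a n)) = - (q n * a n).
    rewrite /sqn mulr_suml -sumrN; apply: eq_bigr => j _.
    by rewrite /d dotp_delta; ring.
  by rewrite /dflow1 /heat_rate /=; field.
have -> : \sum_(i < m) 1 * 0 = 0 :> R by rewrite big1// => j _; rewrite mulr0.
by rewrite /dflow2 /= dotp0r !mulr0 mul0r addr0.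
Qed.

Lemma heat_cl_solution f : L2torus f -> heat_solution f (heat_cl f).
Proof.
move=> fL; have t0 : tempered kap (fun=> 0 : R) by exact: tempered0.
have tf A c : tempered kap (coef (cl_coord A c \o f)).
  by apply: coef_tempered => //; exact: (L2torus_coord A c fL).2.
split.
- move=> t _ j x; apply: cl_coordP => A c; rewrite !cl_coord_heat.
  exact: (pair_series_periodic kap _ _ _ j x).
- move=> A c; rewrite (_ : _ \o _ = heat_series kap (coef (cl_coord A c \o f)) (fun=> 0)).
    exact: Ck_heat_series.
  by apply/funext => -[t x]; rewrite /= cl_coord_heat.
- move=> t x t_gt0; apply: cl_coordP => A c.
  rewrite half_complex cl_coordZ laplacian_coord /cl_derive cl_coord_lift.
  have e s : cl_coord A c \o heat_cl f s =
      (fun y => heat_series kap (coef (cl_coord A c \o f)) (fun=> 0) (s, y)).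
    by apply/funext => y; rewrite /= cl_coord_heat.
  rewrite e -heat_series_heat_equation//; congr ('D_1 _ t); apply/funext => s.
  by rewrite /= cl_coord_heat.
- move=> A c.
  have := heat_series_L2_cvg kap_inj kap_surj (L2torus_coord A c fL).2.
  apply: cvg_trans; apply: near_eq_cvg; apply: nearW => t.
  congr Lnorm; apply/funext => y /=; congr EFin.
  rewrite -[RHS]/(cl_coord A c (heat_cl f t (tp y) - f (tp y))) cl_coordB.
  by rewrite cl_coord_heat.
Qed.

Lemma ccoef_heat_solution f h : L2torus f -> heat_solution f h ->
  forall t n, 0 < t -> ccoef (h t) n = (heat_weight kap t n)%:C%C *: ccoef f n.
Proof.
move=> fL [ph Ch heq hf] t n t0; apply: cl_coordP => A c.
rewrite cl_coordZ !cl_coord_ccoef.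
apply: (@heat_coef_unique R m kap kap_inj (cl_coord A c \o f) (cl_coord A c \o (fun z => h z.1 z.2))) => //.
- exact: (L2torus_coord A c fL).2.
- by move=> s s0 j x; rewrite /= ph.
- move=> s x s0; have := congr1 (cl_coord A c) (heq s x s0).
  by rewrite half_complex cl_coordZ laplacian_coord /cl_derive cl_coord_lift.
- have := hf A c; apply: cvg_trans; apply: near_eq_cvg; apply: nearW => s.
  congr Lnorm; apply/funext => y /=; congr EFin.
  by rewrite -[LHS]/(cl_coord A c (h s (tp y) - f (tp y))) cl_coordB.
Qed.

Lemma heat_solution_unique f h h' : L2torus f -> heat_solution f h -> heat_solution f h' ->
  forall t, 0 < t -> h t = h' t.
Proof.
move=> fL sh sh' t t0; apply/funext => x; apply: cl_coordP => A c.
have slice (g : R -> 'rV[R]_m -> Cl) : heat_solution f g -> rperiodic (cl_coord A c \o g t) /\ continuous (cl_coord A c \o g t).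
  move=> [pg Cg _ _]; split; first by move=> j y; rewrite /= pg.
  move=> y; have [cg _] := Cg A c.
  apply: (@continuous_slice_snd _ _ _ (cl_coord A c \o (fun z => g z.1 z.2)) t).
  exact: (cg (t, y)).
have [ph ch] := slice h sh; have [ph' ch'] := slice h' sh'.
have e : cl_coord A c \o h t = cl_coord A c \o h' t.
  apply: (coef_ext kap_surj ph ch ph' ch') => n.
  by rewrite -!cl_coord_ccoef (ccoef_heat_solution fL sh)// (ccoef_heat_solution fL sh').
exact: (congr1 (@^~ x) e).
Qed.

(** [xget] selects some solution: [heat_cl_solution] shows that there is one, and uniqueness fixes
    its value at time 1. *)
Lemma exp_half_laplacianE f : L2torus f -> exp_half_laplacian f = heat_cl f 1.
Proof.
move=> fL; apply: (heat_solution_unique fL) => //; last exact: heat_cl_solution.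
by apply: (@xgetPex _ _ [set h | heat_solution f h]); exists (heat_cl f); exact: heat_cl_solution.
Qed.

Lemma V_wave_cl f : L2torus f -> V f = fun (x0 : R) x => wave_cl kap (ccoef f) (x0, x).
Proof.
move=> fL; apply/funext => x0; apply/funext => x; rewrite /V exp_half_laplacianE//.
by apply: exp_dirac_pair => //; exact: cl_tempered_ccoef.
Qed.

Lemma V_monogenic f : L2torus f -> monogenic (V f).
Proof.
by move=> fL; rewrite V_wave_cl//; apply: wave_cl_monogenic => //; exact: cl_tempered_ccoef.
Qed.

Lemma exp_dirac0 f : exp_dirac 0 f = f.
Proof.
apply/funext => x; apply: cl_coordP => A c; rewrite /exp_dirac /cl_lim cl_coord_lift.
apply/cvg_lim; first exact: Rhausdorff.
(* At x0 = 0 only the term j = 0 survives, so the partial sums are constant from n = 1 on. *)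
apply: cvg_near_cst; exists 1%N => // -[//|J] _; rewrite /= /exp_dirac_psum big_nat_recl//.
rewrite big1 ?addr0 => [|j _]; last by rewrite expr0n mul0r rmorph0 mulr0 scale0r.
by rewrite expr0 mul1r expr0 divr1 rmorph1 scale1r.
Qed.

Lemma ccoef_V0 f n : L2torus f ->
  ccoef (V f 0) n = (expR (- (q n / 2)))%:C%C *: ccoef f n.
Proof.
move=> fL; rewrite /V exp_dirac0 exp_half_laplacianE//.
by rewrite (ccoef_heat_solution fL (heat_cl_solution fL))// /heat_weight mul1r.
Qed.

End HeatSemigroup.

(** * Complex scalars in real coordinates *)

Section CliffordLinear.
Context {R : realType} {m : nat} {T : Type}.
Local Notation Cl := (clifford R m).
Implicit Types (F G : T -> Cl) (A : {set 'I_m}) (c : bool) (a : R[i]).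

Lemma cl_coordZc A c a (u : Cl) : cl_coord A c (a *: u) = complex.Re a * cl_coord A c u +
  (if c then complex.Im a else - complex.Im a) * cl_coord A (~~ c) u.
Proof.
by rewrite /cl_coord ffunE; case: a => x y; case: (u A) => ? ?; case: c => /=; ring.
Qed.

Lemma cl_coord_linear A c a F G : cl_coord A c \o (fun t => a *: F t + G t) =
  complex.Re a *: (cl_coord A c \o F) +
  ((if c then complex.Im a else - complex.Im a) *: (cl_coord A (~~ c) \o F) + (cl_coord A c \o G)).
Proof.
apply/funext => t.
rewrite -[RHS]/(complex.Re a * cl_coord A c (F t) +
  ((if c then complex.Im a else - complex.Im a) * cl_coord A (~~ c) (F t) + cl_coord A c (G t))).
by rewrite /= cl_coordD cl_coordZc addrA.
Qed.

End CliffordLinear.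

(** * Inner products and energies of Clifford-valued functions *)

Section CliffordL2.
Context {R : realType} {m : nat}.
Local Notation Cl := (clifford R m).
Context {d : measure_display} {T : measurableType d} (mu : probability T R).
Implicit Types (F G : T -> Cl) (A : {set 'I_m}) (c : bool) (a : R[i]).

Lemma L2fun_linear a F G : L2fun mu F -> L2fun mu G -> L2fun mu (fun t => a *: F t + G t).
Proof.
move=> FL GL A c; rewrite cl_coord_linear.
by apply: L2D; [exact: L2Z|apply: L2D; [exact: L2Z|exact: GL]].
Qed.

Definition rip F G : R := \sum_A \sum_c ip mu (cl_coord A c \o F) (cl_coord A c \o G).

(** Extended-real valued, so that it makes sense for [V f] before square integrability, which is
    then deduced from its finiteness. *)
Definition energy F : \bar R := (\sum_A \sum_c \int[mu]_t (cl_coord A c (F t) ^+ 2)%:E)%E.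

Lemma energy_rip F : L2fun mu F -> energy F = (rip F F)%:E.
Proof.
move=> FL; rewrite /rip -sumEFin; apply: eq_bigr => A _; rewrite -sumEFin.
apply: eq_bigr => c _; rewrite ip_EFin; [|exact: FL|exact: FL].
by apply: eq_integral => t _; rewrite expr2.
Qed.

Lemma L2fun_energy F : (forall A c, measurable_fun setT (cl_coord A c \o F)) ->
  (energy F < +oo)%E -> L2fun mu F.
Proof.
move=> mF Fy A c; apply: L2P => //; apply: le_lt_trans Fy.
have I0 A' c' : (0 <= \int[mu]_t (cl_coord A' c' (F t) ^+ 2)%:E)%E.
  by apply: integral_ge0 => t _; rewrite lee_fin sqr_ge0.
rewrite /energy (bigD1 A)//= (bigD1 c)//= -addeA leeDl// adde_ge0//.
  by apply: sume_ge0.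
by apply: sume_ge0 => A' _; apply: sume_ge0.
Qed.

Lemma Rintegral_sum (I : finType) (h : I -> T -> R) :
  (forall i, mu.-integrable setT (EFin \o h i)) ->
  \int[mu]_t (\sum_i h i t) = \sum_i \int[mu]_t h i t.
Proof.
move=> hi.
pose rel (u : T -> R) (y : R) := mu.-integrable setT (EFin \o u) /\ \int[mu]_t u t = y.
suff [_ <-] : rel (fun t => \sum_i h i t) (\sum_i \int[mu]_t h i t) by [].
have -> : (fun t => \sum_i h i t) = \sum_i h i by apply/funext => t; rewrite fct_sumE.
apply: (big_ind2 rel) => [|u y u' y' [ui <-] [ui' <-]|i _]; last by split.
  split; first exact: finite_measure_integrable_cst.
  by rewrite /Rintegral integral0.
split; last exact: RintegralD.
by have := integrableD measurableT ui ui'; under eq_fun do rewrite -EFinD.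
Qed.

Lemma integral_rdot F G : L2fun mu F -> L2fun mu G ->
  \int[mu]_t cl_rdot (F t) (G t) = rip F G.
Proof.
move=> FL GL; pose h (i : {set 'I_m} * bool) t := cl_coord i.1 i.2 (F t) * cl_coord i.1 i.2 (G t).
under eq_Rintegral => t _ do rewrite /cl_rdot pair_big.
rewrite (@Rintegral_sum _ h) => [|i]; last by apply: ip_integrable; [exact: FL|exact: GL].
by rewrite /rip pair_big.
Qed.

Lemma L2dotE F G : L2fun mu F -> L2fun mu G ->
  L2dot mu F G = Complex (rip F G) (rip F (fun t => 'i%C *: G t)).
Proof.
move=> FL GL; have iGL : L2fun mu (fun t => 'i%C *: G t).
  (* Linearity is stated for [a *: F + G], so [i G] is written as (i - 1) G + G. *)
  have := L2fun_linear ('i%C - 1) GL GL.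
  by under eq_fun do rewrite scalerBl scale1r subrK.
rewrite /L2dot -!integral_rdot//.
by congr Complex; apply: eq_Rintegral => t _; rewrite cl_dotE.
Qed.

Lemma rip_polar F G : L2fun mu F -> L2fun mu G ->
  rip F G = (rip (fun t => F t + G t) (fun t => F t + G t) - rip F F - rip G G) / 2.
Proof.
move=> FL GL; rewrite /rip -!sumrB mulr_suml; apply: eq_bigr => A _.
rewrite -!sumrB mulr_suml; apply: eq_bigr => c _.
have fL := FL A c; have gL := GL A c.
have -> : cl_coord A c \o (fun t => F t + G t) = (cl_coord A c \o F) + (cl_coord A c \o G).
  by apply/funext => t; exact: cl_coordD.
have fgL := L2D fL gL.
move: fL gL fgL; set u := cl_coord A c \o F; set v := cl_coord A c \o G => fL gL fgL.
by rewrite ipDl// ![ip mu _ (u + v)]ipC !ipDl// [ip mu v u]ipC; field.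
Qed.

Lemma ae_cl_coord F G :
  (forall A c, {ae mu, forall t, cl_coord A c (F t) = cl_coord A c (G t)}) ->
  {ae mu, forall t, F t = G t}.
Proof.
move=> FG; have FF := ae_filter_ringOfSetsType mu.
have all_coord : \forall t \near almost_everywhere mu,
    forall i : {set 'I_m} * bool, cl_coord i.1 i.2 (F t) = cl_coord i.1 i.2 (G t).
  by apply: filter_forall => i; exact: FG.
apply: filterS all_coord => t H; apply: cl_coordP => A c; exact: (H (A, c)).
Qed.

End CliffordL2.

(** * Energy identities and the properties of V *)

Section Energies.
Context {R : realType} {m : nat}.
Local Notation Cl := (clifford R m).
Local Notation tp := (@torus_point R m).
Variable kap : nat -> 'rV[int]_m.
Hypothesis kap_inj : injective kap.
Hypothesis kap_surj : forall p, exists n, kap n = p.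
Implicit Types (f g : 'rV[R]_m -> Cl) (F : R -> 'rV[R]_m -> Cl) (A : {set 'I_m}) (c : bool).
Local Notation q := (sqn kap : nat -> R).
Local Notation knorm := (knorm kap : nat -> R).
Local Notation ccoef := (ccoef kap).
Local Notation sigma := (neg_index kap_surj).

Lemma sum_nneseries (h : {set 'I_m} -> bool -> nat -> R) : (forall A c l, 0 <= h A c l) ->
  (\sum_A \sum_c \sum_(l <oo) (h A c l)%:E = \sum_(l <oo) (\sum_A \sum_c h A c l)%:E)%E.
Proof.
move=> h0; under eq_bigr => A _.
  rewrite -nneseries_sum; last by move=> c l _; rewrite lee_fin.
  over.
rewrite -nneseries_sum; last by move=> A l _; apply: sume_ge0 => c _; rewrite lee_fin.
apply: eq_eseriesr => l _; rewrite -sumEFin; apply: eq_bigr => A _.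
by rewrite -sumEFin.
Qed.

Lemma cl_rdotE (u : Cl) : cl_rdot u u = \sum_A \sum_c cl_coord A c u ^+ 2.
Proof. by apply: eq_bigr => A _; apply: eq_bigr => c _; rewrite expr2. Qed.

Lemma cl_rdot_ge0 (u : Cl) : 0 <= cl_rdot u u.
Proof.
by rewrite cl_rdotE; apply: sumr_ge0 => A _; apply: sumr_ge0 => c _; exact: sqr_ge0.
Qed.

Lemma torus_energy f : L2torus f ->
  energy (haar R m) (on_torus f) = (\sum_(l <oo) (cl_rdot (ccoef f l) (ccoef f l))%:E)%E.
Proof.
move=> fL; transitivity (\sum_A \sum_c \sum_(l <oo) (cl_coord A c (ccoef f l) ^+ 2)%:E)%E.
  apply: eq_bigr => A _; apply: eq_bigr => c _.
  apply: etrans (torus_parseval kap_inj kap_surj (L2torus_coord A c fL).2) _.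
  by apply: eq_eseriesr => l _; rewrite cl_coord_ccoef.
rewrite sum_nneseries => [|A c l]; last exact: sqr_ge0.
by apply: eq_eseriesr => l _; rewrite cl_rdotE.
Qed.

(** For k nonzero the unit vector preserves norms; for k = 0 [cl_unit] vanishes, but so does the
    factor exp 0 - 1. *)
Lemma cl_rdot_unit n (u : Cl) :
  (expR (q n) - 1) / 2 * cl_rdot (cl_unit kap n u) (cl_unit kap n u) =
  (expR (q n) - 1) / 2 * cl_rdot u u.
Proof.
have [r0|r0] := eqVneq (knorm n) 0.
  by rewrite -(knorm_sqr kap n) r0 expr0n expR0 subrr !mul0r.
congr (_ * _); rewrite /cl_unit cl_rdotZl cl_rdotC cl_rdotZl cl_rdot_vec.
by rewrite -/(sqn kap n : R) -(knorm_sqr kap n : _ = q n) expr2 -!mulrA !mulKf.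
Qed.

(** The cosh part contributes (exp |k|^2 + 1) / 2 times the squared norm of c_k, the sinh part (exp
    |k|^2 - 1) / 2 times that of c_(-k). Since |- k| = |k|, reindexing the second sum makes the
    factors add up to exp |k|^2. *)
Lemma cylinder_energy F : monogenic F ->
  energy (cylinder_measure R m) (on_cylinder F) =
  (\sum_(l <oo) (expR (q l) * cl_rdot (ccoef (F 0) l) (ccoef (F 0) l))%:E)%E.
Proof.
move=> mF; pose P := ccoef (F 0); pose B l := cl_unit kap l (P (sigma l)).
have e1 l : 1 <= expR (q l) by rewrite -expR0 ler_expR sqn_ge0.
have al0 l : 0 <= (expR (q l) + 1) / 2 by have := e1 l; lra.
have be0 l : 0 <= (expR (q l) - 1) / 2 by have := e1 l; lra.
transitivity (\sum_A \sum_c \sum_(l <oo) (wave_energy kap (fun l => cl_coord A c (P l))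
    (fun l => cl_coord A c (B l)) l)%:E)%E.
  apply: eq_bigr => A _; apply: eq_bigr => c _; have [_ CF _] := mF; have [cg _] := CF A c.
  apply: (@cylinder_parseval R m kap kap_inj kap_surj (cl_coord A c \o (fun z => F z.1 z.2))).
  - by move=> z; exact: cg.
  - by move=> x0; have [] := monogenic_slice x0 A c mF.
  - by move=> x0 l; have := monogenic_coefE kap_inj kap_surj A c x0 l mF; rewrite cl_coord_ccoef.
rewrite sum_nneseries => [|A c l]; last first.
  by rewrite addr_ge0// mulr_ge0// sqr_ge0.
transitivity (\sum_(l <oo) (((expR (q l) + 1) / 2 * cl_rdot (P l) (P l))%:E +
    ((expR (q (sigma l)) - 1) / 2 * cl_rdot (P (sigma l)) (P (sigma l)))%:E))%E.
  apply: eq_eseriesr => l _; rewrite -EFinD; congr EFin.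
  have -> : q (sigma l) = q l.
    by rewrite /sqn kap_neg_index; apply: eq_bigr => j _; rewrite mxE mulrNz sqrrN.
  rewrite -cl_rdot_unit !cl_rdotE !mulr_sumr -big_split; apply: eq_bigr => A _.
  by rewrite !mulr_sumr -big_split.
rewrite nneseriesD; last 2 first.
- by move=> l _ _; rewrite lee_fin mulr_ge0// cl_rdot_ge0.
- by move=> l _ _; rewrite lee_fin mulr_ge0// cl_rdot_ge0.
pose h l := ((expR (q l) - 1) / 2 * cl_rdot (P l) (P l))%:E.
have h0 l : (0 <= h l)%E by rewrite lee_fin mulr_ge0// cl_rdot_ge0.
rewrite (nneseries_neg_index kap_inj kap_surj h0) -nneseriesD//; last first.
  by move=> l _ _; rewrite lee_fin mulr_ge0// cl_rdot_ge0.
by apply: eq_eseriesr => l _; rewrite -EFinD; congr EFin; field.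
Qed.

(** Here the two normalizations meet: the time-1 heat factor exp (- |k|^2 / 2), squared, cancels the
    moment exp |k|^2 of the Gaussian with density proportional to exp (- x0^2). *)
Lemma V_energy f : L2torus f ->
  energy (cylinder_measure R m) (on_cylinder (V f)) = energy (haar R m) (on_torus f).
Proof.
move=> fL; rewrite (cylinder_energy (V_monogenic kap_inj kap_surj fL)) torus_energy//.
apply: eq_eseriesr => l _; congr EFin.
rewrite (ccoef_V0 kap_inj kap_surj)// cl_rdotZl cl_rdotC cl_rdotZl !mulrA -!expRD.
by rewrite (_ : _ + _ + _ = 0) ?expR0 ?mul1r//; field.
Qed.

Lemma measurable_monogenic F A c : monogenic F ->
  measurable_fun setT (cl_coord A c \o on_cylinder F).
Proof.
move=> [_ CF _]; have [cg _] := CF A c.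
apply: (measurable_fun_cylinder (Phi := cl_coord A c \o (fun z => F z.1 z.2))).
by move=> z; exact: cg.
Qed.

Lemma V_ML2 f : L2torus f -> ML2 (V f).
Proof.
move=> fL; have mV := V_monogenic kap_inj kap_surj fL; split => //.
apply: L2fun_energy => [A c|]; first exact: measurable_monogenic.
by rewrite V_energy// energy_rip ?ltry//; exact: fL.2.
Qed.

Lemma L2torus_linear (a : R[i]) f g : L2torus f -> L2torus g -> L2torus (a *: f + g).
Proof.
move=> fL gL; split; last exact: (L2fun_linear a fL.2 gL.2).
by move=> j x; rewrite !fctE (fL.1 j x) (gL.1 j x).
Qed.

Lemma ccoef_linear (a : R[i]) f g n : L2torus f -> L2torus g ->
  ccoef (a *: f + g) n = a *: ccoef f n + ccoef g n.
Proof.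
move=> fL gL; apply: cl_coordP => A c.
have fA c' := (L2torus_coord A c' fL).2; have gA := (L2torus_coord A c gL).2.
rewrite cl_coordD cl_coordZc !cl_coord_ccoef.
rewrite (_ : cl_coord A c \o (a *: f + g) = cl_coord A c \o (fun x => a *: f x + g x))//.
rewrite cl_coord_linear coefD; last 2 first.
- exact: (L2Z _ (fA c)).
- exact: (L2D (L2Z _ (fA (~~ c))) gA).
rewrite coefD//; last exact: (L2Z _ (fA (~~ c))).
by rewrite !coefZ// addrA.
Qed.

Lemma cl_pair_linear w (a : R[i]) (u u' v v' : nat -> Cl) x : weight kap w ->
  cl_tempered kap u -> cl_tempered kap u' -> cl_tempered kap v -> cl_tempered kap v' ->
  cl_pair kap w (fun n => a *: u n + v n) (fun n => a *: u' n + v' n) x =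
  a *: cl_pair kap w u u' x + cl_pair kap w v v' x.
Proof.
move=> ww tu tu' tv tv'; apply: cl_coordP => A c.
rewrite cl_coordD cl_coordZc !cl_coord_pair -addrA.
have tD (s : R) (y z : nat -> Cl) : cl_tempered kap y -> cl_tempered kap z ->
    tempered kap (fun n => s * cl_coord A (~~ c) (y n) + cl_coord A c (z n)).
  move=> ty tz; apply: temperedD; last exact: tz.
  by apply: temperedZ; exact: (ty A (~~ c)).
pose s := if c then complex.Im a else - complex.Im a.
rewrite -pair_seriesD//; last 4 first.
- exact: (tu A (~~ c)).
- exact: (tu' A (~~ c)).
- exact: (tv A c).
- exact: (tv' A c).
rewrite -pair_seriesD//; last 4 first.
- exact: (tu A c).
- exact: (tu' A c).
- exact: tD.
- exact: tD.
by apply: eq_pair_series => n; rewrite cl_coordD cl_coordZc addrA.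
Qed.

Lemma half_wave_linear (s : R) (a : R[i]) (u v : nat -> Cl) z : `|s| <= 1 ->
  cl_tempered kap u -> cl_tempered kap v ->
  half_wave kap s (fun n => a *: u n + v n) z = a *: half_wave kap s u z + half_wave kap s v z.
Proof.
move=> s1 tu tv; have uu := cl_tempered_unit kap_inj tu; have uv := cl_tempered_unit kap_inj tv.
have tZ (t : R) y : cl_tempered kap y -> cl_tempered kap (fun n => t%:C%C *: y n).
  by move=> ty; exact: cl_temperedZ.
have sC (t : R[i]) (y : Cl) : t *: (a *: y) = a *: (t *: y) by rewrite !scalerA mulrC.
rewrite -cl_pair_linear; [|exact: wave_weightP|exact: tZ|exact: tZ|exact: tZ|exact: tZ].
apply: eq_cl_pair => n; first by rewrite scalerDr sC.
by rewrite /cl_unit mulrDr -scalerAr !scalerDr !(sC _ (cl_vec _ * _)) sC.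
Qed.

Lemma wave_cl_linear (a : R[i]) (u v : nat -> Cl) z :
  cl_tempered kap u -> cl_tempered kap v ->
  wave_cl kap (fun n => a *: u n + v n) z = a *: wave_cl kap u z + wave_cl kap v z.
Proof.
by move=> tu tv; rewrite /wave_cl !half_wave_linear ?normrN1 ?normr1// scalerDr addrACA.
Qed.

Lemma V_linear (a : R[i]) f g : L2torus f -> L2torus g -> V (a *: f + g) = a *: V f + V g.
Proof.
move=> fL gL; rewrite !(V_wave_cl kap_inj kap_surj)//; last exact: L2torus_linear.
apply/funext => x0; apply/funext => x.
rewrite (_ : ccoef (a *: f + g) = fun n => a *: ccoef f n + ccoef g n); last first.
  by apply/funext => n; exact: ccoef_linear.
by rewrite wave_cl_linear//; exact: cl_tempered_ccoef.
Qed.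

(** The slice x0 = 0 of V f recovers the coefficients of [f], up to the nonzero heat factors. *)
Lemma V_eq_ccoef f g : L2torus f -> L2torus g -> V f = V g <-> ccoef f =1 ccoef g.
Proof.
have c0 n : (expR (- (q n / 2)))%:C%C != 0 :> R[i].
  by rewrite eq_complex /= eqxx andbT gt_eqF// expR_gt0.
move=> fL gL; split; last first.
  by move=> /funext e; rewrite (V_wave_cl kap_inj kap_surj fL) (V_wave_cl kap_inj kap_surj gL) e.
move=> e n; apply: (scalerI (c0 n)); apply: etrans (esym (ccoef_V0 kap_inj kap_surj n fL)) _.
apply: etrans (ccoef_V0 kap_inj kap_surj n gL).
exact: (congr1 (fun F => ccoef (F 0) n) e).
Qed.

Lemma ccoef_ae f g : L2torus f -> L2torus g ->
  ccoef f =1 ccoef g <-> {ae haar R m, forall t, on_torus f t = on_torus g t}.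
Proof.
move=> fL gL; have iff A c := coef_ae kap_surj
  (L2torus_coord A c fL).2 (L2torus_coord A c gL).2.
split=> [e|e n].
  apply: ae_cl_coord => A c; apply/(iff A c) => n.
  by rewrite -!cl_coord_ccoef e.
apply: cl_coordP => A c; rewrite !cl_coord_ccoef; have [+ _] := iff A c; apply.
have FF := ae_filter_ringOfSetsType (haar R m).
by apply: filterS e => t /= e; exact: (congr1 (cl_coord A c) e).
Qed.

Lemma V_rip f g : L2torus f -> L2torus g ->
  rip (cylinder_measure R m) (on_cylinder (V f)) (on_cylinder (V g)) =
  rip (haar R m) (on_torus f) (on_torus g).
Proof.
move=> fL gL.
have sq h : L2torus h -> rip (cylinder_measure R m) (on_cylinder (V h)) (on_cylinder (V h)) =
    rip (haar R m) (on_torus h) (on_torus h).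
  move=> hL; apply: EFin_inj; rewrite -!energy_rip ?V_energy//; first exact: hL.2.
  exact: (V_ML2 hL).2.
rewrite (rip_polar fL.2 gL.2) (rip_polar (V_ML2 fL).2 (V_ML2 gL).2).
have fgL := L2torus_linear 1 fL gL.
have := sq _ fgL; rewrite V_linear// => e.
have oc : on_cylinder (1 *: V f + V g) = fun t => on_cylinder (V f) t + on_cylinder (V g) t.
  by apply/funext => t; rewrite -[LHS]/(1 *: on_cylinder (V f) t + on_cylinder (V g) t) scale1r.
have ot : on_torus (1 *: f + g) = fun t => on_torus f t + on_torus g t.
  by apply/funext => t; rewrite -[LHS]/(1 *: on_torus f t + on_torus g t) scale1r.
rewrite oc ot in e.
have congr_polar (x x' y y' z z' : R) : x = x' -> y = y' -> z = z' ->
    (x - y - z) / 2 = (x' - y' - z') / 2 by move=> -> -> ->.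
exact: congr_polar e (sq f fL) (sq g gL).
Qed.

(** The real part is [V_rip]; the imaginary part is [V_rip] for [i g], because V commutes with
    multiplication by i. *)
Lemma V_isometry f g : L2torus f -> L2torus g ->
  L2dot (cylinder_measure R m) (on_cylinder (V f)) (on_cylinder (V g)) =
  L2dot (haar R m) (on_torus f) (on_torus g).
Proof.
move=> fL gL; rewrite (L2dotE fL.2 gL.2) (L2dotE (V_ML2 fL).2 (V_ML2 gL).2).
have igL := L2torus_linear ('i%C - 1) gL gL; have iV := V_linear ('i%C - 1) gL gL.
rewrite !scalerBl !scale1r !subrK in igL iV.
congr Complex; first exact: V_rip.
have := V_rip fL igL; rewrite iV => e; exact: e.
Qed.

(** V f and F share their coefficients at x0 = 0, hence at every x0 by [monogenic_coefE], and
    [coef_ext] then gives equality at every point of each slice. *)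
Lemma V_onto F : ML2 F -> exists2 f, L2torus f & V f = F.
Proof.
move=> [mF FL]; pose P l : Cl := (expR (q l / 2))%:C%C *: ccoef (F 0) l.
have sumP : (\sum_(l <oo) (cl_rdot (P l) (P l))%:E < +oo)%E.
  have : (energy (cylinder_measure R m) (on_cylinder F) < +oo)%E by rewrite energy_rip// ltry.
  rewrite cylinder_energy//; congr (_ < _)%E; apply: eq_eseriesr => l _; congr EFin.
  rewrite /P cl_rdotZl cl_rdotC cl_rdotZl mulrA -expRD; congr (expR _ * _).
  by field.
have cvgP A c : cvgn (series (fun l => cl_coord A c (P l) ^+ 2)).
  apply: nondecreasing_is_cvgn.
    by apply: nondecreasing_series => l _ _; exact: sqr_ge0.
  exists (fine (\sum_(l <oo) (cl_rdot (P l) (P l))%:E)%E) => _ [N _ <-].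
  have S0 : (0 <= \sum_(l <oo) (cl_rdot (P l) (P l))%:E)%E.
    by apply: nneseries_ge0 => l _ _; rewrite lee_fin cl_rdot_ge0.
  rewrite -lee_fin fineK ?ge0_fin_numE// /series /= -sumEFin.
  apply: le_trans (nneseries_lim_ge N _); last by move=> l _; rewrite lee_fin cl_rdot_ge0.
  apply: lee_sum => l _; rewrite lee_fin cl_rdotE (bigD1 A)//= (bigD1 c)//= -addrA lerDl.
  rewrite addr_ge0//; first by apply: sumr_ge0 => c' _; exact: sqr_ge0.
  by apply: sumr_ge0 => A' _; apply: sumr_ge0 => c' _; exact: sqr_ge0.
(* Riesz-Fischer is applied to each real coordinate, and [cid] turns the existence statements into
   functions from which [f] is assembled. *)
have rf A c := cid (coef_riesz_fischer kap_inj (cvgP A c)).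
pose phi A c := projT1 (rf A c).
have phiP A c : [/\ rperiodic (phi A c), (phi A c \o tp) \in Lfun (haar R m) 2%:E &
    coef kap (phi A c) =1 (fun l => cl_coord A c (P l))] := projT2 (rf A c).
pose f x : Cl := [ffun A => Complex (phi A false x) (phi A true x)].
have fE A c : cl_coord A c \o f = phi A c.
  by apply/funext => x; rewrite /= /cl_coord ffunE; case: c.
have fL : L2torus f.
  split; last by move=> A c; have [_ + _] := phiP A c; rewrite -fE.
  move=> j x; apply: cl_coordP => A c; have [+ _ _] := phiP A c; rewrite -fE => p.
  exact: (p j x).
exists f => //; have mV := V_monogenic kap_inj kap_surj fL.
have e0 l : ccoef (V f 0) l = ccoef (F 0) l.
  rewrite (ccoef_V0 kap_inj kap_surj)//.
  have -> : ccoef f l = P l.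
    by apply: cl_coordP => A c; rewrite cl_coord_ccoef fE; have [_ _ ->] := phiP A c.
  by rewrite /P scalerA -rmorphM -expRD addNr expR0 rmorph1 scale1r.
apply/funext => x0; apply/funext => x; apply: cl_coordP => A c.
have [p1 c1] := monogenic_slice x0 A c mV; have [p2 c2] := monogenic_slice x0 A c mF.
have e : cl_coord A c \o V f x0 = cl_coord A c \o F x0.
  apply: (coef_ext kap_surj p1 c1 p2 c2) => l.
  rewrite -!cl_coord_ccoef (monogenic_coefE kap_inj kap_surj A c x0 l mV).
  by rewrite (monogenic_coefE kap_inj kap_surj A c x0 l mF) !e0.
exact: (congr1 (@^~ x) e).
Qed.

End Energies.

(** * Enumeration of the lattice and conclusion *)

Lemma lattice_enumeration (m : nat) : (0 < m)%N ->
  exists kap : nat -> 'rV[int]_m, injective kap /\ forall p, exists n, kap n = p.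
Proof.
move=> m0; have inf : infinite_set [set: 'rV[int]_m].
  move=> fin; apply: infinite_nat.
  (* The constant vectors embed nat into the lattice, as there is at least one coordinate. *)
  have := @finite_preimage _ _ _ (fun n : nat => const_mx n%:Z : 'rV[int]_m) _ fin.
  rewrite preimage_setT; apply=> x y _ _.
  by move=> /matrixP/(_ 0 (Ordinal m0)); rewrite !mxE => -[].
have /card_set_bijP[f [_ finj fsurj]] := eq_card_nat (countableP [set: 'rV[int]_m]) inf.
have fK n : exists p, f p = n by have [p _ <-] := fsurj n I; exists p.
have kapK n : f (projT1 (cid (fK n))) = n := projT2 (cid (fK n)).
exists (fun n => projT1 (cid (fK n))); split=> [x y e|p].
  by rewrite -[LHS]kapK e kapK.
by exists (f p); apply: finj; rewrite ?in_setT// kapK.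
Qed.

Theorem theorem4p3 (R : realType) (m : nat) (hm : (0 < m)%N) :
  (* the constituents of V f are well defined *)
  (forall f : 'rV[R]_m -> clifford R m, L2torus f ->
     [/\ exists h, heat_solution f h,
         forall h h', heat_solution f h -> heat_solution f h' ->
           forall t, 0 < t -> h t = h' t,
         forall k, cl_Ck setT k (exp_half_laplacian f)
       & forall x0 x, cl_cvgn (exp_dirac_psum x0 (exp_half_laplacian f) x)]) /\
  (* V maps L^2 classes into ML^2; it is linear, isometric, and onto *)
  [/\ forall f : 'rV[R]_m -> clifford R m, L2torus f -> ML2 (V f),
      forall f g : 'rV[R]_m -> clifford R m, L2torus f -> L2torus g ->
        (V f = V g <-> {ae haar R m, forall t, on_torus f t = on_torus g t}),
      forall (a : R[i]) (f g : 'rV[R]_m -> clifford R m),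
        L2torus f -> L2torus g -> V (a *: f + g) = a *: V f + V g,
      forall f g : 'rV[R]_m -> clifford R m, L2torus f -> L2torus g ->
        L2dot (cylinder_measure R m) (on_cylinder (V f)) (on_cylinder (V g)) =
        L2dot (haar R m) (on_torus f) (on_torus g)
    & forall F : R -> 'rV[R]_m -> clifford R m, ML2 F ->
        exists2 f : 'rV[R]_m -> clifford R m, L2torus f & V f = F].
Proof.
have [kap [ki ks]] := lattice_enumeration hm.
split=> [f fL|]; last first.
  split.
  - by move=> f fL; exact: (V_ML2 ki ks).
  - move=> f g fL gL; split.
      by move=> /(V_eq_ccoef ki ks fL gL)/(ccoef_ae ks fL gL).
    by move=> /(ccoef_ae ks fL gL)/(V_eq_ccoef ki ks fL gL).
  - by move=> a f g fL gL; exact: (V_linear ki ks).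
  - by move=> f g fL gL; exact: (V_isometry ki ks).
  - by move=> F FL; exact: (V_onto ki ks).
split.
- by exists (heat_cl kap f); exact: heat_cl_solution.
- by move=> h h' sh sh' t t0; exact: (heat_solution_unique ki ks fL sh sh').
- move=> k A b; rewrite (exp_half_laplacianE ki ks fL).
  rewrite (_ : _ \o _ = pair_series kap (heat_weight kap 1) (coef kap (cl_coord A b \o f)) (fun=> 0)).
    apply: Ck_pair_series => //; [exact: weight_gauss| |exact: tempered0].
    exact: (coef_tempered ki (L2torus_coord A b fL).2).
  by apply/funext => x; exact: cl_coord_heat.
- move=> x0 x A b; rewrite (exp_half_laplacianE ki ks fL).
  by apply: cvgP; apply: exp_dirac_cvg => //; exact: cl_tempered_ccoef.
Qed.
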